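(* Let $\nu$ be a symmetric Lévy measure on $\mathbb{R}^d$ with $\nu(\mathbb{R}^d)=\infty$, and assume that $P_t$ has a transition density $p_t$ for all $t>0$. If, for some $r_0>0$, $\operatorname{supp}\nu\subset B(0,r_0)$, then $$p_t(x)\le e^{-\frac{|x|}{4r_0}\log\left(\frac{r_0|x|}{2tm_0}\right)}\,p_t(0)\qquad\text{for } t>0,\ |x|\ge\frac{2em_0}{r_0}\,t,$$ where $m_0=\int|y|^2\,\nu(dy)$. If additionally there exist constants $M_5,M_6>0$ such that $$\int|y|^2e^{|\xi||y|}\,\nu(dy)\le M_5\qquad\text{for } |\xi|\le M_6,$$ then $$p_t(x)\le e^{-\frac{|x|^2}{4tM_5}}\,p_t(0)\qquad\text{for } t>0,\ |x|\le2M_5M_6\,t.$$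
   Context: $d\in\{1,2,\dots\}$; $B(x,r)$ is the ball with center $x$ and radius $r$. A symmetric Lévy measure on $\mathbb{R}^d$ is a Borel measure $\nu$ with $\nu(\{0\})=0$, $\int_{\mathbb{R}^d}(1\wedge|y|^2)\,\nu(dy)<\infty$ and $\nu(-D)=\nu(D)$ for all Borel $D\subset\mathbb{R}^d$. $\{P_t\}_{t\ge0}$ is the convolution semigroup of probability measures on $\mathbb{R}^d$ with $\int_{\mathbb{R}^d} e^{i\xi\cdot y}P_t(dy)=e^{-t\Phi(\xi)}$, where $\Phi(\xi)=\int_{\mathbb{R}^d}(1-\cos(\xi\cdot y))\,\nu(dy)$, $\xi\in\mathbb{R}^d$. A transition density $p_t$ of $P_t$ is a density of $P_t$ with respect to Lebesgue measure on $\mathbb{R}^d$.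
   Formalization: The densities p_t (values in [0,∞]) are assumed to satisfy p_{s+t}(x) = ∫ p_s(x−y) p_t(y) dy at every x; for an arbitrary density the pointwise bound fails (change p_t at 0), and such a version always exists when all P_t have densities. *)

(* Defs.v *)
From HB Require Import structures.
From mathcomp Require Import all_boot all_order all_algebra.
From mathcomp Require Import all_classical all_reals all_analysis.
From mathcomp Require Import measurable_realfun.

Set Implicit Arguments.
Unset Strict Implicit.
Unset Printing Implicit Defensive.

Import Order.TTheory GRing.Theory Num.Theory.
Import numFieldNormedType.Exports.

Local Open Scope classical_set_scope.
Local Open Scope ring_scope.

(* R^n is 'rV[R]_n.  The library's norm `|x| on 'rV[R]_n is the maximum norm,
   which gives the right topology but not the Euclidean length; the latter is
   enorm. *)

Section euclidean_space.
Context {R : realType} {n : nat}.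
Implicit Types (x y : 'rV[R]_n) (r : R).

Definition dotv x y : R := \sum_(i < n) x ord0 i * y ord0 i.

Definition enorm x : R := Num.sqrt (dotv x x).

Definition eball x r : set 'rV[R]_n := [set y | enorm (y - x) < r].

End euclidean_space.

Definition rV_borel_display : measure_display.
Proof. exact: default_measure_display. Qed.

Section borel_rV.
Context {R : realType} {n : nat}.

Definition rV_borel : set (set 'rV[R]_n) := <<s @open 'rV[R]_n >>.

Let rV_borel0 : rV_borel set0.
Proof. exact: sigma_algebra0. Qed.

Let rV_borelC A : rV_borel A -> rV_borel (~` A).
Proof. exact: sigma_algebraC. Qed.

Let rV_borel_bigcup (F : (set 'rV[R]_n)^nat) :
  (forall i, rV_borel (F i)) -> rV_borel (\bigcup_i F i).
Proof. exact: sigma_algebra_bigcup. Qed.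

HB.instance Definition _ := @isMeasurable.Build rV_borel_display
  'rV[R]_n rV_borel rV_borel0 rV_borelC rV_borel_bigcup.

End borel_rV.

Section measurable_rV.
Context {R : realType} {n : nat}.

Lemma measurable_coord (i : 'I_n) :
  measurable_fun [set: 'rV[R]_n] (fun x : 'rV[R]_n => x ord0 i).
Proof.
apply: (measurability _ (RGenOpens.measurableE R)).
move=> _ [_ [a [b ->]] <-]; rewrite setTI; apply: sub_sigma_algebra.
by apply: open_comp (interval_open _ _) => // x _; exact: coord_continuous.
Qed.

Let box (c : 'rV[rat]_n * nat) : set 'rV[R]_n :=
  \bigcap_(i in [set: 'I_n])
    [set x | ball (ratr (c.1 ord0 i) : R) c.2.+1%:R^-1 (x ord0 i)].

Lemma measurable_fun_rVP d (T : measurableType d) (f : T -> 'rV[R]_n) :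
  (forall i, measurable_fun setT (fun t => f t ord0 i)) ->
  measurable_fun setT f.
Proof.
move=> mf; apply: (measurability (@open 'rV[R]_n)) => // _ [U oU <-].
rewrite setTI.
have mbox c : measurable (f @^-1` box c).
  rewrite /box preimage_bigcap; apply: fin_bigcap_measurable => // i _.
  have := mf i measurableT _ (measurable_ball (ratr (c.1 ord0 i)) c.2.+1%:R^-1).
  by rewrite setTI.
pose F k := if @unpickle ('rV[rat]_n * nat)%type k is Some c then
  if pselect (box c `<=` U) then box c else set0 else set0.
rewrite (_ : U = \bigcup_k F k).
  rewrite preimage_bigcup; apply: bigcup_measurable => k _.
  rewrite /F; case: unpickle => [c|]; last by rewrite preimage_set0.
  by case: pselect => [bU|nbU]; [exact: mbox|rewrite preimage_set0].
apply/seteqP; split=> [x Ux|x [k _]]; last first.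
  by rewrite /F; case: unpickle => [c|//]; case: pselect => [bU /bU|//].
have /nbhs_ballP[e /= e0 xeU] : nbhs x U by apply: open_nbhs_nbhs.
have e20 : 0 < e / 2 by rewrite divr_gt0.
have [k _ /(_ k (leqnn _)) /= ke] := near_infty_natSinv_lt (PosNum e20).
have k0 : 0 < k.+1%:R^-1 :> R by rewrite invr_gt0.
have rx i : exists q : rat, ball (ratr q : R) k.+1%:R^-1 (x ord0 i).
  have [|q] := @rat_in_itvoo R (x ord0 i - k.+1%:R^-1) (x ord0 i + k.+1%:R^-1).
    by rewrite ltrD2l gtrN.
  rewrite in_itv /= => qx; exists q.
  by rewrite /ball /= distrC ltr_distlC.
have [q qx] := choice rx.
pose c : 'rV[rat]_n * nat := (\row_i q i, k).
have bx : box c x by move=> i _ /=; rewrite mxE; exact: qx.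
have bU : box c `<=` U.
  move=> y by_; apply: xeU; split=> // i j; rewrite (ord1 i).
  have b1 : ball (ratr (q j) : R) (e / 2) (x ord0 j).
    exact: le_ball (ltW ke) _ (qx j).
  have b2 : ball (ratr (q j) : R) (e / 2) (y ord0 j).
    apply: le_ball (ltW ke) _ _.
    by have := by_ j I; rewrite /= mxE.
  by rewrite (splitr e); exact: ball_triangle (ball_sym b1) b2.
by exists (pickle c) => //; rewrite /F pickleK; case: pselect.
Qed.

End measurable_rV.

Section lebesgue_measure_rV.
Context {R : realType}.

Section step.
Context {n : nat}.
Local Open Scope ereal_scope.

Definition rV_cons (z : R * 'rV[R]_n) : 'rV[R]_n.+1 :=
  row_mx (const_mx z.1 : 'rV_1) z.2.

Let rV_uncons (v : 'rV[R]_n.+1) : R * 'rV[R]_n :=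
  (v ord0 ord0, rsubmx (v : 'rV_(1 + n))).

Let rV_consK : cancel rV_cons rV_uncons.
Proof.
case=> a v; rewrite /rV_cons /rV_uncons row_mxKr; congr pair.
transitivity (row_mx (const_mx a : 'rV_1) v ord0 (lshift n ord0)).
  by congr (row_mx _ _ _ _); exact/val_inj.
by rewrite row_mxEl mxE.
Qed.

Lemma measurable_rV_cons : measurable_fun setT rV_cons.
Proof.
apply: measurable_fun_rVP => i.
case: (@split_ordP 1 n i) => j ->.
  rewrite (_ : (fun _ => _) = fst) //; apply/funext => z.
  by rewrite [LHS](row_mxEl (const_mx z.1 : 'rV_1)) mxE.
rewrite (_ : (fun _ => _) = (fun v : 'rV[R]_n => v ord0 j) \o snd).
  exact: measurableT_comp (measurable_coord j) _.
by apply/funext => z; rewrite [LHS](row_mxEr (const_mx z.1 : 'rV_1)).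
Qed.

Let measurable_rV_uncons : measurable_fun setT rV_uncons.
Proof.
apply: measurable_fun_pair; first exact: measurable_coord.
apply: measurable_fun_rVP => i; under eq_fun do rewrite mxE.
exact: measurable_coord.
Qed.

Variable mu : {sigma_finite_measure set 'rV[R]_n -> \bar R}.

Definition lebesgue_rV_step : set 'rV[R]_n.+1 -> \bar R :=
  pushforward (lebesgue_measure \x mu) rV_cons.

Let step0 : lebesgue_rV_step set0 = 0.
Proof. by rewrite /lebesgue_rV_step /pushforward preimage_set0 measure0. Qed.

Let step_ge0 A : 0 <= lebesgue_rV_step A.
Proof. exact: (measure_ge0 (lebesgue_measure \x mu)). Qed.

Let step_sigma_additive : semi_sigma_additive lebesgue_rV_step.
Proof.
have mc := measurable_rV_cons.
rewrite /lebesgue_rV_step; exact: measure_semi_sigma_additive.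
Qed.

HB.instance Definition _ := isMeasure.Build _ _ _ lebesgue_rV_step
  step0 step_ge0 step_sigma_additive.

Let step_sigma_finite : sigma_finite setT lebesgue_rV_step.
Proof.
have /sigma_finiteP[F [FT ndF Foo]] := sigma_finiteT (@lebesgue_measure R).
have /sigma_finiteP[G [GT ndG Goo]] := sigma_finiteT mu.
exists (fun k => rV_uncons @^-1` (F k `*` G k)).
  rewrite -preimage_bigcup (_ : \bigcup_k _ = setT) ?preimage_setT//.
  rewrite -subTset -setXTT FT GT => -[x y] /= [[k _ Fkx] [l _ Gly]].
  exists (maxn k l) => //; split => /=.
  - by move: x Fkx; exact/subsetPset/ndF/leq_maxl.
  - by move: y Gly; exact/subsetPset/ndG/leq_maxr.
move=> k; have [mF Fk] := Foo k; have [mG Gk] := Goo k.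
have mFG : measurable (F k `*` G k) by exact: measurableX.
split; first by rewrite -[X in measurable X]setTI; exact: measurable_rV_uncons.
rewrite /lebesgue_rV_step /pushforward -comp_preimage.
rewrite (_ : rV_uncons \o rV_cons = id); last first.
  by apply/funext => z /=; rewrite rV_consK.
by rewrite preimage_id product_measure1E// lte_mul_pinfty// ge0_fin_numE.
Qed.

HB.instance Definition _ := Measure_isSigmaFinite.Build _ _ _
  lebesgue_rV_step step_sigma_finite.

End step.

(* Lebesgue measure on R^n, by iterated products with Lebesgue measure on R;
   for n = 0 it is the Dirac mass at the only point. *)
Fixpoint lebesgue_rV (n : nat) : {sigma_finite_measure set 'rV[R]_n -> \bar R} :=
  match n with
  | 0 => @dirac _ 'rV[R]_0 0 R
  | m.+1 => lebesgue_rV_step (lebesgue_rV m)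
  end.

End lebesgue_measure_rV.

Section levy.
Context {R : realType} {d : nat}.
Local Open Scope ereal_scope.
Implicit Types (nu mu : {measure set 'rV[R]_d -> \bar R}).
Implicit Types (P : R -> probability 'rV[R]_d R) (p : R -> 'rV[R]_d -> \bar R).

Definition symmetric_levy_measure nu : Prop :=
  [/\ nu [set 0%R] = 0,
      \int[nu]_y (Num.min 1 (enorm y ^+ 2))%:E < +oo &
      forall D : set 'rV[R]_d, measurable D -> nu (-%R @` D) = nu D].

Definition measure_support mu : set 'rV[R]_d :=
  [set x | forall U : set 'rV[R]_d, open U -> U x -> 0 < mu U].

(* The integrand is nonnegative and, for a Levy measure, integrable, so the
   real-valued integral loses nothing. *)
Definition levy_exponent nu (xi : 'rV[R]_d) : R :=
  (\int[nu]_y (1 - cos (dotv xi y)))%R.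

Definition convolution (mu1 mu2 : set 'rV[R]_d -> \bar R) (A : set 'rV[R]_d) :
  \bar R := \int[mu1]_x mu2 [set y | A (x + y)%R].

(* Only the restriction of P to [0, +oo[ matters.  The equality
   \int e^{i xi.y} P_t(dy) = e^{- t Phi(xi)}, whose right-hand side is real, is
   written as the equality of the real and of the imaginary parts. *)
Definition levy_semigroup nu P : Prop :=
  [/\ forall A, measurable A -> P 0%R A = \d_(0%R : 'rV[R]_d) A,
      forall s t A, (0 <= s)%R -> (0 <= t)%R -> measurable A ->
        P (s + t)%R A = convolution (P s) (P t) A &
      forall t (xi : 'rV[R]_d), (0 <= t)%R ->
        (\int[P t]_y cos (dotv xi y) = expR (- (t * levy_exponent nu xi)))%R /\
        (\int[P t]_y sin (dotv xi y) = 0)%R].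

Definition is_density (mu : set 'rV[R]_d -> \bar R) (f : 'rV[R]_d -> \bar R) :
    Prop :=
  [/\ measurable_fun setT f, forall x, 0 <= f x &
      forall A, measurable A -> mu A = \int[lebesgue_rV d]_(x in A) f x].

(* A density is only determined almost everywhere, whereas pointwise bounds,
   and the value p_t(0), refer to one version of it.  The version is fixed, as
   usual for transition densities, by requiring the Chapman-Kolmogorov equation
   at every point; this determines p, since p_{2t}(x) is then the integral of
   p_t(x - y) p_t(y), which depends only on the class of p_t.  Such a version
   exists as soon as all the P_t have densities, and it is the continuous one
   when e^{- t Phi} is integrable for all t.  In general p_t may take the value
   +oo (at 0, for small t, for the symmetric variance gamma process). *)
Definition transition_density P p : Prop :=
  (forall t, (0 < t)%R -> is_density (P t) (p t)) /\
  (forall s t x, (0 < s)%R -> (0 < t)%R ->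
     p (s + t)%R x = \int[lebesgue_rV d]_y (p s (x - y)%R * p t y)).

End levy.

(* Main.v *)
Require Import Defs.
From mathcomp Require Import all_boot all_order all_algebra.
From mathcomp Require Import all_classical all_reals all_analysis.
From mathcomp Require Import measurable_realfun ring lra.
From mathcomp Require finmap.

(* Exponential tilting (Esscher transform), carried out on Gaussian averages
   of P_t because p_t need not be bounded.  Fourier inversion writes
   \int e^{-m|x-y|^2} P_t(dy), up to a constant, as the integral of
   e^{-a|u|^2} e^{-t Phi(u)} cos(u.x), where a = 1/(4m).  Cutting nu down to a
   finite measure kappa, e^{t kappa^} is the limit of the powers
   (1 + t kappa^/k)^k of measures, for which the identity
     e^{xi.(x+y)} = e^{xi.x} e^{xi.y}
   replaces kappa by its tilt e^{xi.y} kappa; the modulus of the tilted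
   transform is maximal at the origin up to the factor
   e^{t \int (cosh(xi.y) - 1) nu(dy)}.  Letting the Gaussian concentrate gives
     p_t(x) <= e^{t \int (cosh(xi.y) - 1) nu(dy) - xi.x} p_t(0)
   at every point, since p_t = p_{t/2} * p_{t/2} is lower semicontinuous and,
   by Cauchy-Schwarz and symmetry, at most p_t(0).  Both estimates follow from
   cosh s - 1 <= s^2 e^{|s|} / 2 with xi a suitable multiple of x. *)

Set Implicit Arguments.
Unset Strict Implicit.
Unset Printing Implicit Defensive.

Import Order.TTheory GRing.Theory Num.Theory.
Import numFieldNormedType.Exports.

Local Open Scope classical_set_scope.
Local Open Scope ring_scope.

(** * Row vectors and Lebesgue measure *)

(** What is known of [P t] is a family of cosine and sine integrals, and they are used only through
    Gaussian averages, which they determine by Fubini. Even the symmetry of [P t] on Borel sets has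
    to be recovered this way: averages over reflected sets agree, and the averaging can be undone
    because [z -> P t (A + z)] is continuous when [P t] has a density. The powers [(1 + rho z)^k]
    make the tilt elementary: no complex variable is shifted, only real and imaginary parts are
    carried along. Their modulus is controlled by [|1 + rho z|^2 <= exp (2 (rho Re z + rho^2 W^2))],
    with [W] bounding both parts of [z]; for [rho = t / k] the quadratic error adds up to
    [t^2 W^2 / k] and disappears. The real part of the tilted transform exceeds [kappa^] by at most
    the integral of [cosh - 1], because symmetry turns the tilt into a hyperbolic cosine. The
    Gaussian is tilted too, at the price [exp (a |xi|^2)], which tends to 1 as [a -> 0]. *)

Section row_vectors.
Context {R : realType}.

Lemma rV_consE0 n (a : R) (v : 'rV[R]_n) : rV_cons (a, v) ord0 ord0 = a.
Proof.
rewrite /rV_cons /=.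
transitivity (row_mx (const_mx a : 'rV_1) v ord0 (lshift n ord0)).
  by congr (row_mx _ _ _ _); exact/val_inj.
by rewrite row_mxEl mxE.
Qed.

Lemma rV_consES n (a : R) (v : 'rV[R]_n) j :
  rV_cons (a, v) ord0 (lift ord0 j) = v ord0 j.
Proof.
rewrite /rV_cons /=.
transitivity (row_mx (const_mx a : 'rV_1) v ord0 (rshift 1 j)).
  by congr (row_mx _ _ _ _); exact/val_inj.
by rewrite row_mxEr.
Qed.

Definition rV_behead n (v : 'rV[R]_n.+1) : 'rV[R]_n :=
  \row_j v ord0 (lift ord0 j).

Lemma rV_cons_behead n (v : 'rV[R]_n.+1) :
  rV_cons (v ord0 ord0, rV_behead v) = v.
Proof.
apply/rowP => i; case: (unliftP ord0 i) => [j|] ->.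
  by rewrite rV_consES mxE.
by rewrite rV_consE0.
Qed.

Lemma rV_beheadK n (a : R) (v : 'rV[R]_n) : rV_behead (rV_cons (a, v)) = v.
Proof. by apply/rowP => j; rewrite mxE rV_consES. Qed.

Lemma rV_consB n (a b : R) (v w : 'rV[R]_n) :
  rV_cons (a - b, v - w) = rV_cons (a, v) - rV_cons (b, w).
Proof.
apply/rowP => i; case: (unliftP ord0 i) => [j|] ->.
  by rewrite [RHS]mxE [X in _ = _ + X]mxE !rV_consES !mxE.
by rewrite [RHS]mxE [X in _ = _ + X]mxE !rV_consE0.
Qed.

Lemma measurable_rV_behead n : measurable_fun setT (@rV_behead n).
Proof.
apply: measurable_fun_rVP => i; under eq_fun do rewrite mxE.
exact: measurable_coord.
Qed.

Lemma measurable_fun_rVB d (T : measurableType d) n (f g : T -> 'rV[R]_n) :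
  measurable_fun setT f -> measurable_fun setT g ->
  measurable_fun setT (fun x => f x - g x).
Proof.
move=> mf mg; apply: measurable_fun_rVP => i; under eq_fun do rewrite !mxE.
apply: measurable_funB.
  exact: measurableT_comp (measurable_coord i) mf.
exact: measurableT_comp (measurable_coord i) mg.
Qed.

Lemma measurable_rV_subl n (z : 'rV[R]_n) :
  measurable_fun setT (fun x : 'rV[R]_n => z - x).
Proof.
by apply: measurable_fun_rVB; [exact: measurable_cst|exact: measurable_id].
Qed.

(** For [e > 0] these cubes are the balls around 0 of the topology of ['rV[R]_n], and as products of
    intervals they have an explicit Lebesgue measure. *)
Definition rV_box n (e : R) : set 'rV[R]_n := [set x | forall i, `|x ord0 i| < e].

Lemma measurable_rV_box n e : measurable (@rV_box n e).
Proof.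
rewrite (_ : rV_box e = \bigcap_(i in [set: 'I_n])
    ((fun x : 'rV[R]_n => x ord0 i) @^-1` ball (0 : R) e)); last first.
  apply/seteqP; split=> x /= h i; first by move=> _; rewrite /ball/= sub0r normrN.
  by have := h i I; rewrite /ball/= sub0r normrN.
apply: fin_bigcap_measurable => // i _; rewrite -[X in measurable X]setTI.
by apply: measurable_coord => //; exact: measurable_ball.
Qed.

Lemma rV_box_nbhs n (e : R) : 0 < e -> nbhs (0 : 'rV[R]_n) (rV_box e).
Proof.
move=> e0; apply/nbhs_ballP; exists e => //= y [] _ ey i.
by have := ey ord0 i; rewrite /ball/= mxE sub0r normrN.
Qed.

Lemma nbhs_rV_box n (x : 'rV[R]_n) (A : set 'rV[R]_n) :
  nbhs x A -> exists2 e, 0 < e & forall z, rV_box e z -> A (x + z).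
Proof.
move=> /nbhs_ballP[e /= e0 eA]; exists e => // z ze; apply: eA.
by split=> // i j; rewrite (ord1 i) /ball/= !mxE opprD addNKr normrN.
Qed.

Lemma open_rV_box n e : open (@rV_box n e).
Proof.
rewrite openE => x xe; have [e0|e0] := ltP 0 e; last first.
  (* With [e <= 0] the cube is empty, except in dimension 0, where it is the whole space. *)
  case: n x xe => [|n] x xe.
    rewrite /interior (_ : rV_box e = setT); first exact: filterT.
    by apply/seteqP; split=> // y _ [].
  by have := xe ord0; rewrite ltNge (le_trans e0).
have [d d0 dP] : exists2 d, 0 < d & forall i, `|x ord0 i| + d <= e.
  have [i0|] := pselect (exists i : 'I_n, True); last first.
    by move=> noi; exists 1 => // i; exfalso; apply: noi; exists i.
  case: i0 => i0 _.
  exists (\big[Num.min/e]_(i < n) (e - `|x ord0 i|)).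
    by elim/big_ind: _ => // [a b a0 b0|i _]; rewrite ?lt_min ?a0//= subr_gt0.
  by move=> i; rewrite addrC -lerBrDr; exact: bigmin_le_cond.
apply/nbhs_ballP; exists d => //= y [] _ xy i.
have := xy ord0 i; rewrite /ball/= => h.
apply: lt_le_trans (dP i); rewrite -[y ord0 i](subrK (x ord0 i)) addrC.
by rewrite (le_lt_trans (ler_normD _ _))// ltrD2l distrC.
Qed.

Lemma bigcup_rV_box n : \bigcup_k rV_box k%:R = [set: 'rV[R]_n].
Proof.
apply/seteqP; split=> // x _.
exists (Num.truncn (\sum_(i < n) `|x ord0 i|)).+1 => // i.
rewrite (le_lt_trans _ (truncnS_gt _))// (bigD1 i)//= lerDl.
by apply: sumr_ge0 => j _.
Qed.

End row_vectors.

Section lebesgue_rV.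
Context {R : realType}.
Local Notation mu := (@lebesgue_measure R).
Local Notation lam n := (@lebesgue_rV R n).
Local Open Scope ereal_scope.

Lemma lebesgue_rV0 (A : set 'rV[R]_0) : lam 0%N A = \d_(0%R : 'rV[R]_0) A.
Proof. by []. Qed.

Lemma lebesgue_rVS n (A : set 'rV[R]_n.+1) :
  lam n.+1 A = (mu \x lam n) (@rV_cons R n @^-1` A).
Proof. by []. Qed.

Lemma ge0_integral_lebesgue_rVS n (f : 'rV[R]_n.+1 -> \bar R) :
  measurable_fun setT f -> (forall x, 0 <= f x) ->
  \int[lam n.+1]_x f x = \int[mu]_a \int[lam n]_v f (rV_cons (a, v)).
Proof.
move=> mf f0.
have mc : measurable_fun setT (@rV_cons R n : measurableTypeR R * 'rV[R]_n -> _).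
  exact: measurable_rV_cons.
have mfc : measurable_fun setT
    (f \o @rV_cons R n : measurableTypeR R * 'rV[R]_n -> _).
  exact: measurableT_comp.
pose M : {measure set (measurableTypeR R * 'rV[R]_n) -> \bar R} := (mu \x lam n).
transitivity (\int[M]_z (f \o @rV_cons R n) z); last first.
  exact: (@fubini_tonelli1 _ _ _ _ _ mu (lam n) _ mfc (fun z => f0 _)).
by rewrite -(ge0_integral_pushforward mc M measurableT).
Qed.

(** The form [z - x] covers reflections ([z = 0]) and is the one that convolutions produce. Lebesgue
    measure is characterised by its values on half-open intervals, whose length [x -> z - x] keeps,
    while it moves the closed endpoint to the other side. *)
Lemma ge0_integral_lebesgue_sub (z : R) (f : R -> \bar R) :
  measurable_fun setT f -> (forall x, 0 <= f x) ->
  \int[mu]_x f (z - x)%R = \int[mu]_x f x.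
Proof.
move=> mf f0.
pose phi : measurableTypeR R -> measurableTypeR R := fun x => (z - x)%R.
have mphi : measurable_fun setT phi.
  by apply: measurable_funB; [exact: measurable_cst|exact: measurable_id].
transitivity (\int[pushforward mu phi]_x f x).
  by rewrite (ge0_integral_pushforward mphi mu measurableT).
apply: eq_measure_integral => A mA _; apply/esym.
apply: lebesgue_measure_unique => //= _ [[a b]] _ <-.
rewrite /pushforward.
rewrite (_ : _ @^-1` _ = `[(z - b)%R, (z - a)%R[%classic).
  rewrite !lebesgue_measure_itv/= !lte_fin ltrD2l ltrN2.
  by case: ifP => // _; rewrite -EFinD; congr _%:E; ring.
by apply/seteqP; split=> x; rewrite /phi/= !in_itv/= => /andP[h1 h2]; apply/andP; split; lra.
Qed.

Lemma ge0_integral_rV_sub n (z : 'rV[R]_n) (f : 'rV[R]_n -> \bar R) :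
  measurable_fun setT f -> (forall x, 0 <= f x) ->
  \int[lam n]_x f (z - x)%R = \int[lam n]_x f x.
Proof.
elim: n => [|n IH] in z f *.
  by move=> *; apply: eq_integral => x _; congr f; apply/rowP => -[].
move=> mf f0.
have ms : measurable_fun setT (fun x : 'rV[R]_n.+1 => (z - x)%R).
  exact: measurable_rV_subl.
rewrite [LHS]ge0_integral_lebesgue_rVS//; last exact: (measurableT_comp mf ms).
rewrite [RHS](ge0_integral_lebesgue_rVS mf f0).
have mfc : measurable_fun setT
    (f \o @rV_cons R n : measurableTypeR R * 'rV[R]_n -> _).
  exact: (measurableT_comp mf (@measurable_rV_cons R n)).
rewrite -[RHS](@ge0_integral_lebesgue_sub (z ord0 ord0)); last 2 first.
- exact: (@measurable_fun_fubini_tonelli_F _ _ _ _ _ (lam n) _ mfc (fun z => f0 _)).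
- by move=> x; exact: integral_ge0.
apply: eq_integral => a _.
rewrite -[RHS](IH (rV_behead z)); last 2 first.
- exact: (measurableT_comp mfc (measurable_pair1 _)).
- by [].
by apply: eq_integral => v _; rewrite rV_consB rV_cons_behead.
Qed.

Lemma lebesgue_rV_sub n (z : 'rV[R]_n) (A : set 'rV[R]_n) :
  measurable A -> lam n [set x | A (z - x)%R] = lam n A.
Proof.
move=> mA; have ms : measurable_fun setT (fun x : 'rV[R]_n => (z - x)%R).
  exact: measurable_rV_subl.
have mB : measurable [set x | A (z - x)%R].
  by have := ms measurableT _ mA; rewrite setTI.
transitivity (\int[lam n]_x (\1_A (z - x)%R : R)%:E).
  by rewrite -[X in lam n X]setIT -(integral_indic _ measurableT mB).
rewrite (@ge0_integral_rV_sub _ z (fun x => (\1_A x)%:E)) ?integral_indic ?setIT//.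
exact/measurable_EFinP/measurable_indicP.
Qed.

Lemma lebesgue_rV_box n (e : R) : (0 < e)%R ->
  lam n (rV_box e) = ((2 * e) ^+ n)%:E.
Proof.
move=> e0; elim: n => [|n IH].
  by rewrite lebesgue_rV0 diracE mem_set// => -[].
rewrite lebesgue_rVS (_ : _ @^-1` _ = `](- e)%R, e[ `*` rV_box e); last first.
  apply/seteqP; split=> -[a v] /=; rewrite in_itv/=.
    move=> h; split; first by have := h ord0; rewrite rV_consE0 ltr_norml.
    by move=> j; have := h (lift ord0 j); rewrite rV_consES.
  move=> [ae h] i; case: (unliftP ord0 i) => [j|] ->; first by rewrite rV_consES.
  by rewrite rV_consE0 ltr_norml.
rewrite product_measure1E//; last exact: measurable_rV_box.
rewrite exprS EFinM; congr (_ * _); last exact: IH.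
transitivity (mu [set` `](- e)%R, e[]); first by [].
rewrite lebesgue_measure_itv/= lte_fin ifT; last by lra.
by rewrite -EFinD; congr _%:E; lra.
Qed.

End lebesgue_rV.

(** * Regularity of finite Borel measures *)

Section regularity.
Context {R : realType} {n : nat}.
Local Open Scope ereal_scope.
Implicit Types A U V : set 'rV[R]_n.

Lemma open_measurable_rV U : open U -> measurable U.
Proof. by move=> oU; exact: sub_sigma_algebra. Qed.

Variable m : {measure set 'rV[R]_n -> \bar R}.
Hypothesis moo : m setT < +oo.

Let m_fin A : measurable A -> m A < +oo.
Proof.
move=> mA; apply: le_lt_trans moo.
by apply: le_measure => //; rewrite inE.
Qed.

(* Being squeezed by open sets together with the complement is preserved by
   complements, so that these sets form a sigma-algebra. *)
Let squeezed A := forall e : R, (0 < e)%R -> exists U V,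
  [/\ open U, open V, A `<=` U, ~` A `<=` V & m (U `&` V) < e%:E].

(** [A] itself serves as [U]. For [V] take shrinking neighbourhoods of the complement: their traces
    on the open set [A] decrease to the empty set, so their measures tend to 0 because [m] is
    finite. *)
Let squeezed_open A : open A -> squeezed A.
Proof.
move=> oA e e0.
pose V k : set 'rV[R]_n := \bigcup_(x in ~` A) ball x k.+1%:R^-1.
have oV k : open (V k) by apply: bigcup_open => x _; exact: ball_open.
have mAV k : measurable (A `&` V k).
  by apply: measurableI; exact: open_measurable_rV.
have capV : \bigcap_k (A `&` V k) = set0.
  apply/seteqP; split=> // y Ay; have [Ay0 _] := Ay 0%N I.
  have /nbhs_ballP[r /= r0 yrA] : nbhs y A by exact: open_nbhs_nbhs.
  have [k _ /(_ k (leqnn _)) /= kr] := near_infty_natSinv_lt (PosNum r0).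
  have [_ [x nAx xy]] := Ay k I; apply: nAx; apply: yrA.
  by apply: ball_sym; exact: le_ball (ltW kr) _ xy.
have : m (A `&` V k) @[k --> \oo] --> m (\bigcap_k (A `&` V k)).
  apply: nonincreasing_cvg_mu => //.
  - exact: m_fin.
  - by rewrite capV.
  - move=> i j ij; apply/subsetPset => x [Ax [y nAy yx]]; split => //.
    exists y => //; apply: le_ball yx.
    by rewrite lef_pV2 ?posrE// ler_nat.
rewrite capV measure0 => h.
have /fine_cvgP[_ /cvgrPdist_lt/(_ _ e0)[k _ /(_ k (leqnn _)) /=]] := h.
rewrite sub0r normrN => hk; exists A, (V k); split => //.
  move=> x nAx; exists x => //; apply: ballxx.
  by rewrite invr_gt0.
rewrite -[X in X < _]fineK ?ge0_fin_numE ?measure_ge0 ?m_fin//.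
by rewrite lte_fin (le_lt_trans (ler_norm _)).
Qed.

(** All the [U i] are kept, but an infinite intersection of the [V i] may fail to be open, so only
    the first [k] are intersected. The price is [W k], the part of the union that the first [k] sets
    [U i] miss; [k] makes its measure less than [e / 2], and the other half of [e] is spread
    geometrically over the intersections of [U i] and [V i]. *)
Let squeezed_bigcup (F : (set 'rV[R]_n)^nat) :
  (forall i, squeezed (F i)) -> squeezed (\bigcup_i F i).
Proof.
move=> sF e e0.
have e20 : (0 < e / 2)%R by rewrite divr_gt0.
have ei0 i : (0 < e / 2 / (2 ^ i.+1)%:R)%R by rewrite divr_gt0// ltr0n expn_gt0.
have /choice[U /choice[V UV]] := fun i => sF i _ (ei0 i).
have mU i : measurable (U i) by apply: open_measurable_rV; have [] := UV i.
have mV i : measurable (V i) by apply: open_measurable_rV; have [] := UV i.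
pose W k := \bigcup_i U i `\` \big[setU/set0]_(i < k) U i.
have mbU : measurable (\bigcup_i U i) by exact: bigcup_measurable.
have mW k : measurable (W k).
  by apply: measurableD => //; exact: bigsetU_measurable.
have capW : \bigcap_k W k = set0.
  apply/seteqP; split=> // x Wx; have [[i _ Uix] _] := Wx 0%N I.
  have [_] := Wx i.+1 I; apply; rewrite big_ord_recr/=; right; exact: Uix.
have : m (W k) @[k --> \oo] --> m (\bigcap_k W k).
  apply: nonincreasing_cvg_mu => //.
  - exact: m_fin.
  - by rewrite capW.
  - move=> i j ij; apply/subsetPset => x [Ux nUx]; split => //.
    apply: contra_not nUx; rewrite -!bigcup_mkord => -[l /= li Ulx].
    by exists l => //=; exact: leq_trans ij.
rewrite capW measure0 => h.
have /fine_cvgP[_ /cvgrPdist_lt/(_ _ e20)[k _ /(_ k (leqnn _)) /=]] := h.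
rewrite sub0r normrN => hk.
exists (\bigcup_i U i), (\bigcap_(i in `I_k) V i); split.
- by apply: bigcup_open => i _; have [] := UV i.
- rewrite bigcap_mkord; apply: (big_ind open) => [||i _]; first exact: openT.
    exact: openI.
  by have [] := UV i.
- by move=> x [i _ Fix]; exists i => //; have [_ _ + _ _] := UV i; exact.
- move=> x nF i ik; have [_ _ _ + _] := UV i; apply.
  by apply: contra_not nF => Fix; exists i.
have mUV i : measurable (U i `&` V i) by exact: measurableI.
have sub : \bigcup_i U i `&` \bigcap_(i in `I_k) V i `<=`
    \bigcup_i (U i `&` V i) `|` W k.
  move=> x [[i0 _ Ux] Vx]; have [h1|h1] := pselect ((\big[setU/set0]_(i < k) U i) x).
    left; move: h1; rewrite -bigcup_mkord => -[i ik Uix]; exists i => //.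
    by split => //; exact: Vx.
  by right; split => //; exists i0.
have mcap : measurable (\bigcap_(i in `I_k) V i).
  by apply: fin_bigcap_measurable => //; exact: finite_II.
rewrite (@le_lt_trans _ _ (m (\bigcup_i (U i `&` V i) `|` W k)))//.
  apply: le_measure => //; rewrite inE; first exact: measurableI.
  by apply: measurableU => //; exact: bigcup_measurable.
rewrite (@le_lt_trans _ _ (m (\bigcup_i (U i `&` V i)) + m (W k)))//.
  by apply: measureU2 => //; exact: bigcup_measurable.
rewrite (splitr e) EFinD lee_ltD//.
- rewrite ge0_fin_numE ?measure_ge0 ?m_fin//; exact: bigcup_measurable.
- apply: (@le_trans _ _ (\sum_(i <oo) (e / 2 / (2 ^ i.+1)%:R)%:E)).
    apply: (@le_trans _ _ (\sum_(i <oo) m (U i `&` V i))).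
      by apply: measure_sigma_subadditive => //; exact: bigcup_measurable.
    by apply: lee_nneseries => // i _; apply/ltW; have [] := UV i.
  by apply: epsilon_trick0; exact: ltW.
- rewrite -[X in X < _]fineK ?ge0_fin_numE ?measure_ge0 ?m_fin//.
  by rewrite lte_fin (le_lt_trans (ler_norm _)).
Qed.

Lemma outer_regular_rV A : measurable A -> forall e : R, (0 < e)%R ->
  exists U, [/\ open U, A `<=` U & m (U `\` A) < e%:E].
Proof.
move=> mA; suff : squeezed A.
  move=> sA e /sA[U [V [oU oV AU AV UVe]]]; exists U; split => //.
  have mU := open_measurable_rV oU; have mV := open_measurable_rV oV.
  apply: le_lt_trans UVe; apply: le_measure; rewrite ?inE//.
  - exact: measurableD.
  - exact: measurableI.
  - by move=> x [Ux nAx]; split => //; exact: AV.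
move: A mA; apply: smallest_sub => [|U]; last exact: squeezed_open.
split.
- by apply: squeezed_open; exact: open0.
- move=> A sA e /sA[U [V [oU oV AU AV UVe]]]; exists V, U; split => //.
  + by rewrite setTD.
  + by rewrite setTD setCK.
  + by rewrite setIC.
- exact: squeezed_bigcup.
Qed.

End regularity.

(** * Convolution with an absolutely continuous law *)

Section strong_feller.
Import HBNNSimple.
Context {R : realType} {n : nat}.
Local Open Scope ereal_scope.
Variables (P : probability 'rV[R]_n R) (p : 'rV[R]_n -> \bar R).
Hypothesis Pp : is_density P p.
Local Notation lam := (@lebesgue_rV R n).

Let mp : measurable_fun setT p. Proof. by have [] := Pp. Qed.
Let p0 x : 0 <= p x. Proof. by have [] := Pp. Qed.
Let PE A : measurable A -> P A = \int[lam]_(x in A) p x.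
Proof. by have [_ _] := Pp; exact. Qed.

Lemma measurable_reflect x (A : set 'rV[R]_n) : measurable A ->
  measurable [set y | A (x - y)%R].
Proof.
by move=> mA; have := measurable_rV_subl x measurableT mA; rewrite setTI.
Qed.

(** The superlevel sets [D N] decrease to the set where [p] is infinite, which is null since [p] is
    integrable. Once [P (D k) < e / 2], the density is at most [k + 1] off [D k], whence
    [d = e / 2 / (k + 1)]; the successor keeps this quotient meaningful for [k = 0]. *)
Lemma density_absolutely_continuous (e : R) : (0 < e)%R ->
  exists2 d : R, (0 < d)%R & forall E, measurable E -> lam E <= d%:E -> P E < e%:E.
Proof.
move=> e0; pose D N := [set y | N%:R%:E <= p y].
have mD N : measurable (D N).
  by have := emeasurable_fun_c_infty measurableT mp N%:R%:E; rewrite setTI.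
have Doo : \bigcap_N D N = [set y | p y = +oo].
  apply/seteqP; split=> y /=; last by move=> poo N _; rewrite /D/= poo leey.
  move=> Dy; case E : (p y) => [r| |]; [|by []|by have := p0 y; rewrite E].
  have := Dy (Num.truncn r).+1 I; rewrite /D/= E lee_fin leNgt.
  by rewrite truncnS_gt.
have mcap : measurable (\bigcap_N D N) by exact: bigcapT_measurable.
have ip : lam.-integrable setT p.
  apply/integrableP; split=> //.
  under eq_integral do rewrite gee0_abs//.
  by rewrite -PE// probability_setT ltry.
have Poo : P (\bigcap_N D N) = 0.
  rewrite PE//; apply: null_set_integral => //; first exact: measurable_funTS.
  have [A [mA A0 sub]] := integrable_ae measurableT ip.
  apply/eqP; rewrite -measure_le0 -A0; apply: le_measure; rewrite ?inE//.
  by rewrite Doo => y /= poo; apply: sub => /= /(_ I); rewrite poo.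
have : P (D N) @[N --> \oo] --> P (\bigcap_N D N).
  apply: nonincreasing_cvg_mu => //.
  - by rewrite (le_lt_trans (probability_le1 _ _)) ?ltry.
  - move=> i j ij; apply/subsetPset => x; rewrite /D/=; apply: le_trans.
    by rewrite lee_fin ler_nat.
have e20 : (0 < e / 2)%R by rewrite divr_gt0.
rewrite Poo => h.
have /fine_cvgP[_ /cvgrPdist_lt/(_ _ e20)[k _ /(_ k (leqnn _)) /=]] := h.
rewrite sub0r normrN => hk.
exists (e / 2 / k.+1%:R)%R; first by rewrite divr_gt0.
move=> E mE lamE.
have mED : measurable (E `\` D k) by exact: measurableD.
have mEI : measurable (E `&` D k) by exact: measurableI.
rewrite (measureDI P mE (mD k)) (splitr e) EFinD lee_ltD//.
- by rewrite ge0_fin_numE// (le_lt_trans (probability_le1 _ _)) ?ltry.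
- rewrite [leLHS](PE mED) (@le_trans _ _ (\int[lam]_(x in E `\` D k) k.+1%:R%:E))//.
    apply: ge0_le_integral => //.
    + exact: measurable_funTS.
    + move=> x [_ /negP]; rewrite -ltNge => /ltW/le_trans; apply.
      by rewrite lee_fin ler_nat.
  rewrite integral_cst// -lee_pdivlMl// muleC.
  apply: le_trans lamE; apply: le_measure; rewrite ?inE//.
- apply: (@le_lt_trans _ _ (P (D k))).
    by apply: le_measure; rewrite ?inE//; exact: subIsetr.
  have fD : P (D k) \is a fin_num by rewrite fin_num_measure.
  rewrite -[X in X < _]fineK//.
  by rewrite lte_fin (le_lt_trans (ler_norm _)).
Qed.

Let fP B : measurable B -> P B \is a fin_num.
Proof. by move=> mB; exact: fin_num_measure. Qed.

Let cvg_lt (F : (set 'rV[R]_n)^nat) A (e : R) :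
  (forall k, measurable (F k)) -> measurable A ->
  P (F k) @[k --> \oo] --> P A -> (0 < e)%R ->
  exists k0, forall k, (k0 <= k)%N -> P A < P (F k) + e%:E.
Proof.
move=> mF mA; rewrite -(fineK (fP mA)) => /fine_cvgP[_ /cvgrPdist_lt h] e0.
have [k0 _ hk0] := h _ e0; exists k0 => k /hk0 /=.
rewrite -(fineK (fP (mF k))) -EFinD lte_fin -ltrBlDl.
exact/le_lt_trans/ler_norm.
Qed.

(** The points of [U] at distance at least [1 / (k + 1)] from the complement exhaust [U], and such a
    point [x - y] stays in [U] when [x] moves by less than that distance. *)
Let reflect_open_lsc (x : 'rV[R]_n) (U : set 'rV[R]_n) (e : R) : open U -> (0 < e)%R ->
  \forall x' \near x, P [set y | U (x - y)%R] < P [set y | U (x' - y)%R] + e%:E.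
Proof.
move=> oU e0; have mU := open_measurable_rV oU.
pose V k : set 'rV[R]_n := \bigcup_(z in ~` U) ball z k.+1%:R^-1.
have mV k : measurable (V k).
  by apply: open_measurable_rV; apply: bigcup_open => z _; exact: ball_open.
pose W k := [set y | (U `\` V k) (x - y)%R].
have mW k : measurable (W k) by apply: measurable_reflect; exact: measurableD.
have bigW : \bigcup_k W k = [set y | U (x - y)%R].
  apply/seteqP; split=> y /=; first by move=> [k _ []].
  move=> Uxy; have /nbhs_ballP[r /= r0 xyr] : nbhs (x - y)%R U.
    exact: open_nbhs_nbhs.
  have [k _ /(_ k (leqnn _)) /= kr] := near_infty_natSinv_lt (PosNum r0).
  exists k => //; split => // -[z nUz zxy]; apply: nUz; apply: xyr.
  by apply: ball_sym; exact: le_ball (ltW kr) _ zxy.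
have : P (W k) @[k --> \oo] --> P (\bigcup_k W k).
  apply: nondecreasing_cvg_mu => //; first exact: bigcupT_measurable.
  move=> i j ij; apply/subsetPset => y [Uxy nV]; split => //.
  apply: contra_not nV => -[z nUz zxy]; exists z => //; apply: le_ball zxy.
  by rewrite lef_pV2 ?posrE// ler_nat.
have mr (C : set 'rV[R]_n) (z : 'rV[R]_n) : measurable C -> measurable [set y | C (z - y)%R].
  exact: measurable_reflect.
rewrite bigW => /(cvg_lt mW (mr _ x mU))/(_ e0)[k /(_ k (leqnn _)) hk].
have kp : (0 < k.+1%:R^-1 :> R)%R by rewrite invr_gt0.
have := nbhsx_ballx x _ kp; apply: filterS => x' xx'.
have : P (W k) <= P [set y | U (x' - y)%R].
  apply: le_measure; rewrite ?inE//; first exact: mr.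
  move=> y [Uxy nV] /=.
  apply: contrapT => nU; apply: nV; exists (x' - y)%R => //.
  move: xx'; rewrite -!ball_normE /= distrC => xx'.
  by rewrite opprB addrA subrK.
move=> h; apply: lt_le_trans hk _; by rewrite leeD2r.
Qed.

(** [A] is cut down to a cube, where Lebesgue measure is finite, and covered there by an open set
    [U] with small Lebesgue excess. Since [y -> x' - y] preserves Lebesgue measure, absolute
    continuity bounds the [P]-measure of the reflected excess uniformly in [x'], and the open case
    applies to [U]. *)
Let reflect_lsc (x : 'rV[R]_n) (A : set 'rV[R]_n) (e : R) : measurable A -> (0 < e)%R ->
  \forall x' \near x, P [set y | A (x - y)%R] < P [set y | A (x' - y)%R] + e%:E.
Proof.
move=> mA e0; have e30 : (0 < e / 3)%R by rewrite divr_gt0.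
pose B k := A `&` rV_box k%:R.
have mB k : measurable (B k) by apply: measurableI => //; exact: measurable_rV_box.
pose rB k := [set y | B k (x - y)%R].
have mrB k : measurable (rB k) by exact: measurable_reflect.
have bigB : \bigcup_k rB k = [set y | A (x - y)%R].
  apply/seteqP; split=> y /=; first by move=> [k _ []].
  have : (\bigcup_k rV_box k%:R) (x - y)%R by rewrite bigcup_rV_box.
  by move=> [k _ xyk] Axy; exists k.
have : P (rB k) @[k --> \oo] --> P (\bigcup_k rB k).
  apply: nondecreasing_cvg_mu => //; first exact: bigcupT_measurable.
  move=> i j ij; apply/subsetPset => y [Axy yi]; split => // l.
  by rewrite (lt_le_trans (yi l))// ler_nat.
have mr (C : set 'rV[R]_n) (z : 'rV[R]_n) : measurable C -> measurable [set y | C (z - y)%R].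
  exact: measurable_reflect.
rewrite bigB => /(cvg_lt mrB (mr _ x mA))/(_ e30)[k0 hk0].
(* The successor makes the side of the cube positive. *)
pose k := k0.+1; have {hk0} h1 := hk0 k (leqnSn _).
have [d d0 dP] := density_absolutely_continuous e30.
pose K : set 'rV[R]_n := rV_box k%:R.
have mK : measurable K by exact: measurable_rV_box.
pose m := mrestr lam mK.
have moo : m setT < +oo.
  by rewrite /m /mrestr setTI lebesgue_rV_box ?ltry// ltr0n.
have [U0 [oU0 BU0 mU0]] := outer_regular_rV moo (mB k) d0.
pose U := U0 `&` K.
have oU : open U by apply: openI => //; exact: open_rV_box.
have mU : measurable U by exact: open_measurable_rV.
have BU : B k `<=` U by move=> y By; split; [exact: BU0|case: By].
have mUB : measurable (U `\` B k) by exact: measurableD.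
have lamUB : lam (U `\` B k) <= d%:E.
  by rewrite (_ : U `\` B k = (U0 `\` B k) `&` K) ?(ltW mU0)// setDE setIAC -setDE.
have := reflect_open_lsc x oU e30; apply: filterS => x' hx'.
have h2 : P (rB k) <= P [set y | U (x - y)%R].
  apply: le_measure; rewrite ?inE//; first exact: mr.
  by move=> y /BU.
have h3 : P [set y | U (x' - y)%R] <= P [set y | A (x' - y)%R] + (e / 3)%:E.
  apply: (@le_trans _ _ (P ([set y | A (x' - y)%R] `|`
                            [set y | (U `\` B k) (x' - y)%R]))).
    apply: le_measure; rewrite ?inE//; first exact: mr.
      by apply: measurableU; exact: mr.
    move=> y /= Uy; have [By|nBy] := pselect (B k (x' - y)%R); last by right.
    by left; case: By.
  apply: (le_trans (measureU2 P (mr _ x' mA) (mr _ x' mUB))).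
  rewrite leeD2l//; apply/ltW/dP; first exact: mr.
  by rewrite lebesgue_rV_sub.
move: h1 h2 hx' h3.
rewrite -(fineK (fP (mr _ x mA))) -(fineK (fP (mrB k))).
rewrite -(fineK (fP (mr _ x mU))) -(fineK (fP (mr _ x' mU))).
rewrite -(fineK (fP (mr _ x' mA))) -!EFinD !lte_fin !lee_fin.
by move=> *; lra.
Qed.

(** The lower bounds for [A] and for its complement, whose probabilities add up to 1, control the
    variation from both sides. *)
Lemma continuous_reflect_density (A : set 'rV[R]_n) : measurable A ->
  continuous (fun x : 'rV[R]_n => fine (P [set y | A (x - y)%R])).
Proof.
move=> mA x; apply/(@cvgrPdist_lt _ _ _ (nbhs x) (nbhs_filter x)) => e e0.
have mr (C : set 'rV[R]_n) (z : 'rV[R]_n) : measurable C -> measurable [set y | C (z - y)%R].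
  exact: measurable_reflect.
have PC z : fine (P [set y | (~` A) (z - y)%R]) = (1 - fine (P [set y | A (z - y)%R]))%R.
  rewrite (_ : [set y | (~` A) (z - y)%R] = ~` [set y | A (z - y)%R])//.
  by rewrite probability_setC ?fineB ?fP//; exact: mr.
have mCA : measurable (~` A) by exact: measurableC.
have := reflect_lsc x mCA e0; have := reflect_lsc x mA e0.
apply: filterS2 => x'.
rewrite -(fineK (fP (mr _ x mA))) -(fineK (fP (mr _ x' mA))).
rewrite -(fineK (fP (mr _ x mCA))) -(fineK (fP (mr _ x' mCA))) !PC.
rewrite -!EFinD !lte_fin ltr_norml => h1 h2; apply/andP; split; lra.
Qed.

(** Along simple functions increasing to [q] the convolutions are finite combinations of the
    continuous functions of [continuous_reflect_density], and an increasing limit of continuous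
    functions is lower semicontinuous. *)
Lemma lower_semicontinuous_convolution (q : 'rV[R]_n -> \bar R) (x : 'rV[R]_n) (c : R) :
  measurable_fun setT q -> (forall y, 0 <= q y) ->
  c%:E < \int[P]_y q (x - y)%R ->
  \forall x' \near x, c%:E < \int[P]_y q (x' - y)%R.
Proof.
move=> mq q0.
pose s := nnsfun_approx measurableT mq.
have ms k (z : 'rV[R]_n) : measurable_fun setT (fun y : 'rV[R]_n => (s k (z - y)%R)%:E).
  apply/measurable_EFinP; exact: (measurableT_comp _ (measurable_rV_subl z)).
have intE (z : 'rV[R]_n) : \int[P]_y q (z - y)%R = limn (fun k => \int[P]_y (s k (z - y)%R)%:E).
  rewrite -monotone_convergence//.
  - apply: eq_integral => y _; apply/esym/cvg_lim => //.
    exact: (cvg_nnsfun_approx measurableT mq).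
  - by move=> k y _; rewrite lee_fin.
  - by move=> y _ i j ij; rewrite lee_fin; exact/lefP/nd_nnsfun_approx.
have nd (z : 'rV[R]_n) : nondecreasing_seq (fun k => \int[P]_y (s k (z - y)%R)%:E).
  move=> i j ij; apply: ge0_le_integral => //.
  - by move=> y _; rewrite lee_fin.
  - by move=> y _; rewrite lee_fin; exact/lefP/nd_nnsfun_approx.
pose S k (z : 'rV[R]_n) := (\sum_(r <- finmap.enum_fset (fset_set (range (s k))))
  r * fine (P [set y | (s k @^-1` [set r]) (z - y)]))%R.
have mr (C : set 'rV[R]_n) (z : 'rV[R]_n) : measurable C -> measurable [set y | C (z - y)%R].
  exact: measurable_reflect.
have SE k (z : 'rV[R]_n) : \int[P]_y (s k (z - y)%R)%:E = (S k z)%:E.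
  have msr r : measurable [set y | (s k @^-1` [set r]) (z - y)%R].
    by apply: mr; rewrite -[X in measurable X]setTI; exact: measurable_funP.
  under eq_integral do rewrite fimfunE -fsumEFin//.
  rewrite ge0_integral_fsum//; last 2 first.
  - move=> r; apply/measurable_EFinP/measurable_funM => //.
    exact: ((measurable_indicP _ _).1 (msr r)).
  - by move=> r y _; rewrite nnfun_muleindic_ge0.
  rewrite fsbig_finite//= /S -sumEFin; apply: eq_big_seq => r.
  rewrite in_fset_set// inE => -[w _ sw].
  under eq_integral do rewrite EFinM.
  have mI : measurable_fun setT (fun y : 'rV[R]_n => (\1_(s k @^-1` [set r]) (z - y) : R)%:E).
    apply/measurable_EFinP.
    exact: ((measurable_indicP _ _).1 (msr r)).
  rewrite ge0_integralZl//; last by rewrite lee_fin -sw.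
  rewrite EFinM fineK; last exact: fin_num_measure.
  congr (_ * _); rewrite -[in RHS](setIT [set y | _]).
  by rewrite -(integral_indic P measurableT (msr r)); apply: eq_integral.
have cS k : continuous (S k).
  apply: (@continuous_big R _ +%R 0%R xpredT) => [|r _ z]; first exact: add_continuous.
  apply: (@cvgM _ _ _ (nbhs_filter z)); first exact: (@cvg_cst _ _ _ _ (nbhs_filter z)).
  apply: continuous_reflect_density; rewrite -[X in measurable X]setTI.
  exact: measurable_funP.
rewrite intE.
rewrite (cvg_lim _ (ereal_nondecreasing_cvgn (nd x)))// => /ereal_sup_gt[_ [k _ <-]].
rewrite SE lte_fin => cSk.
have : \forall x' \near x, (c < S k x')%R by exact: (cS k x _ (lt_nbhsr cSk)).
apply: filterS => x' cS'.
apply: (@lt_le_trans _ _ (S k x')%:E); first by rewrite lte_fin.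
rewrite -SE intE (cvg_lim _ (ereal_nondecreasing_cvgn (nd x')))//.
by apply: ereal_sup_ubound; exists k.
Qed.

End strong_feller.

(** * Gaussian integrals *)

Section integral_real_line.
Context {R : realType}.
Local Notation mu := (@lebesgue_measure R).

(** Integration by parts on the whole line, in the form used below: the fundamental theorem of
    calculus on [[-n, n]], then dominated convergence with majorant [|h'|]. *)
Lemma Rintegral_derive_vanishing (h h' : R -> R) :
  (forall u : R, is_derive u (1 : R) h (h' u)) -> continuous h' ->
  mu.-integrable setT (EFin \o h') ->
  h n%:R @[n --> \oo] --> 0 -> h (- n%:R) @[n --> \oo] --> 0 ->
  \int[mu]_u h' u = 0.
Proof.
move=> dh ch' ih' hy hNy.
pose D (n : nat) := `[- n%:R, n%:R]%classic : set R.
have mh' : measurable_fun setT h' by exact: continuous_measurable_fun.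
have FTC n : (0 < n)%N ->
    (\int[mu]_(u in D n) (h' u)%:E = (h n%:R - h (- n%:R))%:E)%E.
  move=> n0; rewrite /D (@continuous_FTC2 _ h' h)//.
  - by rewrite -subr_gt0 opprK -natrD ltr0n addn_gt0 n0.
  - exact: continuous_subspaceT.
  - have ch : continuous h.
      move=> u; apply: differentiable_continuous; apply/derivable1_diffP.
      by have [] := dh u.
    split; [|apply: cvg_at_right_filter; exact: ch|
             apply: cvg_at_left_filter; exact: ch].
    by move=> u _; have [] := dh u.
  - by move=> u _; rewrite derive1E; have [] := dh u.
have := @dominated_convergence _ _ _ mu setT measurableT
  (fun n u => (h' u * \1_(D n) u)%:E) (EFin \o h') (abse \o (EFin \o h')).
move=> [].
- move=> n; apply/measurable_EFinP/measurable_funM => //.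
  by apply: measurable_indic; exact: measurable_itv.
- exact/measurable_EFinP.
- apply: aeW => u _; apply/cvg_EFin; first by near=> n.
  apply: cvg_near_cst; near=> n => /=; rewrite indicE mem_set ?mulr1//.
  rewrite /D /= in_itv/= -ler_norml; near: n; exact: nbhs_infty_ger.
- exact: integrable_abse.
- apply: aeW => u n _; rewrite /= lee_fin normrM.
  by rewrite ler_piMr// indicE; case: (_ \in _); rewrite ?normr1 ?normr0.
move=> _ _ /cvg_lim; rewrite /Rintegral => <-//.
rewrite (_ : 0 = fine (0%:E)%E)//; congr fine; apply/cvg_lim => //.
apply: (@cvg_trans _ ((h n%:R - h (- n%:R))%:E @[n --> \oo])).
  apply: near_eq_cvg; near=> n.
  rewrite -FTC; last by near: n; exact: nbhs_infty_gt.
  rewrite [LHS]integral_mkcond; apply: eq_integral => u _.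
  rewrite patchE indicE; case: (u \in D n); by rewrite ?mulr1 ?mulr0.
apply/cvg_EFin; first by near=> n.
by rewrite -(subr0 0); exact: cvgB.
Unshelve. all: end_near. Qed.

Lemma Rintegral_odd (f : R -> R) : measurable_fun setT f ->
  (forall u, f (- u) = - f u) -> \int[mu]_u f u = 0.
Proof.
move=> mf fN; rewrite /Rintegral integralE.
set a := (X in fine (X - _)); set b := (X in fine (_ - X)).
(* When both parts have infinite integral, their difference is infinite and [fine] returns 0, as in
   the finite case. *)
suff -> : a = b by case: b => //= r; rewrite subrr.
have mEf : measurable_fun setT (EFin \o f) by exact/measurable_EFinP.
rewrite /a -(@ge0_integral_lebesgue_sub _ 0)//; last exact: measurable_funepos.
apply: eq_integral => u _.
by rewrite funeposE funenegE /= sub0r fN.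
Qed.

End integral_real_line.

Section gaussian_line.
Context {R : realType}.
Local Notation mu := (@lebesgue_measure R).
Implicit Types a x y u : R.

Definition gaussian (a u : R) : R := expR (- (a * u ^+ 2)).

Lemma continuous_gaussian a : continuous (gaussian a).
Proof.
move=> u; apply: (@continuous_comp _ _ _ (fun u : R => - (a * u ^+ 2)) expR).
  apply: cvgN; apply: cvgM; first exact: cvg_cst.
  exact: exprn_continuous.
exact: continuous_expR.
Qed.

Lemma measurable_gaussian a : measurable_fun setT (gaussian a).
Proof. by apply: continuous_measurable_fun; exact: continuous_gaussian. Qed.

Lemma is_derive_gaussian a (u : R) :
  is_derive u (1 : R) (gaussian a) (- (2 * a * u) * gaussian a u).
Proof.
rewrite /gaussian; apply: is_derive_eq.
rewrite /GRing.scale /= /gaussian. ring.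
Qed.

(** The sequence [v n] may be [n] or [- n], so that this applies at both ends of the line. *)
Lemma gaussian_sinM_cvg0 a x (v : nat -> R) : 0 < a -> (forall n, v n ^+ 2 = n%:R ^+ 2) ->
  gaussian a (v n) * sin (v n * x) @[n --> \oo] --> 0.
Proof.
move=> a0 vE; apply/cvgr0Pnorm_lt => e e0; near=> n.
have n1 : 1 <= n%:R :> R by rewrite ler1n; near: n; exact: nbhs_infty_gt.
have ne : (a * e)^-1 < n%:R by near: n; exact: nbhs_infty_gtr.
rewrite normrM (le_lt_trans (ler_piMr _ (sin_max _)))//.
rewrite ger0_norm ?expR_ge0// /gaussian vE expRN invf_plt ?posrE ?expR_gt0//.
apply: lt_le_trans (expR_ge1Dx _).
have aen : 1 < n%:R * (a * e) by rewrite -ltr_pdivrMr ?mulr_gt0// div1r.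
rewrite -[ltLHS]div1r ltr_pdivrMr//; nra.
Unshelve. all: end_near. Qed.

Lemma integrable_gaussian a : 0 < a ->
  mu.-integrable setT (EFin \o gaussian a).
Proof.
(* A centred normal density of variance [1 / (2 a)] is proportional to [gaussian a]. *)
move=> a0; pose s := Num.sqrt ((2 * a)^-1).
have s0 : s != 0 by rewrite gt_eqF// sqrtr_gt0 invr_gt0 mulr_gt0.
have := @integrable_normal_pdf R 0 s.
move=> /(integrableZl measurableT (normal_peak s)^-1).
apply: eq_integrable => // u _; rewrite -EFinM /= normal_pdfE// mulKf; last first.
  by rewrite gt_eqF// normal_peak_gt0.
congr (expR _)%:E; rewrite /= subr0 /s sqr_sqrtr ?invr_ge0 ?mulr_ge0 ?ltW//.
field; lra.
Qed.

(** Half of the exponent is sacrificed: [|u| <= 1 + u^2], and [u^2] is absorbed by [expR (a / 2 * u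
    ^+ 2) >= 1 + a / 2 * u ^+ 2]. *)
Lemma normr_gaussian_le a u : 0 < a ->
  `|u| * gaussian a u <= (1 + 2 / a) * gaussian (a / 2) u.
Proof.
move=> a0; have g0 : 0 < gaussian (a / 2) u by exact: expR_gt0.
have -> : gaussian a u = gaussian (a / 2) u * gaussian (a / 2) u.
  by rewrite /gaussian -expRD; congr expR; field.
rewrite mulrA ler_pM2r// /gaussian expRN ler_pdivrMr ?expR_gt0//.
have h1 : `|u| <= 1 + u ^+ 2.
  rewrite -[u ^+ 2]real_normK ?num_real//.
  by have := sqr_ge0 (`|u| - 1); nra.
have h2 := expR_ge1Dx (a / 2 * u ^+ 2).
apply: (le_trans h1); apply: (@le_trans _ _ ((1 + 2 / a) * (1 + a / 2 * u ^+ 2))).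
  rewrite (_ : (1 + 2 / a) * _ = 1 + u ^+ 2 + 2 / a + a / 2 * u ^+ 2); last by field; lra.
  have : 0 <= 2 / a by rewrite divr_ge0// ltW.
  have : 0 <= a / 2 * u ^+ 2 by rewrite mulr_ge0 ?sqr_ge0// divr_ge0// ltW.
  by lra.
by rewrite ler_wpM2l// addr_ge0// divr_ge0// ltW.
Qed.

Lemma integrable_gaussianM a (f : R -> R) : 0 < a -> measurable_fun setT f ->
  (forall u, `|f u| <= 1) -> mu.-integrable setT (fun u => (gaussian a u * f u)%:E).
Proof.
move=> a0 mf f1; apply: le_integrable (integrable_gaussian a0) => //.
  by apply/measurable_EFinP/measurable_funM => //; exact: measurable_gaussian.
by move=> u _; rewrite lee_fin normrM ler_piMr.
Qed.

Lemma integrable_id_gaussianM a (f : R -> R) : 0 < a -> measurable_fun setT f ->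
  (forall u, `|f u| <= 1) ->
  mu.-integrable setT (fun u => (u * gaussian a u * f u)%:E).
Proof.
move=> a0 mf f1.
have a20 : 0 < a / 2 by rewrite divr_gt0.
have := integrableZl measurableT (1 + 2 / a) (integrable_gaussian a20).
apply: le_integrable => //.
  apply/measurable_EFinP/measurable_funM => //.
  apply: measurable_funM; [exact: measurable_id|exact: measurable_gaussian].
move=> u _; rewrite -EFinM lee_fin !normrM.
rewrite (le_trans (ler_piMr _ (f1 u)))// ?mulr_ge0//.
rewrite [in leLHS](@ger0_norm _ (gaussian a u)) ?expR_ge0//.
by rewrite (le_trans (normr_gaussian_le _ _))// -normrM ler_norm.
Qed.

Lemma continuous_cosM (x : R) : continuous (fun u : R => cos (u * x)).
Proof.
move=> u; apply: continuous_comp; last exact: continuous_cos.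
by apply: cvgM; [exact: cvg_id|exact: cvg_cst].
Qed.

Lemma continuous_sinM (x : R) : continuous (fun u : R => sin (u * x)).
Proof.
move=> u; apply: continuous_comp; last exact: continuous_sin.
by apply: cvgM; [exact: cvg_id|exact: cvg_cst].
Qed.

Lemma Rintegral_gaussian_sin a x :
  \int[mu]_u (gaussian a u * sin (u * x)) = 0.
Proof.
apply: Rintegral_odd => [|u].
  apply: measurable_funM; first exact: measurable_gaussian.
  by apply: continuous_measurable_fun; exact: continuous_sinM.
by rewrite mulNr sinN mulrN /gaussian sqrrN.
Qed.

Let cos_part a x := \int[mu]_u (gaussian a u * cos (u * x)).

(** Differentiation under the integral sign, with the majorant [|u| * gaussian a u] for all points
    at once. *)
Let derive_cos_part a x : 0 < a ->
  is_derive x (1 : R) (cos_part a) (\int[mu]_u (- (u * gaussian a u * sin (u * x)))).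
Proof.
move=> a0; pose f y u := gaussian a u * cos (u * y).
have df y u : is_derive y (1 : R) (f ^~ u) (- (u * gaussian a u * sin (u * y))).
  rewrite /f; apply: is_derive_eq.
  rewrite /GRing.scale /=. ring.
have d1f y u : partial1of2 f y u = - (u * gaussian a u * sin (u * y)).
  by rewrite partial1of2E; have [] := df y u.
have xI : (`](x - 1), (x + 1)[%classic : set R) x.
  by rewrite /= in_itv/= ltrBlDr ltrDl ltr01.
have intf y : mu.-integrable setT (EFin \o f y).
  apply: integrable_gaussianM => // [|u]; last exact: cos_max.
  by apply: continuous_measurable_fun; exact: continuous_cosM.
have intG := integrable_norm (@integrable_id_gaussianM a (cst 1) a0
  (@measurable_cst _ _ _ _ _ _) _).
have {}intG : mu.-integrable setT (EFin \o (fun u => `|u * gaussian a u * 1|)).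
  by apply: intG => // u; rewrite normr1.
have df1 y u : `](x - 1), (x + 1)[%classic y -> setT u -> derivable (f ^~ u) y 1.
  by move=> _ _; have [] := df y u.
have ub y u : `](x - 1), (x + 1)[%classic y -> setT u ->
    `|partial1of2 f y u| <= `|u * gaussian a u * 1|.
  move=> _ _; rewrite d1f normrN mulr1 normrM ler_piMr//; exact: sin_max.
have G0 u : 0 <= `|u * gaussian a u * 1| by [].
apply: DeriveDef.
  exact: (derivable_under_integral measurableT xI (fun y _ => intf y) df1 G0 intG ub).
rewrite -derive1E (differentiation_under_integral measurableT xI (fun y _ => intf y) df1 G0 intG ub).
by apply: eq_Rintegral => u _; rewrite d1f.
Qed.

(** The two sides differ by a multiple of the integral of the derivative of
    [gaussian a u * sin (u * x)], a function that vanishes at both ends of the line. *)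
Let parts_cos_part a x : 0 < a ->
  \int[mu]_u (- (u * gaussian a u * sin (u * x))) = - (x / (2 * a)) * cos_part a x.
Proof.
move=> a0.
have ms : measurable_fun setT (fun u : R => sin (u * x)).
  by apply: continuous_measurable_fun; exact: continuous_sinM.
have mc : measurable_fun setT (fun u : R => cos (u * x)).
  by apply: continuous_measurable_fun; exact: continuous_cosM.
have i1 := integrable_id_gaussianM a0 ms (fun u => sin_max _).
have i2 := integrable_gaussianM a0 mc (fun u => cos_max _).
pose h u := gaussian a u * sin (u * x).
pose h' u := - (2 * a) * (u * gaussian a u * sin (u * x)) + x * (gaussian a u * cos (u * x)).
have i1' := integrableZl measurableT (- (2 * a)) i1.
have i2' := integrableZl measurableT x i2.
have h'0 : \int[mu]_u h' u = 0.
  apply: (@Rintegral_derive_vanishing _ h) => [u|u|||].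
  - rewrite /h; have dg := is_derive_gaussian a u; apply: is_derive_eq.
    rewrite /GRing.scale /= /h'. ring.
  - apply: cvgD; apply: cvgM; try exact: cvg_cst.
      apply: cvgM; last exact: continuous_sinM.
      by apply: cvgM; [exact: cvg_id|exact: continuous_gaussian].
    by apply: cvgM; [exact: continuous_gaussian|exact: continuous_cosM].
  - by have := integrableD measurableT i1' i2'; apply: eq_integrable.
  - by apply: gaussian_sinM_cvg0.
  - by apply: gaussian_sinM_cvg0 => // n; rewrite sqrrN.
have : \int[mu]_u h' u = - (2 * a) * \int[mu]_u (u * gaussian a u * sin (u * x))
    + x * cos_part a x.
  rewrite /h' RintegralD//.
  by rewrite RintegralZl// RintegralZl.
rewrite h'0 => /esym/eqP; rewrite addr_eq0 => /eqP e.
transitivity (- \int[mu]_u (u * gaussian a u * sin (u * x))).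
  rewrite -[RHS]mulN1r -RintegralZl//.
  by apply: eq_Rintegral => u _; rewrite mulN1r.
apply: (@mulfI _ (- (2 * a))); first by lra.
rewrite mulrN e. field. lra.
Qed.

(** The cosine integral [F] satisfies [F' x = - x / (2 a) F x], so [F x * expR (x^2 / (4 a))] is
    constant. *)
Lemma Rintegral_gaussian_cos a x : 0 < a ->
  \int[mu]_u (gaussian a u * cos (u * x)) =
  \int[mu]_u gaussian a u * gaussian (4 * a)^-1 x.
Proof.
move=> a0; rewrite -/(cos_part a x).
pose K y := cos_part a y * expR ((4 * a)^-1 * y ^+ 2).
have : K x = K 0.
  apply: is_derive_0_is_cst => y.
  have dF := @derive_cos_part a y a0; rewrite parts_cos_part// in dF.
  rewrite /K; apply: is_derive_eq.
  rewrite /GRing.scale /=. field. lra.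
rewrite /K expr0n mulr0 expR0 mulr1 => e.
rewrite /gaussian expRN -[LHS](mulfK (lt0r_neq0 (expR_gt0 ((4 * a)^-1 * x ^+ 2)))) e.
by congr (_ / _); apply: eq_Rintegral => u _; rewrite mulr0 cos0 mulr1.
Qed.

End gaussian_line.

(** * Euclidean inner product and the Cauchy-Schwarz inequality *)

Section dot_product.
Context {R : realType} {n : nat}.
Implicit Types (x y z : 'rV[R]_n) (a : R).

Lemma dotvC x y : dotv x y = dotv y x.
Proof. by apply: eq_bigr => i _; rewrite mulrC. Qed.

Lemma dotvBr x y z : dotv x (y - z) = dotv x y - dotv x z.
Proof. by rewrite -sumrB; apply: eq_bigr => i _; rewrite !mxE mulrBr. Qed.

Lemma dotvZr a x y : dotv x (a *: y) = a * dotv x y.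
Proof. by rewrite mulr_sumr; apply: eq_bigr => i _; rewrite !mxE mulrCA. Qed.

Lemma dotv0r x : dotv x 0 = 0.
Proof. by rewrite -(scale0r 0) dotvZr mul0r. Qed.

Lemma dotvNr x y : dotv x (- y) = - dotv x y.
Proof. by rewrite -scaleN1r dotvZr mulN1r. Qed.

Lemma dotvBl x y z : dotv (x - y) z = dotv x z - dotv y z.
Proof. by rewrite dotvC dotvBr !(dotvC z). Qed.

Lemma dotvZl a x y : dotv (a *: x) y = a * dotv x y.
Proof. by rewrite dotvC dotvZr dotvC. Qed.

Lemma dotvv_ge0 x : 0 <= dotv x x.
Proof. by apply: sumr_ge0 => i _; rewrite -expr2 sqr_ge0. Qed.

Lemma sqr_enorm x : enorm x ^+ 2 = dotv x x.
Proof. by rewrite sqr_sqrtr// dotvv_ge0. Qed.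

Lemma enorm_ge0 x : 0 <= enorm x. Proof. exact: sqrtr_ge0. Qed.

Lemma enormZ a x : enorm (a *: x) = `|a| * enorm x.
Proof.
rewrite /enorm dotvZl dotvZr mulrA -expr2 sqrtrM ?sqr_ge0//.
by rewrite sqrtr_sqr.
Qed.

Lemma enormN x : enorm (- x) = enorm x.
Proof. by rewrite -scaleN1r enormZ normrN1 mul1r. Qed.

Lemma enorm_eq0 x : enorm x = 0 -> x = 0.
Proof.
move=> x0; have : dotv x x = 0 by rewrite -sqr_enorm x0 expr0n.
move=> /eqP; rewrite psumr_eq0; last by move=> i _; rewrite -expr2 sqr_ge0.
move=> /allP h; apply/rowP => i; have := h i (mem_index_enum _).
by rewrite mulf_eq0 orbb mxE => /eqP.
Qed.

Lemma dotv_le x y : `|dotv x y| <= enorm x * enorm y.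
Proof.
have [y0|y0] := eqVneq (dotv y y) 0.
  have -> : y = 0 by apply: enorm_eq0; rewrite /enorm y0 sqrtr0.
  by rewrite dotv0r normr0 mulr_ge0 ?enorm_ge0.
rewrite -ler_sqr ?nnegrE ?mulr_ge0 ?enorm_ge0// real_normK ?num_real//.
rewrite exprMn !sqr_enorm.
have yp : 0 < dotv y y by rewrite lt_neqAle eq_sym y0 dotvv_ge0.
(* The component of [x] orthogonal to [y] has nonnegative squared length. *)
have := dotvv_ge0 (x - (dotv x y / dotv y y) *: y).
rewrite dotvBl !dotvBr !dotvZl !dotvZr (dotvC y x).
set b := dotv x y; set c := dotv y y; set e := dotv x x.
rewrite (_ : _ - _ = e - b ^+ 2 / c); last by field; rewrite gt_eqF.
by rewrite subr_ge0 ler_pdivrMr.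
Qed.

Lemma measurable_dotv d (T : measurableType d) (f g : T -> 'rV[R]_n) :
  measurable_fun setT f -> measurable_fun setT g ->
  measurable_fun setT (fun t => dotv (f t) (g t)).
Proof.
move=> mf mg; apply: measurable_sum => i; apply: measurable_funM.
  exact: measurableT_comp (measurable_coord i) mf.
exact: measurableT_comp (measurable_coord i) mg.
Qed.

Lemma measurable_dotvl x : measurable_fun setT (dotv x).
Proof. by apply: measurable_dotv. Qed.

Lemma measurable_dotvr x : measurable_fun setT (dotv ^~ x).
Proof. by apply: measurable_dotv. Qed.

Lemma measurable_enorm : measurable_fun setT (@enorm R n).
Proof.
have ms : measurable_fun setT (@Num.sqrt R).
  by apply: continuous_measurable_fun; exact: sqrt_continuous.
apply: (measurableT_comp ms); exact: measurable_dotv.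
Qed.

End dot_product.

Lemma dotv_behead (R : realType) n (u x : 'rV[R]_n.+1) :
  dotv u x = u ord0 ord0 * x ord0 ord0 + dotv (rV_behead u) (rV_behead x).
Proof.
rewrite /dotv big_ord_recl; congr (_ + _).
by apply: eq_bigr => i _; rewrite !mxE.
Qed.

(** * Functions that split into a factor of the first coordinate and one of the others *)

Section tensor.
Context {R : realType}.
Local Notation mu := (@lebesgue_measure R).
Local Notation lam n := (@lebesgue_rV R n).
Variables (n : nat) (f : R -> R) (g : 'rV[R]_n -> R) (h : 'rV[R]_n.+1 -> R).
Hypotheses (mh : measurable_fun setT h)
  (hE : forall u, h u = f (u ord0 ord0) * g (rV_behead u)).
Hypotheses (intf : mu.-integrable setT (EFin \o f))
           (intg : (lam n).-integrable setT (EFin \o g)).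

Let hcE a v : h (rV_cons (a, v)) = f a * g v.
Proof. by rewrite hE rV_consE0 rV_beheadK. Qed.

Let mf : measurable_fun setT f.
Proof. by apply/measurable_EFinP; exact: (measurable_int mu). Qed.

Let mg : measurable_fun setT g.
Proof. by apply/measurable_EFinP; exact: (measurable_int (lam n)). Qed.

Let tensor_lty :
  (\int[mu]_a \int[lam n]_v `|(h (rV_cons (a, v)))%:E| < +oo)%E.
Proof.
have /integrableP[_ foo] := intf; have /integrableP[_ goo] := intg.
rewrite (_ : (fun a => _) =
    fun a => (`|f a|%:E * \int[lam n]_v `|(g v)%:E|)%E); last first.
  apply/funext => a; rewrite -ge0_integralZl//.
  - by apply: eq_integral => v _; rewrite /= hcE normrM EFinM.
  - by apply/measurableT_comp => //; exact/measurable_EFinP.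
rewrite ge0_integralZr//; last 2 first.
- by apply/measurable_EFinP; exact: measurableT_comp.
- exact: integral_ge0.
by rewrite lte_mul_pinfty// ?ge0_fin_numE// integral_ge0.
Qed.

Lemma integrable_tensor : (lam n.+1).-integrable setT (EFin \o h).
Proof.
apply/integrableP; split; first exact/measurable_EFinP.
rewrite ge0_integral_lebesgue_rVS//.
by apply/measurableT_comp => //; exact/measurable_EFinP.
Qed.

Lemma Rintegral_tensor :
  \int[lam n.+1]_u h u = \int[mu]_a f a * \int[lam n]_v g v.
Proof.
have mc : measurable_fun setT (@rV_cons R n : measurableTypeR R * 'rV[R]_n -> _).
  exact: measurable_rV_cons.
pose M : {measure set (measurableTypeR R * 'rV[R]_n) -> \bar R} := (mu \x lam n)%E.
have ihc : M.-integrable setT (fun z => (h (rV_cons z))%:E).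
  have mhc : measurable_fun setT (fun z : measurableTypeR R * 'rV[R]_n => (h (rV_cons z))%:E).
    by apply/measurable_EFinP; exact: (measurableT_comp mh mc).
  exact: (@integrable12ltyP _ _ _ _ _ mu (lam n) _ mhc).2 tensor_lty.
have mEh : measurable_fun setT (EFin \o h) by exact/measurable_EFinP.
rewrite /Rintegral.
have -> : (\int[lam n.+1]_u (h u)%:E = \int[M]_z (h (rV_cons z))%:E)%E.
  exact: (integral_pushforward mc mEh ihc measurableT).
have -> : (\int[M]_z (h (rV_cons z))%:E =
    \int[mu]_a \int[lam n]_v (h (rV_cons (a, v)))%:E)%E.
  exact: (esym (integral12_prod_meas1 ihc)).
have gfin : (\int[lam n]_v (g v)%:E)%E \is a fin_num by exact: integrable_fin_num.
rewrite (_ : (fun a => _) = fun a => ((f a)%:E * \int[lam n]_v (g v)%:E)%E); last first.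
  apply/funext => a; rewrite -integralZl//.
  by apply: eq_integral => v _; rewrite hcE EFinM.
rewrite -(fineK gfin) integralZr// fineM//; exact: integrable_fin_num.
Qed.

End tensor.

Section gaussian_rV.
Context {R : realType}.
Local Notation mu := (@lebesgue_measure R).
Local Notation lam n := (@lebesgue_rV R n).

Definition gauss_rV n (a : R) (x : 'rV[R]_n) : R := expR (- (a * dotv x x)).

Lemma gauss_rV_behead n (a : R) (x : 'rV[R]_n.+1) :
  gauss_rV a x = gaussian a (x ord0 ord0) * gauss_rV a (rV_behead x).
Proof.
by rewrite /gauss_rV /gaussian -expRD dotv_behead mulrDr opprD expr2.
Qed.

Lemma gauss_rV_gt0 n (a : R) (x : 'rV[R]_n) : 0 < gauss_rV a x.
Proof. exact: expR_gt0. Qed.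

Lemma measurable_gauss_rV n (a : R) : measurable_fun setT (@gauss_rV n a).
Proof.
rewrite /gauss_rV; apply: measurableT_comp => //=.
apply: measurableT_comp => //=; apply: measurable_funM => //.
exact: measurable_dotv.
Qed.

Lemma integrable_gauss_rV n (a : R) : 0 < a ->
  (lam n).-integrable setT (EFin \o @gauss_rV n a).
Proof.
move=> a0; elim: n => [|n IH].
  apply: measurable_bounded_integrable => //.
  - by rewrite /= diracT ltry.
  - exact: measurable_gauss_rV.
  - exists 1; split; first exact: num_real.
    move=> M M1 x _ /=; rewrite ger0_norm ?(ltW (gauss_rV_gt0 _ _))//.
    by rewrite /gauss_rV /dotv big_ord0 mulr0 oppr0 expR0 ltW.
apply: (integrable_tensor _ (@gauss_rV_behead n a)) => //.
  exact: measurable_gauss_rV.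
exact: integrable_gaussian.
Qed.

Lemma integrable_gauss_rVM n (a : R) (f : 'rV[R]_n -> R) : 0 < a ->
  measurable_fun setT f -> (exists2 M, 0 <= M & forall u, `|f u| <= M) ->
  (lam n).-integrable setT (fun u => (gauss_rV a u * f u)%:E).
Proof.
move=> a0 mf [M M0 f1].
have := integrableZl measurableT M (integrable_gauss_rV n a0).
apply: le_integrable => //.
  by apply/measurable_EFinP/measurable_funM => //; exact: measurable_gauss_rV.
move=> u _; rewrite lee_fin !normrM mulrC ler_wpM2r//.
by rewrite (ger0_norm M0).
Qed.

Lemma measurable_cos_dotv n (x : 'rV[R]_n) :
  measurable_fun setT (fun u => cos (dotv u x)).
Proof.
have mc : measurable_fun setT (@cos R).
  by apply: continuous_measurable_fun; exact: continuous_cos.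
exact: (measurableT_comp mc (measurable_dotvr x)).
Qed.

Lemma measurable_sin_dotv n (x : 'rV[R]_n) :
  measurable_fun setT (fun u => sin (dotv u x)).
Proof.
have mc : measurable_fun setT (@sin R).
  by apply: continuous_measurable_fun; exact: continuous_sin.
exact: (measurableT_comp mc (measurable_dotvr x)).
Qed.

(** Induction on the dimension: the cosine of a sum expands into two products, and the one with
    sines vanishes because its one-dimensional factor is the integral of an odd function. *)
Lemma Rintegral_gauss_rV_cos n (a : R) (x : 'rV[R]_n) : 0 < a ->
  \int[lam n]_u (gauss_rV a u * cos (dotv u x)) =
  \int[lam n]_u gauss_rV a u * gauss_rV (4 * a)^-1 x.
Proof.
move=> a0; elim: n x => [|n IH] x.
  rewrite {3}/gauss_rV /dotv big_ord0 mulr0 oppr0 expR0 mulr1.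
  by apply: eq_Rintegral => u _; rewrite big_ord0 cos0 mulr1.
pose y := rV_behead x; pose x0 := x ord0 ord0.
have mh (f : R -> R) (g : 'rV[R]_n -> R) :
    measurable_fun setT f -> measurable_fun setT g ->
    measurable_fun setT (fun u : 'rV[R]_n.+1 => f (u ord0 ord0) * g (rV_behead u)).
  move=> mf mg; apply: measurable_funM.
    exact: (measurableT_comp mf (measurable_coord ord0)).
  exact: (measurableT_comp mg (@measurable_rV_behead R n)).
have mG := @measurable_gauss_rV n a; have mg := @measurable_gaussian R a.
have mc : measurable_fun setT (fun u : R => cos (u * x0)).
  by apply: continuous_measurable_fun; exact: continuous_cosM.
have ms : measurable_fun setT (fun u : R => sin (u * x0)).
  by apply: continuous_measurable_fun; exact: continuous_sinM.
have mcy := measurable_cos_dotv y; have msy := measurable_sin_dotv y.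
have ic := integrable_gaussianM a0 mc (fun u => cos_max _).
have ints := integrable_gaussianM a0 ms (fun u => sin_max _).
have icy : (lam n).-integrable setT (fun u => (gauss_rV a u * cos (dotv u y))%:E).
  by apply: integrable_gauss_rVM => //; exists 1 => // u; exact: cos_max.
have isy : (lam n).-integrable setT (fun u => (gauss_rV a u * sin (dotv u y))%:E).
  by apply: integrable_gauss_rVM => //; exists 1 => // u; exact: sin_max.
pose h1 (u : 'rV[R]_n.+1) := gaussian a (u ord0 ord0) * cos (u ord0 ord0 * x0) *
  (gauss_rV a (rV_behead u) * cos (dotv (rV_behead u) y)).
pose h2 (u : 'rV[R]_n.+1) := gaussian a (u ord0 ord0) * sin (u ord0 ord0 * x0) *
  (gauss_rV a (rV_behead u) * sin (dotv (rV_behead u) y)).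
have mh1 : measurable_fun setT h1.
  by apply: (mh (fun t => gaussian a t * cos (t * x0))
    (fun v => gauss_rV a v * cos (dotv v y))); exact: measurable_funM.
have mh2 : measurable_fun setT h2.
  by apply: (mh (fun t => gaussian a t * sin (t * x0))
    (fun v => gauss_rV a v * sin (dotv v y))); exact: measurable_funM.
have E1 := Rintegral_tensor mh1 (fun=> erefl) ic icy.
have E2 := Rintegral_tensor mh2 (fun=> erefl) ints isy.
have i1 := integrable_tensor mh1 (fun=> erefl) ic icy.
have i2 := integrable_tensor mh2 (fun=> erefl) ints isy.
have EZ := Rintegral_tensor (@measurable_gauss_rV n.+1 a) (@gauss_rV_behead n a)
  (integrable_gaussian a0) (integrable_gauss_rV n a0).
rewrite EZ gauss_rV_behead.
transitivity (\int[lam n.+1]_u (h1 u - h2 u)).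
  apply: eq_Rintegral => u _; rewrite gauss_rV_behead dotv_behead cosD /h1 /h2.
  by rewrite -/y -/x0; ring.
rewrite RintegralB// E1 E2 Rintegral_gaussian_sin mul0r subr0.
by rewrite IH Rintegral_gaussian_cos// -/y -/x0; ring.
Qed.

End gaussian_rV.

(** * Gaussian approximation of the identity *)

Section concentration.
Context {R : realType} {n : nat}.
Local Notation lam := (@lebesgue_rV R n).
Implicit Types (d e a : R) (x : 'rV[R]_n).

Definition gauss_mass a : R := \int[lam]_x gauss_rV a x.

Lemma gauss_massE a : 0 < a ->
  (\int[lam]_x (gauss_rV a x)%:E = (gauss_mass a)%:E)%E.
Proof.
by move=> a0; rewrite /gauss_mass /Rintegral fineK//; apply: integrable_fin_num => //;
  exact: integrable_gauss_rV.
Qed.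

Let measurable_EgaussT D a : measurable_fun D (fun x => (gauss_rV a x)%:E).
Proof.
by apply: measurable_funTS; apply/measurable_EFinP; exact: measurable_gauss_rV.
Qed.

Let gauss_ge0 a x : (0 <= (gauss_rV a x)%:E)%E.
Proof. by rewrite lee_fin ltW// gauss_rV_gt0. Qed.

(** On the cube [dotv x x] is at most [n r^2]. The resulting lower bound is what the tail is
    compared with in [gauss_concentration]. *)
Lemma gauss_mass_ge_box a r : 0 < a -> 0 < r ->
  expR (- (a * (n%:R * r ^+ 2))) * (2 * r) ^+ n <= gauss_mass a.
Proof.
move=> a0 r0; rewrite -lee_fin -gauss_massE// EFinM -lebesgue_rV_box//.
have mb := @measurable_rV_box R n r.
rewrite -integral_cst//.
apply: (@le_trans _ _ (\int[lam]_(x in rV_box r) (gauss_rV a x)%:E)%E).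
  apply: ge0_le_integral => //.
  - by move=> x _; rewrite lee_fin expR_ge0.
  - move=> x xr; rewrite lee_fin ler_expR lerN2 ler_wpM2l ?(ltW a0)//.
    rewrite (_ : _ * _ = \sum_(i < n) r ^+ 2); last first.
      by rewrite sumr_const card_ord mulr_natl.
    rewrite /dotv.
    apply: ler_sum => i _; rewrite -expr2 -[_ ^+ 2]real_normK ?num_real//.
    by rewrite ler_sqr ?nnegrE ?(ltW r0)// ltW//; exact: xr.
by apply: ge0_subset_integral.
Qed.

Lemma gauss_mass_gt0 a : 0 < a -> 0 < gauss_mass a.
Proof.
move=> a0; apply: lt_le_trans (gauss_mass_ge_box a0 ltr01).
by rewrite mulr_gt0 ?expR_gt0// exprn_gt0// mulr_gt0.
Qed.

(** Off the cube [dotv x x >= d^2], so the tail is at most [expR (- k d^2) * gauss_mass 1], whereas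
    the total mass is at least of order [expR (- k d^2 / 4)]. *)
Lemma gauss_concentration d e : 0 < d -> 0 < e ->
  \forall k \near \oo,
  (\int[lam]_(x in ~` rV_box d) (gauss_rV k.+1%:R x)%:E
    <= (e * gauss_mass k.+1%:R)%:E)%E.
Proof.
(* This [r] satisfies [n r^2 <= d^2 / 4], and [n.+1] covers dimension 0. *)
move=> d0 e0; pose r := d / (2 * n.+1%:R).
have r0 : 0 < r by rewrite divr_gt0// mulr_gt0.
have nr : n%:R * r ^+ 2 <= d ^+ 2 / 4.
  have n1 : 0 < n.+1%:R :> R by rewrite ltr0n.
  rewrite (_ : _ * _ = d ^+ 2 / 4 * (n%:R / n.+1%:R ^+ 2)); last first.
    by rewrite /r; field; rewrite gt_eqF.
  rewrite ler_piMr ?divr_ge0 ?sqr_ge0// ler_pdivrMr ?exprn_gt0// mul1r.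
  rewrite -natrX ler_nat.
  by rewrite (leq_trans (leqnSn n))// expnS expn1 leq_pmulr.
(* [C] collects the constants of the comparison; half of the decay, [expR (k d^2 / 2)], is spent on
   exceeding it. *)
pose C := gauss_mass 1 * expR (d ^+ 2 / 4) / (e * (2 * r) ^+ n).
have rn : 0 < (2 * r) ^+ n by rewrite exprn_gt0// mulr_gt0.
near=> k.
have kC : C / (d ^+ 2 / 2) <= k%:R by near: k; exact: nbhs_infty_ger.
have {}kC : C <= expR (k%:R * (d ^+ 2 / 2)).
  apply: le_trans (expR_ge1Dx _).
  by rewrite ler_pdivrMr in kC; [lra|rewrite divr_gt0// exprn_gt0].
have mCb : measurable (~` (rV_box d) : set 'rV[R]_n).
  by apply: measurableC; exact: measurable_rV_box.
apply: (@le_trans _ _ (expR (- (k%:R * d ^+ 2)) * gauss_mass 1)%:E); last first.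
  rewrite lee_fin.
  apply: (@le_trans _ _ (e * (expR (- (k.+1%:R * (d ^+ 2 / 4))) * (2 * r) ^+ n))).
    rewrite ler_pdivrMr ?mulr_gt0// in kC.
    have YX : expR (- (k%:R * d ^+ 2)) * expR (k%:R * (d ^+ 2 / 2)) <=
        expR (- (k.+1%:R * (d ^+ 2 / 4))) * expR (d ^+ 2 / 4).
      rewrite -!expRD ler_expR -[k.+1%:R]natr1.
      have : 0 <= k%:R * d ^+ 2 by rewrite mulr_ge0 ?sqr_ge0.
      by lra.
    rewrite -(@ler_pM2r _ (expR (d ^+ 2 / 4))) ?expR_gt0// -mulrA.
    apply: le_trans (ler_wpM2l (expR_ge0 _) kC) _.
    have eB : 0 <= e * (2 * r) ^+ n by rewrite mulr_ge0 ?(ltW e0) ?(ltW rn).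
    have := ler_wpM2r eB YX; rewrite -mulrA => /le_trans; apply.
    by rewrite le_eqVlt; apply/orP; left; apply/eqP; ring.
  rewrite ler_pM2l//; apply: le_trans (gauss_mass_ge_box _ r0); last by rewrite ltr0n.
  by rewrite ler_wpM2r ?(ltW rn)// ler_expR lerN2 ler_wpM2l.
rewrite EFinM -gauss_massE// -ge0_integralZl//.
apply: (@le_trans _ _ (\int[lam]_(x in ~` rV_box d)
    ((expR (- (k%:R * d ^+ 2)))%:E * (gauss_rV 1 x)%:E))%E); last first.
  apply: ge0_subset_integral => //.
    by apply: measurable_funeM.
  by move=> x _; rewrite mule_ge0// lee_fin expR_ge0.
apply: ge0_le_integral => //.
- exact: measurable_funeM.
move=> x xd; rewrite -EFinM lee_fin /gauss_rV -expRD ler_expR mul1r.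
have {xd} : d ^+ 2 <= dotv x x.
  have [i di] : exists i, d <= `|x ord0 i|.
    apply: contrapT => /forallNP h; apply: xd => i.
    by rewrite ltNge; apply/negP; exact: h.
  rewrite /dotv (bigD1 i)//=.
  apply: (@le_trans _ _ (x ord0 i * x ord0 i)).
    by rewrite -expr2 -[leRHS]real_normK ?num_real// ler_sqr ?nnegrE ?(ltW d0).
  by rewrite lerDl; apply: sumr_ge0 => j _; rewrite -expr2 sqr_ge0.
rewrite -[k.+1%:R]natr1 => h; rewrite mulrDl mul1r opprD lerD2r lerN2.
by rewrite ler_wpM2l.
Unshelve. all: end_near. Qed.

(** Only a lower bound near 0 enters, which suits functions that are merely lower semicontinuous and
    possibly infinite. It passes to the Gaussian averages up to the mass outside a cube. *)
Lemma gauss_approx_identity (F : 'rV[R]_n -> \bar R) (c e : R) :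
  measurable_fun setT F -> (forall x, 0 <= F x)%E -> 0 <= c -> 0 < e ->
  (\forall x \near (0 : 'rV[R]_n), (c%:E < F x)%E) ->
  \forall k \near \oo,
  ((c * (1 - e) * gauss_mass k.+1%:R)%:E
    <= \int[lam]_x ((gauss_rV k.+1%:R x)%:E * F x))%E.
Proof.
move=> mF F0 c0 e0 /nbhs_rV_box[d d0 dF].
have := gauss_concentration d0 e0; apply: filterS => k hk.
have k0 : 0 < k.+1%:R :> R by rewrite ltr0n.
have mb := @measurable_rV_box R n d.
have mG := measurable_EgaussT.
apply: (@le_trans _ _ (\int[lam]_(x in rV_box d) ((gauss_rV k.+1%:R x)%:E * F x))%E);
  last first.
  apply: ge0_subset_integral => //.
    exact: emeasurable_funM.
  by move=> x _; rewrite mule_ge0.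
apply: (@le_trans _ _ (\int[lam]_(x in rV_box d) (c%:E * (gauss_rV k.+1%:R x)%:E))%E);
  last first.
  apply: ge0_le_integral => //.
  - by move=> x _; rewrite mule_ge0.
  - exact: measurable_funeM.
  - by apply: emeasurable_funM => //; exact: measurable_funTS.
  - move=> x xd; rewrite muleC lee_pmul2l ?lte_fin ?gauss_rV_gt0//.
    by apply: ltW; have := dF _ xd; rewrite add0r.
rewrite ge0_integralZl// -mulrA EFinM lee_wpmul2l//.
have mCb : measurable (~` (rV_box d) : set 'rV[R]_n) by exact: measurableC.
have := gauss_massE k0.
rewrite -(setUv (rV_box d)) ge0_integral_setU//; last first.
  by rewrite disj_set2E setICr.
have fin A : measurable A ->
    (\int[lam]_(x in A) (gauss_rV k.+1%:R x)%:E)%E \is a fin_num.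
  move=> mA; apply: integrable_fin_num => //.
  by apply: (integrableS measurableT) => //; exact: integrable_gauss_rV.
move: hk; rewrite -(fineK (fin _ mb)) -(fineK (fin _ mCb)) -EFinD !lee_fin.
by move=> hk [E]; rewrite -E in hk *; lra.
Qed.

End concentration.

(** * Fourier transforms with a Gaussian weight *)

Section real_fubini.
Context d1 d2 (T1 : measurableType d1) (T2 : measurableType d2) (R : realType).
Variables (m1 : {sigma_finite_measure set T1 -> \bar R})
  (m2 : {sigma_finite_measure set T2 -> \bar R}).
Variable f : T1 -> T2 -> R.
Hypothesis mf : measurable_fun setT (fun z : T1 * T2 => f z.1 z.2).

Lemma measurable_Rintegral_param :
  measurable_fun setT (fun x => \int[m2]_y f x y).
Proof.
apply: (measurableT_comp (@fine_measurable R _ measurableT)).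
pose g (z : T1 * T2) := (f z.1 z.2)%:E.
have mg : measurable_fun setT g by exact/measurable_EFinP.
rewrite (_ : (fun x => _) = (fun x => fubini_F m2 g^\+ x - fubini_F m2 g^\- x)%E).
  apply: emeasurable_funB; apply: measurable_fun_fubini_tonelli_F => //.
    exact: measurable_funepos.
  exact: measurable_funeneg.
apply/funext => x; rewrite /fubini_F [LHS]integralE; congr (_ - _)%E.
  by apply: eq_integral => y _; rewrite !funeposE.
by apply: eq_integral => y _; rewrite !funenegE.
Qed.

Lemma Rintegral_fubini (g : T1 -> R) (h : T2 -> R) :
  m1.-integrable setT (EFin \o g) -> m2.-integrable setT (EFin \o h) ->
  (forall x y, `|f x y| <= g x * h y) ->
  \int[m2]_y \int[m1]_x f x y = \int[m1]_x \int[m2]_y f x y.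
Proof.
move=> ig ih fgh.
pose F (z : T1 * T2) := (f z.1 z.2)%:E.
have mF : measurable_fun setT F by exact/measurable_EFinP.
have mg : measurable_fun setT g by apply/measurable_EFinP; exact: (measurable_int m1).
have mh : measurable_fun setT h by apply/measurable_EFinP; exact: (measurable_int m2).
have ix x : m2.-integrable setT (fun y => (f x y)%:E).
  apply: le_integrable (integrableZl measurableT (g x) ih) => //.
    exact: (measurableT_comp mF (measurable_pair1 x)).
  by move=> y _; rewrite -EFinM lee_fin (le_trans (fgh x y))// ler_norm.
have iy y : m1.-integrable setT (fun x => (f x y)%:E).
  apply: le_integrable (integrableZl measurableT (h y) ig) => //.
    exact: (measurableT_comp mF (measurable_pair2 y)).
  by move=> x _; rewrite -EFinM lee_fin (le_trans (fgh x y))// mulrC ler_norm.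
have iF : (m1 \x m2)%E.-integrable setT F.
  apply/(@integrable12ltyP _ _ _ _ _ m1 m2 _ mF).
  apply: (@le_lt_trans _ _ (\int[m1]_x (`|g x|%:E * \int[m2]_y `|(h y)%:E|))%E).
    apply: ge0_le_integral => //.
    - by move=> x _; exact: integral_ge0.
    - apply: (@measurable_fun_fubini_tonelli_F _ _ _ _ _ m2 (abse \o F)).
        exact: measurableT_comp.
      by move=> z; exact: abse_ge0.
    - under eq_fun do rewrite muleC; apply: measurable_funeM.
      by apply/measurable_EFinP; exact: measurableT_comp.
    - move=> x _; rewrite -ge0_integralZl//.
      + apply: ge0_le_integral => //.
        * exact: (measurableT_comp _ (measurable_int m2 (ix x))).
        * apply: measurable_funeM; apply: measurableT_comp => //.
          exact/measurable_EFinP.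
        * move=> y _; rewrite /= -EFinM lee_fin -normrM.
          by rewrite (le_trans (fgh x y))// ler_norm.
      + by apply: measurableT_comp => //; exact/measurable_EFinP.
  have /integrableP[_ goo] := ig; have /integrableP[_ hoo] := ih.
  rewrite ge0_integralZr//; last 2 first.
  - by apply/measurable_EFinP; exact: measurableT_comp.
  - exact: integral_ge0.
  by rewrite lte_mul_pinfty// ?ge0_fin_numE// integral_ge0.
rewrite /Rintegral; congr fine.
transitivity (\int[m2]_y \int[m1]_x F (x, y))%E.
  by apply: eq_integral => y _; rewrite fineK//; exact: integrable_fin_num.
rewrite -Fubini//.
by apply: eq_integral => x _; rewrite fineK//; exact: integrable_fin_num.
Qed.

End real_fubini.

Section gauss_fourier.
Context {R : realType} {n : nat}.
Local Notation lam := (@lebesgue_rV R n).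
Implicit Types (a : R) (A B w : 'rV[R]_n -> R) (x y u : 'rV[R]_n).

(* The real part of the integral of gauss_rV a u * (A u + i B u) e^{-i u.x}. *)
Definition gauss_ft a A B x : R :=
  \int[lam]_u (gauss_rV a u * (A u * cos (dotv u x) + B u * sin (dotv u x))).

Definition bounded_by (M : R) (f : 'rV[R]_n -> R) := forall u, `|f u| <= M.

Lemma integrable_gauss_ft a A B x M N : 0 < a ->
  measurable_fun setT A -> measurable_fun setT B ->
  bounded_by M A -> bounded_by N B ->
  lam.-integrable setT (fun u =>
    (gauss_rV a u * (A u * cos (dotv u x) + B u * sin (dotv u x)))%:E).
Proof.
move=> a0 mA mB AM BN; apply: integrable_gauss_rVM => //.
  apply: measurable_funD; apply: measurable_funM => //.
    exact: measurable_cos_dotv.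
  exact: measurable_sin_dotv.
exists (M + N).
  by rewrite addr_ge0// (le_trans _ (AM 0), le_trans _ (BN 0)).
move=> u; rewrite (le_trans (ler_normD _ _))// !normrM lerD//.
  by rewrite (le_trans (ler_piMr _ (cos_max _))).
by rewrite (le_trans (ler_piMr _ (sin_max _))).
Qed.

Section convolution.
Variables (kappa : {sigma_finite_measure set 'rV[R]_n -> \bar R}) (w : 'rV[R]_n -> R).
Hypothesis iw : kappa.-integrable setT (EFin \o w).

(** Real and imaginary part of the Fourier transform of the measure with density [w] relative to
    [kappa]; the weight lets [kappa] and its tilt be integrals over the same measure. *)
Definition cos_int u := \int[kappa]_y (cos (dotv u y) * w y).
Definition sin_int u := \int[kappa]_y (sin (dotv u y) * w y).

Let mw : measurable_fun setT w.
Proof. by apply/measurable_EFinP; exact: (measurable_int kappa). Qed.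

Let mdot2 : measurable_fun setT (fun z : 'rV[R]_n * 'rV[R]_n => dotv z.1 z.2).
Proof. by apply: measurable_dotv. Qed.

Let mcos : measurable_fun setT (@cos R).
Proof. by apply: continuous_measurable_fun; exact: continuous_cos. Qed.

Let msin : measurable_fun setT (@sin R).
Proof. by apply: continuous_measurable_fun; exact: continuous_sin. Qed.

Lemma measurable_cos_int : measurable_fun setT cos_int.
Proof.
apply: measurable_Rintegral_param; apply: measurable_funM.
  exact: (measurableT_comp mcos mdot2).
exact: (measurableT_comp mw measurable_snd).
Qed.

Lemma measurable_sin_int : measurable_fun setT sin_int.
Proof.
apply: measurable_Rintegral_param; apply: measurable_funM.
  exact: (measurableT_comp msin mdot2).
exact: (measurableT_comp mw measurable_snd).
Qed.

Lemma integrable_cosw u : kappa.-integrable setT (fun y => (cos (dotv u y) * w y)%:E).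
Proof.
apply: le_integrable iw => //.
  apply/measurable_EFinP/measurable_funM => //.
  exact: (measurableT_comp mcos (measurable_dotvl u)).
by move=> y _; rewrite lee_fin normrM ler_piMl// cos_max.
Qed.

Lemma integrable_sinw u : kappa.-integrable setT (fun y => (sin (dotv u y) * w y)%:E).
Proof.
apply: le_integrable iw => //.
  apply/measurable_EFinP/measurable_funM => //.
  exact: (measurableT_comp msin (measurable_dotvl u)).
by move=> y _; rewrite lee_fin normrM ler_piMl// sin_max.
Qed.

Lemma cos_int_bounded : bounded_by (\int[kappa]_y `|w y|) cos_int.
Proof.
move=> u; apply: (le_trans (le_normr_Rintegral measurableT (integrable_cosw u))).
apply: le_Rintegral => //; [exact: integrable_norm (integrable_cosw u)|exact: integrable_norm|].
by move=> y _; rewrite normrM ler_piMl// cos_max.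
Qed.

Lemma sin_int_bounded : bounded_by (\int[kappa]_y `|w y|) sin_int.
Proof.
move=> u; apply: (le_trans (le_normr_Rintegral measurableT (integrable_sinw u))).
apply: le_Rintegral => //; [exact: integrable_norm (integrable_sinw u)|exact: integrable_norm|].
by move=> y _; rewrite normrM ler_piMl// sin_max.
Qed.

(** Convolution with [w kappa] multiplies [A + i B] by [cos_int + i sin_int], and the pair on the
    right is this complex product. Fubini applies because the integrand is dominated by a multiple
    of [gauss_rV a u * |w y|]. *)
Lemma gauss_ft_convolution a A B M N x : 0 < a ->
  measurable_fun setT A -> measurable_fun setT B ->
  bounded_by M A -> bounded_by N B ->
  \int[kappa]_y (gauss_ft a A B (x - y) * w y) =
  gauss_ft a (fun u => A u * cos_int u - B u * sin_int u)
             (fun u => A u * sin_int u + B u * cos_int u) x.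
Proof.
move=> a0 mA mB AM BN.
pose f u y := gauss_rV a u *
  (A u * cos (dotv u (x - y)) + B u * sin (dotv u (x - y))) * w y.
have mxy : measurable_fun setT (fun z : 'rV[R]_n * 'rV[R]_n => dotv z.1 (x - z.2)).
  apply: measurable_dotv => //.
  exact: (measurableT_comp (measurable_rV_subl x) measurable_snd).
have mf : measurable_fun setT (fun z : 'rV[R]_n * 'rV[R]_n => f z.1 z.2).
  apply: measurable_funM; last exact: (measurableT_comp mw measurable_snd).
  apply: measurable_funM.
    exact: (measurableT_comp (measurable_gauss_rV a) measurable_fst).
  apply: measurable_funD; apply: measurable_funM.
  - exact: (measurableT_comp mA measurable_fst).
  - exact: (measurableT_comp mcos mxy).
  - exact: (measurableT_comp mB measurable_fst).
  - exact: (measurableT_comp msin mxy).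
transitivity (\int[kappa]_y \int[lam]_u f u y).
  apply: eq_Rintegral => y _; rewrite RintegralZr//.
  exact: integrable_gauss_ft AM BN.
have ig : lam.-integrable setT (EFin \o (fun u => gauss_rV a u * (M + N))).
  apply: integrable_gauss_rVM => //; exists `|M + N| => //.
have ih : kappa.-integrable setT (EFin \o (fun y => `|w y|)) by exact: integrable_norm.
rewrite (Rintegral_fubini mf ig ih); last first.
  move=> u y; rewrite /f normrM ler_wpM2r// normrM ger0_norm ?(ltW (gauss_rV_gt0 _ _))//.
  rewrite ler_wpM2l ?(ltW (gauss_rV_gt0 _ _))//.
  rewrite (le_trans (ler_normD _ _))// !normrM lerD//.
    by rewrite (le_trans (ler_piMr _ (cos_max _))).
  by rewrite (le_trans (ler_piMr _ (sin_max _))).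
apply: eq_Rintegral => u _.
(* [al] and [be] are the coefficients of [cos (dotv u y)] and [sin (dotv u y)] once the angles [u.x]
   and [u.y] are separated. *)
pose al := gauss_rV a u * (A u * cos (dotv u x) + B u * sin (dotv u x)).
pose be := gauss_rV a u * (A u * sin (dotv u x) - B u * cos (dotv u x)).
have i1 := integrableZl measurableT al (integrable_cosw u).
have i2 := integrableZl measurableT be (integrable_sinw u).
transitivity (\int[kappa]_y (al * (cos (dotv u y) * w y) + be * (sin (dotv u y) * w y))).
  apply: eq_Rintegral => y _; rewrite /f dotvBr cosB sinB /al /be. ring.
rewrite RintegralD// RintegralZl//; last exact: integrable_cosw.
rewrite RintegralZl//; last exact: integrable_sinw.
rewrite -/(cos_int u) -/(sin_int u) /al /be. ring.
Qed.

End convolution.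

End gauss_fourier.

(** With [y = x / (n + 1)] and [1 + y > 0], one has [expR (y / (1 + y)) <= 1 + y <= expR y], both
    instances of [1 + v <= expR v]; raised to the power [n + 1] they squeeze the sequence. *)
Lemma cvg_expR_pow (R : realType) (x : R) :
  (1 + x / n.+1%:R) ^+ n.+1 @[n --> \oo] --> expR x.
Proof.
have cx : x / n.+1%:R @[n --> \oo] --> 0.
  rewrite -(mulr0 x); apply: cvgM; first exact: cvg_cst.
  exact: cvg_harmonic.
have cd : expR (x / (1 + x / n.+1%:R)) @[n --> \oo] --> expR x.
  apply: (@continuous_cvg _ _ _ _ _ (fun n : nat => x / (1 + x / n.+1%:R)) (@expR R));
    first exact: continuous_expR.
  rewrite -[X in _ --> X]divr1; apply: cvgM; first exact: cvg_cst.
  apply: cvgV; first exact: oner_neq0.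
  by rewrite -[X in _ --> X]addr0; apply: cvgD => //; exact: cvg_cst.
apply: (squeeze_cvgr _ cd (@cvg_cst _ (expR x) _ _ _)).
near=> n.
have n0 : 0 < n.+1%:R :> R by rewrite ltr0n.
have nx : `|x / n.+1%:R| < 1.
  by near: n; have /cvgr0Pnorm_lt := cx; exact.
set y := x / _ in nx *.
have xE : x = n.+1%:R * y by rewrite /y mulrC divfK// gt_eqF.
have y1 : 0 < 1 + y by move: nx; rewrite ltr_norml; lra.
apply/andP; split.
  rewrite {1}xE -mulrA expRM_natl lerXn2r ?nnegrE ?expR_ge0 ?(ltW y1)//.
  rewrite -lef_pV2 ?posrE ?expR_gt0// -expRN.
  apply: le_trans (expR_ge1Dx _); rewrite le_eqVlt; apply/orP; left; apply/eqP.
  by field; rewrite gt_eqF.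
rewrite xE expRM_natl lerXn2r ?nnegrE ?expR_ge0 ?(ltW y1)//.
exact: expR_ge1Dx.
Unshelve. all: end_near. Qed.

Section gauss_fourier_limits.
Context {R : realType} {n : nat}.
Local Notation lam := (@lebesgue_rV R n).
Variable a : R.
Hypothesis a0 : 0 < a.
Implicit Types (A B : 'rV[R]_n -> R) (x : 'rV[R]_n).

Lemma measurable_gauss_ft A B :
  measurable_fun setT A -> measurable_fun setT B ->
  measurable_fun setT (gauss_ft a A B).
Proof.
move=> mA mB; apply: measurable_Rintegral_param.
have mxy : measurable_fun setT (fun z : 'rV[R]_n * 'rV[R]_n => dotv z.2 z.1).
  exact: measurable_dotv.
have mcos : measurable_fun setT (@cos R).
  by apply: continuous_measurable_fun; exact: continuous_cos.
have msin : measurable_fun setT (@sin R).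
  by apply: continuous_measurable_fun; exact: continuous_sin.
apply: measurable_funM.
  exact: (measurableT_comp (measurable_gauss_rV a) measurable_snd).
apply: measurable_funD; apply: measurable_funM.
- exact: (measurableT_comp mA measurable_snd).
- exact: (measurableT_comp mcos mxy).
- exact: (measurableT_comp mB measurable_snd).
- exact: (measurableT_comp msin mxy).
Qed.

Lemma gauss_ft_bounded A B M N :
  measurable_fun setT A -> measurable_fun setT B ->
  bounded_by M A -> bounded_by N B ->
  bounded_by (\int[lam]_u (gauss_rV a u * (M + N))) (gauss_ft a A B).
Proof.
move=> mA mB AM BN x.
have i1 := integrable_gauss_ft x a0 mA mB AM BN.
apply: (le_trans (le_normr_Rintegral measurableT i1)).
apply: le_Rintegral => //; first exact: integrable_norm i1.
  by apply: integrable_gauss_rVM => //; exists `|M + N|.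
move=> u _; rewrite normrM ger0_norm ?(ltW (gauss_rV_gt0 _ _))//.
rewrite ler_wpM2l ?(ltW (gauss_rV_gt0 _ _))//.
rewrite (le_trans (ler_normD _ _))// !normrM lerD//.
  by rewrite (le_trans (ler_piMr _ (cos_max _))).
by rewrite (le_trans (ler_piMr _ (sin_max _))).
Qed.

Lemma gauss_ftZ A M c x : measurable_fun setT A -> bounded_by M A ->
  gauss_ft a (fun u => c * A u) (cst 0) x = c * gauss_ft a A (cst 0) x.
Proof.
move=> mA bA; rewrite /gauss_ft -RintegralZl//; last first.
  by apply: (@integrable_gauss_ft _ _ _ _ _ _ M 0) => // u; rewrite normr0.
by apply: eq_Rintegral => u _; rewrite /cst; ring.
Qed.

Lemma gauss_ft_cvg (A_ : nat -> 'rV[R]_n -> R) A M x :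
  (forall k, measurable_fun setT (A_ k)) -> measurable_fun setT A ->
  (forall k, bounded_by M (A_ k)) ->
  (forall u, A_ k u @[k --> \oo] --> A u) ->
  gauss_ft a (A_ k) (cst 0) x @[k --> \oo] --> gauss_ft a A (cst 0) x.
Proof.
move=> mA_ mA bA cA; rewrite /gauss_ft /Rintegral.
have bA' : bounded_by M A.
  by move=> u; apply: (cvgr_to_le (cvg_norm (cA u))); apply: nearW => k; exact: bA.
have m0 : measurable_fun setT (cst 0 : 'rV[R]_n -> R) by exact: measurable_cst.
have b0 : bounded_by 0 (cst 0 : 'rV[R]_n -> R) by move=> u; rewrite normr0.
have mf_ k := measurable_int lam (integrable_gauss_ft x a0 (mA_ k) m0 (bA k) b0).
have intA := integrable_gauss_ft x a0 mA m0 bA' b0.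
have mf := measurable_int lam intA.
have iM : lam.-integrable setT (fun u => (gauss_rV a u * M)%:E).
  by apply: integrable_gauss_rVM => //; exists `|M|.
have [||_ _ h] := dominated_convergence measurableT mf_ mf _ iM.
- apply: aeW => u _; apply/cvg_EFin; first by near=> k.
  apply: cvgM; first exact: cvg_cst.
  apply: cvgD; last exact: cvg_cst.
  by apply: cvgM; [exact: cA|exact: cvg_cst].
- apply: aeW => u k _; rewrite lee_fin /= mul0r addr0 normrM.
  rewrite ger0_norm ?(ltW (gauss_rV_gt0 _ _))//.
  rewrite ler_wpM2l ?(ltW (gauss_rV_gt0 _ _))// normrM.
  by rewrite (le_trans (ler_piMr _ (cos_max _)))//; exact: bA.
apply: fine_cvg; rewrite fineK; first exact: h.
exact: integrable_fin_num.
Unshelve. all: end_near. Qed.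

End gauss_fourier_limits.

(** * Exponential tilt of a finite symmetric measure *)

Section exponential_tilt.
Context {R : realType} {n : nat}.
Local Notation lam := (@lebesgue_rV R n).
Variables (kappa : {finite_measure set 'rV[R]_n -> \bar R}) (a : R) (xi : 'rV[R]_n).
Hypothesis a0 : 0 < a.
Hypothesis kappaN : forall D : set 'rV[R]_n, measurable D ->
  kappa (-%R @` D) = kappa D.

Let w (y : 'rV[R]_n) := expR (dotv xi y).
Hypothesis iw : kappa.-integrable setT (EFin \o w).

Let mopp : measurable_fun setT (-%R : 'rV[R]_n -> 'rV[R]_n).
Proof.
rewrite (_ : -%R = fun x : 'rV[R]_n => 0 - x); first exact: measurable_rV_subl.
by apply/funext => x; rewrite sub0r.
Qed.

Let kappaE (g : 'rV[R]_n -> \bar R) :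
  (\int[pushforward kappa -%R]_y g y = \int[kappa]_y g y)%E.
Proof.
have kE A : measurable A -> pushforward kappa -%R A = kappa A.
  move=> mA; rewrite /pushforward -(kappaN mA); congr (kappa _).
  apply/seteqP; split=> y /=; first by move=> Ay; exists (- y); rewrite ?opprK.
  by move=> [z Az <-]; rewrite opprK.
by apply: eq_measure_integral => A mA _; exact: kE.
Qed.

Let integrable_sym (f : 'rV[R]_n -> R) : kappa.-integrable setT (EFin \o f) ->
  kappa.-integrable setT (fun y => (f (- y))%:E).
Proof.
move=> intf; have mf : measurable_fun setT (EFin \o f) by exact: (measurable_int kappa).
apply/integrableP; split; first exact: (measurableT_comp mf mopp).
have := @ge0_integral_pushforward _ _ _ _ _ _ mopp kappa setT (abse \o (EFin \o f)).
rewrite /= preimage_setT => <- //; first by rewrite kappaE; have /integrableP[] := intf.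
exact: measurableT_comp.
Qed.

Let Rintegral_sym (f : 'rV[R]_n -> R) : kappa.-integrable setT (EFin \o f) ->
  \int[kappa]_y f (- y) = \int[kappa]_y f y.
Proof.
move=> intf; rewrite /Rintegral; congr fine.
have mf : measurable_fun setT (EFin \o f) by exact: (measurable_int kappa).
rewrite -[RHS]kappaE; apply: esym.
exact: (integral_pushforward mopp mf (integrable_sym intf) measurableT).
Qed.

Let one_int : kappa.-integrable setT (EFin \o cst 1).
Proof. exact: finite_measure_integrable_cst. Qed.

Let iw' : kappa.-integrable setT (fun y => (expR (- dotv xi y))%:E).
Proof.
have := integrable_sym iw; apply: eq_integrable => // y _.
by rewrite /w dotvNr.
Qed.

Let ch (y : 'rV[R]_n) := (expR (dotv xi y) + expR (- dotv xi y)) / 2.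

Let ich : kappa.-integrable setT (EFin \o ch).
Proof.
have i1 := integrableZl measurableT 2^-1 iw.
have i2 := integrableZl measurableT 2^-1 iw'.
have := integrableD measurableT i1 i2; apply: eq_integrable => // y _.
by rewrite /= -EFinD /ch mulrDl !(mulrC _ 2^-1).
Qed.

Let ch_ge1 y : 1 <= ch y.
Proof.
rewrite /ch ler_pdivlMr// mul1r expRN.
set e := expR _; have e0 : 0 < e by exact: expR_gt0.
rewrite -(@ler_pM2r _ e)// (_ : (e + _) * _ = e ^+ 2 + 1); last first.
  by field; rewrite gt_eqF.
by have := sqr_ge0 (e - 1); nra.
Qed.

Let psi := \int[kappa]_y (ch y - 1).

Let khat := cos_int kappa (cst 1).
Let ca := cos_int kappa w.
Let sb := sin_int kappa w.
Let W := \int[kappa]_y `|w y|.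

Let W_ge0 : 0 <= W. Proof. by apply: Rintegral_ge0. Qed.

Let sin_int1 u : sin_int kappa (cst 1) u = 0.
Proof.
have i1 := integrable_sinw one_int u.
have := Rintegral_sym i1; rewrite -/(sin_int kappa (cst 1) u).
under eq_Rintegral do rewrite dotvNr sinN -mulN1r -mulrA.
rewrite RintegralZl// -/(sin_int kappa (cst 1) u); lra.
Qed.

(** By symmetry of [kappa] the weight [w] may be replaced by the hyperbolic cosine [ch], and
    [cos * (ch - 1) <= ch - 1] because [ch >= 1]. *)
Let ca_le u : ca u <= khat u + psi.
Proof.
have i1 := integrable_cosw iw u.
have i2 := integrable_cosw iw' u.
have ic := integrable_cosw ich u.
have i0 := integrable_cosw one_int u.
have I2 : \int[kappa]_y (cos (dotv u y) * expR (- dotv xi y)) = ca u.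
  rewrite /ca /cos_int -(Rintegral_sym i1).
  by apply: eq_Rintegral => y _; rewrite /w !dotvNr cosN.
have -> : ca u = \int[kappa]_y (cos (dotv u y) * ch y).
  transitivity (\int[kappa]_y (2^-1 * (cos (dotv u y) * w y) +
      2^-1 * (cos (dotv u y) * expR (- dotv xi y)))).
    rewrite RintegralD//; last 2 first.
    - exact: (integrableZl measurableT 2^-1 i1).
    - exact: (integrableZl measurableT 2^-1 i2).
    rewrite !RintegralZl// I2.
    rewrite -[\int[kappa]_x _]/(ca u); lra.
  by apply: eq_Rintegral => y _; rewrite /w /ch; field.
rewrite -lerBlDl /khat /cos_int -RintegralB// /psi.
have i3 := integrableB measurableT ich one_int.
apply: le_Rintegral => //.
- exact: (integrableB measurableT ic i0).
- move=> y _ /=; rewrite -mulrBr ler_piMl ?subr_ge0 ?ch_ge1 ?cos_le1//.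
Qed.

Let khat_bounded : bounded_by (\int[kappa]_y `|cst 1 y|) khat.
Proof. exact: cos_int_bounded. Qed.

Let mkhat : measurable_fun setT khat.
Proof. exact: measurable_cos_int. Qed.

(** Completing the square, [xi.x - |x|^2 / (4 a) = a |xi|^2 - |x - 2 a xi|^2 / (4 a)]: the tilted
    Gaussian is [E] times its translate by [zeta], and this translation is the factor [e^{i u.zeta}]
    on the Fourier side. *)
Let E := expR (a * dotv xi xi).
Let zeta : 'rV[R]_n := (2 * a) *: xi.

(* The complex number E e^{i u.zeta} (1 + rho (ca u + i sb u))^k. *)
Fixpoint tilt_pow (rho : R) k u : R * R :=
  if k is k'.+1 then
    let p := tilt_pow rho k' u in
    (p.1 + rho * (p.1 * ca u - p.2 * sb u), p.2 + rho * (p.1 * sb u + p.2 * ca u))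
  else (E * cos (dotv u zeta), E * sin (dotv u zeta)).

Let mca : measurable_fun setT ca. Proof. exact: measurable_cos_int. Qed.
Let msb : measurable_fun setT sb. Proof. exact: measurable_sin_int. Qed.
Let bca : bounded_by W ca. Proof. exact: cos_int_bounded. Qed.
Let bsb : bounded_by W sb. Proof. exact: sin_int_bounded. Qed.

Let measurable_tilt_pow rho k :
  measurable_fun setT (fun u => (tilt_pow rho k u).1) /\
  measurable_fun setT (fun u => (tilt_pow rho k u).2).
Proof.
elim: k => [|k [IH1 IH2]] /=.
  split; apply: measurable_funM => //.
    exact: measurable_cos_dotv.
  exact: measurable_sin_dotv.
split; apply: measurable_funD => //; apply: measurable_funM => //.
  by apply: measurable_funB; apply: measurable_funM.
by apply: measurable_funD; apply: measurable_funM.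
Qed.

Let tilt_pow_norm rho k u :
  (tilt_pow rho k u).1 ^+ 2 + (tilt_pow rho k u).2 ^+ 2 =
  E ^+ 2 * ((1 + rho * ca u) ^+ 2 + (rho * sb u) ^+ 2) ^+ k.
Proof.
elim: k => [|k IH] /=.
  by rewrite expr0 mulr1 !exprMn -mulrDr cos2Dsin2 mulr1.
rewrite [X in _ = _ * X]exprS [RHS]mulrCA -IH; ring.
Qed.

Let E_gt0 : 0 < E. Proof. exact: expR_gt0. Qed.

(** Cauchy-Schwarz against the unit vector [(c, s)] leaves the modulus, which is multiplicative.
    Each factor has squared modulus at most [1 + 2 (rho ca + rho^2 W^2)], and [1 + v <= expR v]. *)
Let tilt_pow_le rho k u (c s : R) : 0 <= rho -> c ^+ 2 + s ^+ 2 = 1 ->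
  `|(tilt_pow rho k u).1 * c + (tilt_pow rho k u).2 * s| <=
  E * expR (k%:R * (rho * ca u + rho ^+ 2 * W ^+ 2)).
Proof.
move=> rho0 cs.
set A := _.1; set B := _.2.
rewrite -ler_sqr ?nnegrE ?mulr_ge0 ?expR_ge0 ?(ltW E_gt0)//.
rewrite real_normK ?num_real//.
apply: (@le_trans _ _ (A ^+ 2 + B ^+ 2)).
  rewrite -[leRHS]mulr1 -cs -subr_ge0.
  rewrite (_ : _ - _ = (A * s - B * c) ^+ 2) ?sqr_ge0//; ring.
rewrite /A /B tilt_pow_norm [leRHS]exprMn ler_pM2l ?exprn_gt0//.
rewrite -expRM_natl mulrCA expRM_natl lerXn2r ?nnegrE ?expR_ge0//.
  by rewrite addr_ge0 ?sqr_ge0.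
apply: le_trans (expR_ge1Dx _).
have h1 : (rho * ca u) ^+ 2 <= rho ^+ 2 * W ^+ 2.
  rewrite exprMn ler_wpM2l ?sqr_ge0// -[ca u ^+ 2]real_normK ?num_real//.
  by rewrite ler_sqr ?nnegrE//; exact: bca.
have h2 : (rho * sb u) ^+ 2 <= rho ^+ 2 * W ^+ 2.
  rewrite exprMn ler_wpM2l ?sqr_ge0// -[sb u ^+ 2]real_normK ?num_real//.
  by rewrite ler_sqr ?nnegrE//; exact: bsb.
lra.
Qed.

Let tilt_pow_bounded rho k : 0 <= rho -> exists M,
  bounded_by M (fun u => (tilt_pow rho k u).1) /\
  bounded_by M (fun u => (tilt_pow rho k u).2).
Proof.
move=> rho0; exists (E * expR (k%:R * (rho * W + rho ^+ 2 * W ^+ 2))).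
have h u : E * expR (k%:R * (rho * ca u + rho ^+ 2 * W ^+ 2)) <=
    E * expR (k%:R * (rho * W + rho ^+ 2 * W ^+ 2)).
  rewrite ler_pM2l// ler_expR ler_wpM2l// lerD2r ler_wpM2l//.
  exact: le_trans (ler_norm _) (bca u).
split=> u; apply: le_trans (h u).
  have := @tilt_pow_le rho k u 1 0 rho0; rewrite mulr1 mulr0 addr0; apply; ring.
have := @tilt_pow_le rho k u 0 1 rho0; rewrite mulr1 mulr0 add0r; apply; ring.
Qed.

Let tilt_base x :
  expR (dotv xi x) * gauss_ft a (cst 1) (cst 0) x =
  gauss_ft a (fun u => E * cos (dotv u zeta)) (fun u => E * sin (dotv u zeta)) x.
Proof.
have -> : gauss_ft a (cst 1) (cst 0) x =
    \int[lam]_u (gauss_rV a u * cos (dotv u x)).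
  by apply: eq_Rintegral => u _ /=; rewrite mul1r mul0r addr0.
have -> : gauss_ft a (fun u => E * cos (dotv u zeta)) (fun u => E * sin (dotv u zeta)) x
    = E * \int[lam]_u (gauss_rV a u * cos (dotv u (x - zeta))).
  rewrite -RintegralZl//; last first.
    apply: integrable_gauss_rVM => //; first exact: measurable_cos_dotv.
    by exists 1 => // u; exact: cos_max.
  apply: eq_Rintegral => u _; rewrite dotvBr cosB; ring.
rewrite !Rintegral_gauss_rV_cos// mulrCA [RHS]mulrCA; congr (_ * _).
rewrite /gauss_rV /E -!expRD; congr expR.
rewrite dotvBl !dotvBr /zeta !dotvZl !dotvZr (dotvC xi x).
by field; rewrite gt_eqF.
Qed.

Let gauss_ft_axpy (A B A' B' : 'rV[R]_n -> R) M M' rho x :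
  measurable_fun setT A -> measurable_fun setT B ->
  measurable_fun setT A' -> measurable_fun setT B' ->
  bounded_by M A -> bounded_by M B -> bounded_by M' A' -> bounded_by M' B' ->
  gauss_ft a (fun u => A u + rho * A' u) (fun u => B u + rho * B' u) x =
  gauss_ft a A B x + rho * gauss_ft a A' B' x.
Proof.
move=> mA mB mA' mB' bA bB bA' bB'.
have i1 := integrable_gauss_ft x a0 mA mB bA bB.
have i2 := integrable_gauss_ft x a0 mA' mB' bA' bB'.
rewrite /gauss_ft -RintegralZl// -RintegralD//; last first.
  exact: (integrableZl measurableT rho i2).
by apply: eq_Rintegral => u _; ring.
Qed.

Let m0 : measurable_fun setT (cst 0 : 'rV[R]_n -> R).
Proof. exact: measurable_cst. Qed.

Let b0 : bounded_by 0 (cst 0 : 'rV[R]_n -> R).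
Proof. by move=> u; rewrite normr0. Qed.

Let K := \int[kappa]_y `|cst 1 y : R|.

Let mpow rho k : measurable_fun setT (fun u => (1 + rho * khat u) ^+ k).
Proof.
by apply: measurable_funX; apply: measurable_funD => //; apply: measurable_funM.
Qed.

Let bpow rho k : 0 <= rho ->
  bounded_by ((1 + rho * K) ^+ k) (fun u => (1 + rho * khat u) ^+ k).
Proof.
move=> rho0 u; rewrite normrX lerXn2r ?nnegrE//.
  by rewrite addr_ge0// mulr_ge0//; exact: Rintegral_ge0.
rewrite (le_trans (ler_normD _ _))// normr1 lerD2l normrM ger0_norm//.
by rewrite ler_wpM2l//; exact: khat_bounded.
Qed.

(** Induction on [k] for all [x] at once, since a further factor amounts to a convolution and calls
    the previous case at the points [x - y]. *)
Let tilt_power rho k x : 0 <= rho ->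
  expR (dotv xi x) * gauss_ft a (fun u => (1 + rho * khat u) ^+ k) (cst 0) x =
  gauss_ft a (fun u => (tilt_pow rho k u).1) (fun u => (tilt_pow rho k u).2) x.
Proof.
move=> rho0; elim: k x => [|k IH] x.
  by rewrite -[RHS]tilt_base; congr (_ * _).
have [mA mB] := measurable_tilt_pow rho k.
have [M [bA bB]] := tilt_pow_bounded k rho0.
pose C u := (1 + rho * khat u) ^+ k.
have mC : measurable_fun setT C by exact: mpow.
have bC : bounded_by ((1 + rho * K) ^+ k) C by exact: bpow.
have b0' : bounded_by ((1 + rho * K) ^+ k) (cst 0 : 'rV[R]_n -> R).
  by move=> u; rewrite (le_trans (b0 u))// (le_trans (normr_ge0 _) (bC u)).
pose A' (u : 'rV[R]_n) := C u * khat u - 0 * sin_int kappa (cst 1) u.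
pose B' (u : 'rV[R]_n) := C u * sin_int kappa (cst 1) u + 0 * khat u.
have mA' : measurable_fun setT A'.
  apply: measurable_funB; apply: measurable_funM => //; exact: measurable_sin_int.
have mB' : measurable_fun setT B'.
  apply: measurable_funD; apply: measurable_funM => //; exact: measurable_sin_int.
have bA' : bounded_by ((1 + rho * K) ^+ k * K) A'.
  by move=> u; rewrite /A' mul0r subr0 normrM ler_pM.
have bB' : bounded_by ((1 + rho * K) ^+ k * K) B'.
  move=> u; rewrite /B' sin_int1 mulr0 mul0r addr0 normr0.
  exact: le_trans (normr_ge0 _) (bA' u).
have -> : gauss_ft a (fun u => (1 + rho * khat u) ^+ k.+1) (cst 0) x =
    gauss_ft a C (cst 0) x + rho * \int[kappa]_y (gauss_ft a C (cst 0) (x - y) * cst 1 y).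
  rewrite (gauss_ft_convolution one_int x a0 mC m0 bC b0).
  rewrite -(@gauss_ft_axpy C (cst 0) A' B' _ _ rho x mC m0 mA' mB' bC b0' bA' bB').
  rewrite /gauss_ft; apply: eq_Rintegral => u _; rewrite /A' /B' sin_int1 /C exprS /=; ring.
rewrite mulrDr IH mulrCA.
(* [expR (xi.x)] splits into [expR (xi.(x - y))], used up by the induction hypothesis, and the
   weight [w y]. *)
have -> : expR (dotv xi x) * \int[kappa]_y (gauss_ft a C (cst 0) (x - y) * cst 1 y) =
    \int[kappa]_y (gauss_ft a (fun u => (tilt_pow rho k u).1)
                  (fun u => (tilt_pow rho k u).2) (x - y) * w y).
  rewrite -RintegralZl//; last first.
    apply: (@le_integrable _ _ _ _ _ _ _
      (EFin \o cst (\int[lam]_u (gauss_rV a u * ((1 + rho * K) ^+ k + 0))))) => //.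
    - apply/measurable_EFinP/measurable_funM => //.
      exact: (measurableT_comp (measurable_gauss_ft a mC m0) (measurable_rV_subl x)).
    - move=> y _; rewrite lee_fin mulr1 (le_trans (gauss_ft_bounded a0 mC m0 bC b0 _))//.
      exact: ler_norm.
    - exact: finite_measure_integrable_cst.
  apply: eq_Rintegral => y _; rewrite -IH /w mulr1 mulrAC -expRD.
  by rewrite dotvBr subrK.
rewrite (gauss_ft_convolution iw x a0 mA mB bA bB).
pose p u := tilt_pow rho k u.
have mA2 : measurable_fun setT (fun u => (p u).1 * ca u - (p u).2 * sb u).
  by apply: measurable_funB; apply: measurable_funM.
have mB2 : measurable_fun setT (fun u => (p u).1 * sb u + (p u).2 * ca u).
  by apply: measurable_funD; apply: measurable_funM.
have bA2 : bounded_by ((M + M) * W) (fun u => (p u).1 * ca u - (p u).2 * sb u).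
  by move=> u; rewrite (le_trans (ler_normB _ _))// !normrM mulrDl lerD// ler_pM.
have bB2 : bounded_by ((M + M) * W) (fun u => (p u).1 * sb u + (p u).2 * ca u).
  by move=> u; rewrite (le_trans (ler_normD _ _))// !normrM mulrDl lerD// ler_pM.
by rewrite -(gauss_ft_axpy rho x mA mB mA2 mB2 bA bB bA2 bB2).
Qed.

(** [tilt_power] is used with [rho = t / (k + 1)] and exponent [k + 1], then [k] tends to infinity.
    The integrands are compared at each [u]: up to an error factor that tends to 1, the modulus
    bound and [ca_le] leave [E * expR (t * psi) * expR (t * khat u)], whose Gaussian integral is the
    transform at 0, where the cosine is 1. *)
Let gauss_ft_tilt_le t x : 0 <= t ->
  expR (dotv xi x) * gauss_ft a (fun u => expR (t * khat u)) (cst 0) x <=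
  expR (a * dotv xi xi + t * psi) * gauss_ft a (fun u => expR (t * khat u)) (cst 0) 0.
Proof.
move=> t0.
have mexp : measurable_fun setT (fun u => expR (t * khat u)).
  by apply: measurableT_comp => //; apply: measurable_funM.
have bexp : bounded_by (expR (t * K)) (fun u => expR (t * khat u)).
  move=> u; rewrite ger0_norm ?expR_ge0// ler_expR ler_wpM2l//.
  exact: le_trans (ler_norm _) (khat_bounded u).
have tn k : 0 <= t / k.+1%:R by rewrite divr_ge0.
pose G0 := gauss_ft a (fun u => expR (t * khat u)) (cst 0) 0.
pose lhs k := expR (dotv xi x) *
  gauss_ft a (fun u => (1 + t / k.+1%:R * khat u) ^+ k.+1) (cst 0) x.
pose rhs k := expR (a * dotv xi xi + t * psi) * G0 * expR (t ^+ 2 * W ^+ 2 / k.+1%:R).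
have clhs : lhs k @[k --> \oo] -->
    expR (dotv xi x) * gauss_ft a (fun u => expR (t * khat u)) (cst 0) x.
  apply: cvgM; first exact: cvg_cst.
  apply: (@gauss_ft_cvg _ _ _ a0 _ _ (expR (t * K))) => // [k u|u].
    apply: (le_trans (bpow _ (tn k) u)).
    (* Here [1 + v <= expR v] makes the majorant independent of [k], as dominated convergence
       requires. *)
    rewrite (_ : t * K = k.+1%:R * (t / k.+1%:R * K)); last by field; rewrite gt_eqF.
    rewrite expRM_natl lerXn2r ?nnegrE ?expR_ge0 ?expR_ge1Dx//.
    by rewrite addr_ge0// mulr_ge0//; exact: Rintegral_ge0.
  have := @cvg_expR_pow R (t * khat u).
  by under eq_fun do rewrite mulrAC.
have crhs : rhs k @[k --> \oo] --> expR (a * dotv xi xi + t * psi) * G0.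
  have c0 : t ^+ 2 * W ^+ 2 / k.+1%:R @[k --> \oo] --> 0.
    rewrite -(mulr0 (t ^+ 2 * W ^+ 2)); apply: cvgM; first exact: cvg_cst.
    exact: cvg_harmonic.
  rewrite -[X in _ --> X]mulr1; apply: cvgM; first exact: cvg_cst.
  have := continuous_cvg _ (@continuous_expR R 0) c0.
  by rewrite expR0; apply.
apply: (ler_cvg_to clhs crhs); apply: nearW => k.
rewrite /lhs tilt_power// /rhs /G0 /gauss_ft.
have [mA mB] := measurable_tilt_pow (t / k.+1%:R) k.+1.
have [M [bA bB]] := tilt_pow_bounded k.+1 (tn k).
have i0 := integrable_gauss_ft 0 a0 mexp m0 bexp b0.
rewrite mulrAC -RintegralZl//.
apply: le_Rintegral => //.
- exact: integrable_gauss_ft bA bB.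
- exact: (integrableZl measurableT _ i0).
move=> u _; rewrite /cst mul0r addr0 dotv0r cos0 mulr1 mulrCA.
rewrite ler_wpM2l ?(ltW (gauss_rV_gt0 _ _))//.
apply: (le_trans (ler_norm _)).
apply: (le_trans (tilt_pow_le _ _ (tn k) (cos2Dsin2 _))).
rewrite /E -!expRD ler_expR -!addrA lerD2l.
have k0 : 0 < k.+1%:R :> R by rewrite ltr0n.
rewrite (_ : _ * (_ + _) = t * ca u + t ^+ 2 * W ^+ 2 / k.+1%:R); last first.
  by field; rewrite gt_eqF.
have := ler_wpM2l t0 (ca_le u); rewrite mulrDr.
by rewrite (addrC (t ^+ 2 * _ / _) (t * khat u)) addrA lerD2r (addrC (t * psi)).
Qed.

Lemma gauss_ft_exponential_tilt t x : 0 <= t ->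
  expR (dotv xi x) *
  gauss_ft a (fun u => expR (t * cos_int kappa (cst 1) u)) (cst 0) x <=
  expR (a * dotv xi xi +
        t * \int[kappa]_y ((expR (dotv xi y) + expR (- dotv xi y)) / 2 - 1)) *
  gauss_ft a (fun u => expR (t * cos_int kappa (cst 1) u)) (cst 0) 0.
Proof. exact: gauss_ft_tilt_le. Qed.

End exponential_tilt.

(** * Tilting a truncated Levy measure *)

Lemma ge0_integral_mrestr d (T : measurableType d) (R : realType)
    (mu : {measure set T -> \bar R}) (D : set T) (mD : measurable D)
    (f : T -> \bar R) : measurable_fun setT f -> (forall x, 0 <= f x)%E ->
  (\int[mrestr mu mD]_x f x = \int[mu]_(x in D) f x)%E.
Proof.
move=> mf f0; have mCD : measurable (~` D) by exact: measurableC.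
rewrite -(setUv D) ge0_integral_setU//; last 2 first.
- by rewrite setUv.
- by rewrite disj_set2E setICr.
rewrite [X in (_ + X)%E]null_set_integral//; last 2 first.
- exact: measurable_funTS.
- by transitivity (mu (~` D `&` D)); [by []|rewrite setICl measure0].
rewrite adde0; apply: eq_measure_integral => A mA AD.
by transitivity (mu (A `&` D)); [by []|congr (mu _); apply/setIidPl].
Qed.

Lemma sin_norm_le (R : realType) (s : R) : `|sin s| <= `|s|.
Proof.
have pos (r : R) : 0 < r -> `|sin r| <= r.
  move=> r0; have [|c _] := @MVT R sin cos 0 r r0.
    exact/continuous_subspaceT/continuous_sin.
  rewrite sin0 !subr0 => ->; rewrite normrM (gtr0_norm r0) ler_piMl ?(ltW r0)//.
  exact: cos_max.
have [s0|s0|->] := ltgtP s 0; last by rewrite sin0.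
  rewrite -normrN -sinN (ltr0_norm s0); apply: pos; lra.
by rewrite (gtr0_norm s0); exact: pos.
Qed.

Lemma onem_cos_le (R : realType) (s : R) : 1 - cos s <= s ^+ 2 / 2.
Proof.
(* Half angle: [1 - cos s = 2 sin^2 (s / 2)]. *)
have -> : cos s = cos (s / 2 + s / 2) by congr cos; lra.
rewrite cosD.
have h := cos2Dsin2 (s / 2); have := sin_norm_le (s / 2).
rewrite -ler_sqr ?nnegrE// !real_normK ?num_real// => h2.
by nra.
Qed.

(** Every point off the support has a null neighbourhood, hence lies in a null cube with rational
    centre and radius [1 / (k + 1)]; there are countably many such cubes. *)
Lemma measure_support_null (R : realType) n (nu : {measure set 'rV[R]_n -> \bar R})
    (A : set 'rV[R]_n) : measurable A -> measure_support nu `<=` A -> nu (~` A) = 0%E.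
Proof.
move=> mA sA.
pose box (c : 'rV[rat]_n * nat) : set 'rV[R]_n :=
  [set y | rV_box c.2.+1%:R^-1 (map_mx ratr c.1 - y)].
have mbox c : measurable (box c).
  by apply: measurable_reflect; exact: measurable_rV_box.
(* Cubes of positive measure are replaced by the empty set, so that every [F k] is null. *)
pose F k := if @unpickle ('rV[rat]_n * nat)%type k is Some c then
  if nu (box c) == 0%E then box c else set0 else set0.
have mF k : measurable (F k).
  by rewrite /F; case: unpickle => // c; case: ifP.
have F0 k : nu (F k) = 0%E.
  by rewrite /F; case: unpickle => // c; case: ifPn => // /eqP.
have sub : ~` A `<=` \bigcup_k F k.
  move=> x nAx; have : ~ measure_support nu x by move=> /sA.
  move=> /existsNP[U] /not_implyP[oU] /not_implyP[Ux] /negP.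
  rewrite -leNgt measure_le0 => /eqP U0.
  have [e e0 eU] := nbhs_rV_box (open_nbhs_nbhs (conj oU Ux)).
  (* With a radius below [e / 2], any two points of the cube are within [e] of each other in every
     coordinate. *)
  have e20 : 0 < e / 2 by rewrite divr_gt0.
  have [k _ /(_ k (leqnn _)) /= ke] := near_infty_natSinv_lt (PosNum e20).
  have k0 : 0 < k.+1%:R^-1 :> R by rewrite invr_gt0.
  have rx i : exists q : rat, `|ratr q - x ord0 i| < k.+1%:R^-1.
    have [|q] := @rat_in_itvoo R (x ord0 i - k.+1%:R^-1) (x ord0 i + k.+1%:R^-1).
      by rewrite ltrD2l gtrN.
    by rewrite in_itv /= => qx; exists q; rewrite distrC ltr_distlC.
  have [q qx] := choice rx.
  pose c : 'rV[rat]_n * nat := (\row_i q i, k).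
  have bx : box c x by move=> i; rewrite /= !mxE; exact: qx.
  have bU : box c `<=` U.
    move=> y yc; rewrite -(subrKC x y); apply: eU => i.
    have := yc i; have := bx i; rewrite /= !mxE => h1 h2.
    rewrite (_ : _ - _ = (ratr (q i) - x ord0 i) - (ratr (q i) - y ord0 i)); last by ring.
    rewrite (le_lt_trans (ler_normB _ _))// (splitr e) ltrD//.
      exact: lt_trans h1 ke.
    exact: lt_trans h2 ke.
  exists (pickle c) => //; rewrite /F pickleK ifT//.
  rewrite -measure_le0 -U0; apply: le_measure => //; rewrite inE//.
  exact: open_measurable_rV.
apply/eqP; rewrite -measure_le0.
have mCA : measurable (~` A) by exact: measurableC.
have := measure_sigma_subadditive nu mF mCA sub.
by rewrite eseries0.
Qed.

Definition levy_symbol (R : realType) n (nu : {measure set 'rV[R]_n -> \bar R})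
  (t : R) (u : 'rV[R]_n) : R := expR (- (t * levy_exponent nu u)).

Section truncated_levy.
Context {R : realType} {n : nat}.
Variables (nu : {measure set 'rV[R]_n -> \bar R}) (r0 : R).
Hypothesis levy : symmetric_levy_measure nu.
Hypothesis supp : measure_support nu `<=` eball 0 r0.

(** Away from 0 the measure [nu] is finite, and inside the ball of radius [r0] exponential weights
    are bounded; being symmetric as well, the restriction of [nu] to a shell falls under the finite
    case. *)
Definition levy_shell j : set 'rV[R]_n := [set y | j.+1%:R^-1 < enorm y < r0].

Lemma measurable_levy_shell j : measurable (levy_shell j).
Proof.
rewrite (_ : levy_shell j = @enorm R n @^-1` `]j.+1%:R^-1, r0[).
  rewrite -[X in measurable X]setTI; apply: measurable_enorm => //.
by apply/seteqP; split=> y /=; rewrite in_itv.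
Qed.

Let minfun (y : 'rV[R]_n) : R := Num.min 1 (enorm y ^+ 2).

Let mminfun : measurable_fun setT minfun.
Proof.
apply: measurable_minr => //; apply: measurable_funX; exact: measurable_enorm.
Qed.

Lemma levy_shell_lty j : (nu (levy_shell j) < +oo)%E.
Proof.
have [_ moo _] := levy.
pose c : R := Num.min 1 (j.+1%:R^-1 ^+ 2).
have c0 : 0 < c by rewrite lt_min ltr01 exprn_gt0// invr_gt0.
have mD := measurable_levy_shell j.
have : (c%:E * nu (levy_shell j) < +oo)%E.
  apply: le_lt_trans moo; rewrite -integral_cst//.
  apply: (@le_trans _ _ (\int[nu]_(y in levy_shell j) (minfun y)%:E)%E).
    apply: ge0_le_integral => //.
    - by move=> y _; rewrite lee_fin ltW.
    - by apply: measurable_funTS; exact/measurable_EFinP.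
    - move=> y /andP[y1 _]; rewrite lee_fin le_min2// ler_sqr ?nnegrE ?enorm_ge0//.
      exact: ltW.
  apply: ge0_subset_integral => //; first exact/measurable_EFinP.
  by move=> y _; rewrite lee_fin le_min ler01 sqr_ge0.
by rewrite !ltey; apply: contra_neq => ->; rewrite mulry gtr0_sg// mul1e.
Qed.

Let kap j : {finite_measure set 'rV[R]_n -> \bar R} :=
  mfrestr (measurable_levy_shell j) (levy_shell_lty j).

Let integral_kap j (f : 'rV[R]_n -> \bar R) :
  measurable_fun setT f -> (forall x, 0 <= f x)%E ->
  (\int[kap j]_x f x = \int[nu]_(x in levy_shell j) f x)%E.
Proof. exact: ge0_integral_mrestr. Qed.

Let kapN j (D : set 'rV[R]_n) : measurable D -> kap j (-%R @` D) = kap j D.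
Proof.
move=> mD; have [_ _ nuN] := levy.
transitivity (nu (-%R @` D `&` levy_shell j)); first by [].
transitivity (nu (D `&` levy_shell j)); last by [].
rewrite -(nuN (D `&` levy_shell j)); last first.
  by apply: measurableI => //; exact: measurable_levy_shell.
congr (nu _); apply/seteqP; split=> y /=.
  by move=> [[z Dz <-]]; rewrite /levy_shell /= enormN => h; exists z.
by move=> [z [Dz h] <-]; split; [exists z|rewrite /levy_shell /= enormN].
Qed.

Lemma measurable_exp_dotv (xi : 'rV[R]_n) :
  measurable_fun setT (fun y => expR (dotv xi y)).
Proof. by apply: measurableT_comp => //; exact: measurable_dotvl. Qed.

Let integrable_exp_kap j (xi : 'rV[R]_n) :
  (kap j).-integrable setT (fun y => (expR (dotv xi y))%:E).
Proof.
have mw := measurable_exp_dotv xi; have mS := measurable_levy_shell j.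
apply/integrableP; split; first exact/measurable_EFinP.
rewrite integral_kap//; last by apply: measurableT_comp => //; exact/measurable_EFinP.
apply: (@le_lt_trans _ _ (\int[nu]_(y in levy_shell j) (expR (enorm xi * r0))%:E)%E).
  apply: ge0_le_integral => //.
  - by apply: measurable_funTS; apply: measurableT_comp => //; exact/measurable_EFinP.
  - move=> y /andP[_ yr]; rewrite lee_fin /= ger0_norm ?expR_ge0// ler_expR.
    rewrite (le_trans (ler_norm _))// (le_trans (dotv_le _ _))//.
    by rewrite ler_wpM2l ?enorm_ge0// ltW.
by rewrite integral_cst// lte_mul_pinfty ?levy_shell_lty// lee_fin expR_ge0.
Qed.

Let monem_cos (u : 'rV[R]_n) : measurable_fun setT (fun y => (1 - cos (dotv u y))%:E).
Proof.
apply/measurable_EFinP; apply: measurable_funB => //.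
have mcos : measurable_fun setT (@cos R).
  by apply: continuous_measurable_fun; exact: continuous_cos.
exact: (measurableT_comp mcos (measurable_dotvl u)).
Qed.

Let onem_cos_ge0 (u y : 'rV[R]_n) : (0 <= (1 - cos (dotv u y))%:E)%E.
Proof. by rewrite lee_fin subr_ge0 cos_le1. Qed.

Let levy_shells : \bigcup_j levy_shell j = [set y | 0 < enorm y < r0].
Proof.
apply/seteqP; split=> y /=.
  move=> [j _ /andP[h1 h2]]; apply/andP; split => //.
  by apply: lt_trans h1; rewrite invr_gt0.
move=> /andP[y0 yr].
have [k _ /(_ k (leqnn _)) /= ky] := near_infty_natSinv_lt (PosNum y0).
by exists k => //; apply/andP.
Qed.

(** The shells miss the origin, null by definition of a Levy measure, and the outside of a ball that
    contains the support. *)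
Let nu_shells : nu (~` (\bigcup_j levy_shell j)) = 0%E.
Proof.
have [nu0 _ _] := levy.
have mE : measurable (eball 0 r0 : set 'rV[R]_n).
  rewrite (_ : eball 0 r0 = @enorm R n @^-1` `]-oo, r0[).
    rewrite -[X in measurable X]setTI; apply: measurable_enorm => //.
  by apply/seteqP; split=> y; rewrite /eball /= in_itv/= subr0.
have nuE := measure_support_null mE supp.
have m0 : measurable ([set 0] : set 'rV[R]_n).
  rewrite (_ : [set 0] = @enorm R n @^-1` [set 0]).
    by rewrite -[X in measurable X]setTI; apply: measurable_enorm.
  apply/seteqP; split=> y /=; last exact: enorm_eq0.
  by move=> ->; rewrite /enorm dotv0r sqrtr0.
apply/eqP; rewrite -measure_le0.
have mCE : measurable (~` eball 0 r0 : set 'rV[R]_n) by exact: measurableC.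
rewrite (@le_trans _ _ (nu ([set 0] `|` ~` eball 0 r0)))//.
  apply: le_measure; rewrite ?inE//.
  - by apply: measurableC; apply: bigcup_measurable => j _; exact: measurable_levy_shell.
  - exact: measurableU.
  rewrite levy_shells => y /= /negP; rewrite negb_and -!leNgt => /orP[h|h].
    by left; apply: enorm_eq0; apply/eqP; rewrite eq_le h enorm_ge0.
  by right; rewrite /eball /= subr0; apply/negP; rewrite -leNgt.
apply: (le_trans (measureU2 nu m0 mCE)).
by rewrite [X in (X + _)%E]nu0 [X in (_ + X)%E]nuE adde0.
Qed.

Let levy_shell_nd : nondecreasing_seq levy_shell.
Proof.
move=> i j ij; apply/subsetPset => y /andP[h1 h2]; apply/andP; split=> //.
by apply: le_lt_trans h1; rewrite lef_pV2 ?posrE// ler_nat.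
Qed.

Lemma ge0_integral_levy_shells (f : 'rV[R]_n -> \bar R) :
  measurable_fun setT f -> (forall x, 0 <= f x)%E ->
  (\int[nu]_x f x = \int[nu]_(x in \bigcup_j levy_shell j) f x)%E.
Proof.
move=> mf f0; set S := \bigcup_j _.
have mS : measurable S.
  by apply: bigcup_measurable => j _; exact: measurable_levy_shell.
have mCS : measurable (~` S) by exact: measurableC.
rewrite -(setUv S) ge0_integral_setU//; last 2 first.
- by rewrite setUv.
- by rewrite disj_set2E setICr.
rewrite [X in (_ + X)%E]null_set_integral ?adde0//.
exact: measurable_funTS.
Qed.

Let levy_exponent_lty (u : 'rV[R]_n) :
  (\int[nu]_y (1 - cos (dotv u y))%:E < +oo)%E.
Proof.
have [_ moo _] := levy.
(* [1 - cos s <= 2] serves for large [y], and [1 - cos s <= s^2 / 2] with Cauchy-Schwarz for small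
   [y]. *)
pose C : R := 2 + dotv u u.
have C0 : 0 <= C by rewrite addr_ge0 ?dotvv_ge0.
apply: (@le_lt_trans _ _ (\int[nu]_y (C%:E * (minfun y)%:E))%E).
  apply: ge0_le_integral => //.
  - by apply: measurable_funeM; exact/measurable_EFinP.
  - move=> y _; rewrite -EFinM lee_fin /minfun.
    have h1 : 1 - cos (dotv u y) <= 2 by have := cos_geN1 (dotv u y); lra.
    have h2 : dotv u y ^+ 2 <= dotv u u * enorm y ^+ 2.
      rewrite -[dotv u u]sqr_enorm -exprMn -[leLHS]real_normK ?num_real//.
      by rewrite ler_sqr ?nnegrE ?mulr_ge0 ?enorm_ge0//; exact: dotv_le.
    have h3 := onem_cos_le (dotv u y).
    have := dotvv_ge0 u; have := sqr_ge0 (enorm y).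
    by rewrite /C; case: (lerP 1 (enorm y ^+ 2)) => ? ? ?; nra.
rewrite ge0_integralZl//.
- by rewrite lte_mul_pinfty.
- exact/measurable_EFinP.
- by move=> y _; rewrite lee_fin le_min ler01 sqr_ge0.
Qed.

Let Phi j (u : 'rV[R]_n) := \int[kap j]_y (1 - cos (dotv u y)).

(** Monotone convergence along the increasing shells; finiteness of the full integral lets [fine]
    pass to the limit. *)
Let Phi_cvg u : Phi j u @[j --> \oo] --> levy_exponent nu u.
Proof.
apply: fine_cvg; rewrite fineK; last first.
  rewrite ge0_fin_numE; first exact: levy_exponent_lty.
  by apply: integral_ge0 => y _; exact: onem_cos_ge0.
rewrite ge0_integral_levy_shells//.
under eq_fun do rewrite integral_kap//.
apply: ge0_nondecreasing_set_cvg_integral => //.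
- exact: measurable_levy_shell.
- by move=> i; exact: measurable_funTS.
Qed.

(** On a shell, [Phi j] is the constant [K j] minus the cosine transform, so the symbol is the
    exponential of the finite case times [expR (- (t * K j))], a positive factor common to both
    sides. As [L] bounds all shells, the inequality survives [j -> oo] by dominated convergence, the
    symbols being at most 1. *)
Lemma gauss_ft_levy_tilt a (xi : 'rV[R]_n) L t x : 0 < a -> 0 <= t ->
  (forall j, (\int[nu]_(y in levy_shell j)
     ((expR (dotv xi y) + expR (- dotv xi y)) / 2 - 1)%:E <= L%:E)%E) ->
  expR (dotv xi x) * gauss_ft a (levy_symbol nu t) (cst 0) x <=
  expR (a * dotv xi xi + t * L) * gauss_ft a (levy_symbol nu t) (cst 0) 0.
Proof.
move=> a0 t0 hL; pose f := levy_symbol nu t; rewrite -/f.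
pose f_ j u := expR (- (t * Phi j u)).
have one_int j : (kap j).-integrable setT (EFin \o cst 1).
  exact: finite_measure_integrable_cst.
pose K j := \int[kap j]_y (cst 1 y : R).
have PhiE j u : Phi j u = K j - cos_int (kap j) (cst 1) u.
  rewrite /K /cos_int.
  rewrite -(RintegralB measurableT (one_int j) (integrable_cosw (one_int j) u)).
  by apply: eq_Rintegral => y _; rewrite /cst mulr1.
have f_E j u : f_ j u = expR (- (t * K j)) * expR (t * cos_int (kap j) (cst 1) u).
  by rewrite /f_ -expRD PhiE; congr expR; ring.
have mcos j : measurable_fun setT (cos_int (kap j) (cst 1)).
  exact: (measurable_cos_int (one_int j)).
have mexp j : measurable_fun setT (fun u => expR (t * cos_int (kap j) (cst 1) u)).
  by apply: measurableT_comp => //; apply: measurable_funM.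
have mf_ j : measurable_fun setT (f_ j).
  rewrite (_ : f_ j = fun u => expR (- (t * K j)) * expR (t * cos_int (kap j) (cst 1) u)).
    exact: measurable_funM.
  by apply/funext => u; exact: f_E.
have bf_ j : bounded_by 1 (f_ j).
  move=> u; rewrite ger0_norm ?expR_ge0// -[leRHS]expR0 ler_expR oppr_le0.
  by rewrite mulr_ge0//; apply: Rintegral_ge0 => y _; rewrite subr_ge0 cos_le1.
have cf u : f_ j u @[j --> \oo] --> f u.
  have c : - (t * Phi j u) @[j --> \oo] --> - (t * levy_exponent nu u).
    by apply: cvgN; apply: cvgM; [exact: cvg_cst|exact: Phi_cvg].
  exact: (continuous_cvg _ (@continuous_expR R _) c).
have mf : measurable_fun setT f.
  apply: (measurable_fun_cvg mf_) => u _; exact: cf.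
have cl c z : c * gauss_ft a (f_ j) (cst 0) z @[j --> \oo] -->
    c * gauss_ft a f (cst 0) z.
  apply: cvgM; first exact: cvg_cst.
  exact: (@gauss_ft_cvg _ _ _ a0 f_ f 1 z mf_ mf bf_ cf).
apply: (ler_cvg_to (cl _ x) (cl _ 0)); apply: nearW => j.
have bexp : bounded_by (expR (t * \int[kap j]_y `|cst 1 y : R|))
    (fun u => expR (t * cos_int (kap j) (cst 1) u)).
  move=> u; rewrite ger0_norm ?expR_ge0// ler_expR ler_wpM2l//.
  exact: le_trans (ler_norm _) (cos_int_bounded (one_int j) u).
have fE z : gauss_ft a (f_ j) (cst 0) z = expR (- (t * K j)) *
    gauss_ft a (fun u => expR (t * cos_int (kap j) (cst 1) u)) (cst 0) z.
  rewrite -(@gauss_ftZ _ _ _ a0 _ _ (expR (- (t * K j))) z (mexp j) bexp).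
  congr gauss_ft.
  by apply/funext => u; exact: f_E.
rewrite !fE mulrCA [leRHS]mulrCA ler_wpM2l ?expR_ge0//.
apply: (le_trans (gauss_ft_exponential_tilt a0 (@kapN j) (integrable_exp_kap j xi) x t0)).
rewrite ler_wpM2r//.
  apply: Rintegral_ge0 => u _.
  by rewrite /cst dotv0r cos0 mulr1 mul0r addr0 mulr_ge0 ?expR_ge0 ?(ltW (gauss_rV_gt0 _ _)).
rewrite ler_expR lerD2l ler_wpM2l//.
have g0 y : 0 <= (expR (dotv xi y) + expR (- dotv xi y)) / 2 - 1.
  have e0 := expR_gt0 (dotv xi y); rewrite expRN.
  rewrite -(@pmulr_lge0 _ (2 * expR (dotv xi y))) ?mulr_gt0//.
  rewrite (_ : (_ - 1) * _ = (expR (dotv xi y) - 1) ^+ 2) ?sqr_ge0//.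
  by field; rewrite gt_eqF.
have mch : measurable_fun setT (fun y : 'rV[R]_n =>
    ((expR (dotv xi y) + expR (- dotv xi y)) / 2 - 1)%:E).
  apply/measurable_EFinP; apply: measurable_funB => //; apply: measurable_funM => //.
  apply: measurable_funD; first exact: measurable_exp_dotv.
  by apply: measurableT_comp => //; apply: measurableT_comp => //; exact: measurable_dotvl.
have hLj := hL j; rewrite -integral_kap// in hLj.
rewrite -lee_fin /Rintegral fineK// ge0_fin_numE.
  exact: le_lt_trans hLj (ltry _).
by apply: integral_ge0 => y _; rewrite lee_fin.
Qed.

End truncated_levy.

(** * Gaussian averages of the semigroup *)

(** [q] agrees almost everywhere with the Radon-Nikodym derivative of [Q], for which the change of
    variables is known. *)
Lemma ge0_integral_density (R : realType) n (Q : probability 'rV[R]_n R)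
    (q f : 'rV[R]_n -> \bar R) :
  is_density Q q -> measurable_fun setT f -> (forall x, 0 <= f x)%E ->
  (\int[Q]_x f x = \int[lebesgue_rV n]_x (f x * q x))%E.
Proof.
move=> [mq q0 QE] mf f0.
have dom : Q `<< lebesgue_rV n.
  apply/null_content_dominatesP => A mA A0; rewrite QE//.
  by apply: null_set_integral => //; exact: measurable_funTS.
rewrite -(Radon_Nikodym_SigmaFinite.change_of_variables dom f0 measurableT mf).
have iRN := Radon_Nikodym_SigmaFinite.f_integrable dom.
have mRN := measurable_int (lebesgue_rV n) iRN.
have RN0 := Radon_Nikodym_SigmaFinite.f_ge0 dom.
apply: ge0_ae_eq_integral => //.
- exact: emeasurable_funM.
- exact: emeasurable_funM.
- by move=> x _; exact: mule_ge0.
- by move=> x _; exact: mule_ge0.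
apply: ae_eqe_mul2l.
apply: integral_ae_eq => // E _ mE.
by rewrite -(QE E mE); apply: esym; exact: Radon_Nikodym_SigmaFinite.f_integral.
Qed.

Section semigroup.
Context {R : realType} {n : nat}.
Local Notation lam := (@lebesgue_rV R n).
Variables (nu : {measure set 'rV[R]_n -> \bar R}) (P : R -> probability 'rV[R]_n R).
Hypothesis sg : levy_semigroup nu P.
Implicit Types (m t a : R) (x : 'rV[R]_n).

Definition gauss_smooth m t x := \int[P t]_y gauss_rV m (x - y).

(** This is [gauss_ft_convolution] for [kappa = P t] and weight 1, started from the transform of the
    bare Gaussian, which is [gauss_mass] times [gauss_rV m] because [(4 a)^-1 = m]. The semigroup
    hypothesis identifies the multiplier as [levy_symbol]. *)
Lemma gauss_ft_semigroup m t x : 0 < m -> 0 <= t ->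
  gauss_ft (4 * m)^-1 (levy_symbol nu t) (cst 0) x =
  @gauss_mass R n (4 * m)^-1 * gauss_smooth m t x.
Proof.
move=> m0 t0; set a := (4 * m)^-1.
have a0 : 0 < a by rewrite invr_gt0 mulr_gt0.
have [_ _ /(_ t _ t0) ft] := sg.
have one_int : (P t).-integrable setT (EFin \o cst 1).
  exact: finite_measure_integrable_cst.
have b1 : bounded_by 1 (cst 1 : 'rV[R]_n -> R) by move=> u; rewrite normr1.
have b0 : bounded_by 0 (cst 0 : 'rV[R]_n -> R) by move=> u; rewrite normr0.
have m1 : measurable_fun setT (cst 1 : 'rV[R]_n -> R) by exact: measurable_cst.
have m0' : measurable_fun setT (cst 0 : 'rV[R]_n -> R) by exact: measurable_cst.
have := gauss_ft_convolution one_int x a0 m1 m0' b1 b0.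
rewrite (_ : gauss_ft a _ _ x = gauss_ft a (levy_symbol nu t) (cst 0) x); last first.
  rewrite /gauss_ft; apply: eq_Rintegral => u _.
  have [c s] := ft u.
  have -> : cos_int (P t) (cst 1) u = levy_symbol nu t u.
    by rewrite -[RHS]c; apply: eq_Rintegral => y _; rewrite /cst mulr1.
  have -> : sin_int (P t) (cst 1) u = 0.
    by rewrite -[RHS]s; apply: eq_Rintegral => y _; rewrite /cst mulr1.
  by rewrite /cst; ring.
move=> <-; rewrite /gauss_smooth -RintegralZl//.
  apply: eq_Rintegral => y _; rewrite /cst mulr1.
  rewrite (_ : m = (4 * a)^-1); last by rewrite /a; field; rewrite gt_eqF.
  rewrite -Rintegral_gauss_rV_cos// /gauss_ft.
  by apply: eq_Rintegral => u _; rewrite mul1r mul0r addr0.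
apply: (le_integrable measurableT _ _ one_int).
  apply/measurable_EFinP.
  exact: (measurableT_comp (measurable_gauss_rV m) (measurable_rV_subl x)).
move=> y _; rewrite /= ger0_norm ?expR_ge0// normr1 lee_fin -[leRHS]expR0 ler_expR.
by rewrite oppr_le0 mulr_ge0 ?dotvv_ge0 ?(ltW m0).
Qed.

Lemma gauss_ft_even a (A : 'rV[R]_n -> R) x :
  gauss_ft a A (cst 0) (- x) = gauss_ft a A (cst 0) x.
Proof.
rewrite /gauss_ft; apply: eq_Rintegral => u _.
by rewrite /cst !mul0r dotvNr cosN.
Qed.

Lemma gauss_smoothN m t x : 0 < m -> 0 <= t ->
  gauss_smooth m t (- x) = gauss_smooth m t x.
Proof.
move=> m0 t0.
have a0 : 0 < (4 * m)^-1 by rewrite invr_gt0 mulr_gt0.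
apply: (mulfI (lt0r_neq0 (@gauss_mass_gt0 R n _ a0))).
by rewrite -!gauss_ft_semigroup// gauss_ft_even.
Qed.

Lemma gauss_smoothE m t x : 0 < m ->
  ((gauss_smooth m t x)%:E = \int[P t]_y (gauss_rV m (x - y))%:E)%E.
Proof.
move=> m0; rewrite /gauss_smooth /Rintegral fineK//.
apply: integrable_fin_num => //.
have one_int : (P t).-integrable setT (EFin \o cst 1).
  exact: finite_measure_integrable_cst.
apply: (le_integrable measurableT _ _ one_int).
  apply/measurable_EFinP.
  exact: (measurableT_comp (measurable_gauss_rV m) (measurable_rV_subl x)).
move=> y _; rewrite /= ger0_norm ?expR_ge0// normr1 lee_fin -[leRHS]expR0 ler_expR.
by rewrite oppr_le0 mulr_ge0 ?dotvv_ge0 ?(ltW m0).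
Qed.

Lemma gauss_rVN m (x : 'rV[R]_n) : gauss_rV m (- x) = gauss_rV m x.
Proof. by rewrite /gauss_rV dotvNr dotvC dotvNr opprK. Qed.

(* Both sides average P t A over Gaussian translates. *)
Lemma gauss_average_measure m t (A : set 'rV[R]_n) : 0 < m -> measurable A ->
  (\int[lam]_z ((gauss_rV m z)%:E * P t [set y | A (y - z)%R]) =
   \int[lam]_z ((\1_A z : R)%:E * (gauss_smooth m t z)%:E))%E.
Proof.
move=> m0 mA.
have mI : measurable_fun setT (\1_A : 'rV[R]_n -> R) by exact: measurable_indic.
have mG := @measurable_gauss_rV R n m.
have msub : measurable_fun setT (fun z : 'rV[R]_n * 'rV[R]_n => z.2 - z.1).
  by apply: measurable_fun_rVB.
have mAz z : measurable [set y | A (y - z)%R].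
  have h : measurable_fun setT (fun y : 'rV[R]_n => y - z).
    by apply: measurable_fun_rVB.
  by have := h measurableT _ mA; rewrite setTI.
pose f (z : 'rV[R]_n * 'rV[R]_n) := (gauss_rV m z.1 * \1_A (z.2 - z.1))%:E.
have mf : measurable_fun setT f.
  apply/measurable_EFinP/measurable_funM.
    exact: (measurableT_comp mG measurable_fst).
  exact: (measurableT_comp mI msub).
have f0 z : (0 <= f z)%E by rewrite lee_fin mulr_ge0 ?expR_ge0.
transitivity (\int[lam]_z \int[P t]_y f (z, y))%E.
  apply: eq_integral => z _.
  rewrite -[X in P t X]setIT -integral_indic// -ge0_integralZl//.
  - exact/measurable_EFinP/measurable_indic.
  - by rewrite lee_fin expR_ge0.
rewrite (fubini_tonelli f)//.
pose g (z : 'rV[R]_n * 'rV[R]_n) := (gauss_rV m (z.1 - z.2) * \1_A z.2)%:E.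
have msub' : measurable_fun setT (fun z : 'rV[R]_n * 'rV[R]_n => z.1 - z.2).
  by apply: measurable_fun_rVB.
have mg : measurable_fun setT g.
  apply/measurable_EFinP/measurable_funM.
    exact: (measurableT_comp mG msub').
  exact: (measurableT_comp mI measurable_snd).
have g0 z : (0 <= g z)%E by rewrite lee_fin mulr_ge0 ?expR_ge0.
transitivity (\int[P t]_y \int[lam]_z g (y, z))%E.
  apply: eq_integral => y _.
  rewrite -(@ge0_integral_rV_sub _ _ y (fun z => g (y, z)))//; last first.
    exact: (measurableT_comp mg (measurable_pair1 y)).
  by apply: eq_integral => z _; rewrite /f /g /= subKr.
rewrite (fubini_tonelli g)//.
apply: eq_integral => z _; rewrite gauss_smoothE// -ge0_integralZl//.
- by apply: eq_integral => y _; rewrite /g /= EFinM muleC -opprB gauss_rVN.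
- apply/measurable_EFinP.
  exact: (measurableT_comp mG (measurable_rV_subl z)).
- by move=> y _; rewrite lee_fin expR_ge0.
Qed.

(** The averages for [A] and for its reflection integrate the same even function [gauss_smooth]. *)
Lemma gauss_average_measureN m t (A : set 'rV[R]_n) : 0 < m -> 0 <= t -> measurable A ->
  (\int[lam]_z ((gauss_rV m z)%:E * P t [set y | A (- (y - z))%R]) =
   \int[lam]_z ((gauss_rV m z)%:E * P t [set y | A (y - z)%R]))%E.
Proof.
move=> m0 t0 mA.
have mN : measurable [set y | A (- y)%R].
  have := measurable_rV_subl 0 measurableT mA; rewrite setTI.
  by congr measurable; apply/seteqP; split=> y /=; rewrite sub0r.
rewrite (gauss_average_measure t m0 mN) (gauss_average_measure t m0 mA).
have msm : measurable_fun setT (gauss_smooth m t).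
  apply: measurable_Rintegral_param.
  have msub' : measurable_fun setT (fun z : 'rV[R]_n * 'rV[R]_n => z.1 - z.2).
    by apply: measurable_fun_rVB.
  exact: (measurableT_comp (@measurable_gauss_rV R n m) msub').
rewrite -[RHS](@ge0_integral_rV_sub _ _ 0).
- by apply: eq_integral => z _; rewrite sub0r gauss_smoothN.
- apply: emeasurable_funM; apply/measurable_EFinP; last exact: msm.
  exact: measurable_indic.
- move=> z; rewrite mule_ge0// lee_fin//.
  by apply: Rintegral_ge0 => y _; exact: expR_ge0.
Qed.

End semigroup.

Lemma continuous_measurable_rV (R : realType) n (f : 'rV[R]_n -> R) :
  continuous f -> measurable_fun setT f.
Proof.
move=> cf; apply: (measurability _ (RGenOpens.measurableE R)).
move=> _ [_ [a [b ->]] <-]; rewrite setTI; apply: open_measurable_rV.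
by apply: open_comp (interval_open _ _) => // x _; exact: cf.
Qed.

Lemma gauss_approx_continuous (R : realType) n (F : 'rV[R]_n -> R) (e : R) :
  continuous F -> (forall z, 0 <= F z) -> 0 < e ->
  \forall k \near \oo,
  (((F 0 - e) * @gauss_mass R n k.+1%:R)%:E
    <= \int[@lebesgue_rV R n]_z ((gauss_rV k.+1%:R z)%:E * (F z)%:E))%E.
Proof.
move=> cF F0 e0.
(* If [F 0 <= e], the left-hand side is at most 0. *)
have [c0|c0] := leP (F 0 - e) 0.
  apply: nearW => k; apply: (@le_trans _ _ 0%E).
    rewrite lee_fin mulr_le0_ge0// ltW// gauss_mass_gt0//.
  by apply: integral_ge0 => z _; rewrite mule_ge0// lee_fin ?expR_ge0.
(* Half of [e] is spent below [F 0], the other half as a relative error: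
   [c (1 - e / (2 c)) = F 0 - e]. *)
pose c := F 0 - e / 2.
have cp : 0 < c by rewrite /c; lra.
have e1 : 0 < e / 2 / c by rewrite !divr_gt0.
have cc : c * (1 - e / 2 / c) = F 0 - e.
  by rewrite mulrBr mulr1 [X in _ - X]mulrC divfK ?gt_eqF// /c; lra.
have mF : measurable_fun setT (EFin \o F).
  by apply/measurable_EFinP; exact: continuous_measurable_rV.
have FE0 z : (0 <= (EFin \o F) z)%E by rewrite lee_fin.
have near0 : \forall z \near (0 : 'rV[R]_n), (c%:E < (EFin \o F) z)%E.
  have cF0 : c < F 0 by rewrite /c; lra.
  have : \forall z \near (0 : 'rV[R]_n), c < F z by exact: (cF 0 _ (lt_nbhsr cF0)).
  by apply: filterS => z; rewrite lte_fin.
have := gauss_approx_identity mF FE0 (ltW cp) e1 near0.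
by rewrite cc.
Qed.

(** * Symmetry of the measures [P t] *)

Section symmetry.
Context {R : realType} {n : nat}.
Local Notation lam := (@lebesgue_rV R n).
Variables (nu : {measure set 'rV[R]_n -> \bar R}) (P : R -> probability 'rV[R]_n R).
Hypothesis sg : levy_semigroup nu P.
Variables (t : R) (q : 'rV[R]_n -> \bar R).
Hypotheses (t0 : 0 < t) (Pq : is_density (P t) q).

Let mopp (A : set 'rV[R]_n) : measurable A -> measurable [set y | A (- y)].
Proof.
move=> mA; have := measurable_rV_subl 0 measurableT mA; rewrite setTI.
by congr measurable; apply/seteqP; split=> y /=; rewrite sub0r.
Qed.

Let fP (A : set 'rV[R]_n) : measurable A -> P t A \is a fin_num.
Proof. by move=> mA; exact: fin_num_measure. Qed.

Let shift (A : set 'rV[R]_n) (z : 'rV[R]_n) := fine (P t [set y | A (y - z)]).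

Let shift_continuous (A : set 'rV[R]_n) : measurable A -> continuous (shift A).
Proof.
move=> mA; have E (z : 'rV[R]_n) : [set y | A (y - z)] = [set y | [set w | A (- w)] (z - y)].
  by apply/seteqP; split=> y /=; rewrite opprB.
rewrite (_ : shift A = fun z : 'rV[R]_n => fine (P t [set y | [set w | A (- w)] (z - y)])).
  by have hc := continuous_reflect_density Pq (mopp mA); move=> z; exact: (hc z).
by apply/funext => z; rewrite /shift E.
Qed.

Let mshift (A : set 'rV[R]_n) (z : 'rV[R]_n) : measurable A -> measurable [set y | A (y - z)].
Proof.
move=> mA; have h : measurable_fun setT (fun y : 'rV[R]_n => y - z).
  by apply: measurable_fun_rVB.
by have := h measurableT _ mA; rewrite setTI.
Qed.

Let shiftE (A : set 'rV[R]_n) (z : 'rV[R]_n) : measurable A ->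
  (shift A z)%:E = P t [set y | A (y - z)].
Proof. by move=> mA; rewrite fineK// fP//; exact: mshift. Qed.

Let shift0 (A : set 'rV[R]_n) : shift A 0 = fine (P t A).
Proof.
rewrite /shift (_ : [set y | _] = A)//.
by apply/seteqP; split=> y /=; rewrite subr0.
Qed.

(** Gaussian averages are bounded from below only, so the inequality is extracted from a pair: [A]
    and the reflected complement [B]. The average for [B] equals that for the complement of [A], so
    the two averages add up to the total mass; hence [P t A + P t B <= 1 + e]. *)
Let symmetric_le (A : set 'rV[R]_n) : measurable A ->
  (P t A <= P t [set y | A (- y)%R])%E.
Proof.
move=> mA; have mCA : measurable (~` A) by exact: measurableC.
pose B := [set y : 'rV[R]_n | (~` A) (- y)].
have mB : measurable B by exact: mopp.
have PB : fine (P t B) = 1 - fine (P t [set y | A (- y)]).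
  rewrite (_ : B = ~` [set y | A (- y)])//.
  by rewrite probability_setC ?fineB ?fP//; exact: mopp.
rewrite -(fineK (fP mA)) -(fineK (fP (mopp mA))) lee_fin.
apply/ler_addgt0Pr => e e0; have e20 : 0 < e / 2 by rewrite divr_gt0.
have sge (C : set 'rV[R]_n) (z : 'rV[R]_n) : 0 <= shift C z by rewrite fine_ge0.
have := gauss_approx_continuous (shift_continuous mA) (sge A) e20.
have := gauss_approx_continuous (shift_continuous mB) (sge B) e20.
move=> /[swap] hA hB.
have [k [hAk hBk]] : exists k,
  (((shift A 0 - e / 2) * @gauss_mass R n k.+1%:R)%:E
    <= \int[lam]_z ((gauss_rV k.+1%:R z)%:E * (shift A z)%:E))%E /\
  (((shift B 0 - e / 2) * @gauss_mass R n k.+1%:R)%:E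
    <= \int[lam]_z ((gauss_rV k.+1%:R z)%:E * (shift B z)%:E))%E.
  by have [k _ /(_ k (leqnn _))] := filterI hA hB; exists k.
have k0 : 0 < k.+1%:R :> R by rewrite ltr0n.
have Z0 := @gauss_mass_gt0 R n _ k0.
pose I (C : set 'rV[R]_n) :=
  (\int[lam]_z ((gauss_rV k.+1%:R z)%:E * P t [set y | C (y - z)%R]))%E.
have IE C : measurable C ->
    (\int[lam]_z ((gauss_rV k.+1%:R z)%:E * (shift C z)%:E))%E = I C.
  by move=> mC; apply: eq_integral => z _; rewrite shiftE.
have IB : I B = I (~` A) by exact: (gauss_average_measureN sg k0 (ltW t0) mCA).
have msh C : measurable C ->
    measurable_fun setT (fun z => ((gauss_rV k.+1%:R z)%:E * P t [set y | C (y - z)%R])%E).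
  move=> mC; apply: emeasurable_funM.
    by apply/measurable_EFinP; exact: measurable_gauss_rV.
  rewrite (_ : (fun z => _) = EFin \o shift C).
    by apply/measurable_EFinP; apply: continuous_measurable_rV; exact: shift_continuous.
  by apply/funext => z; rewrite /= shiftE.
have Isum : (I A + I (~` A) = (@gauss_mass R n k.+1%:R)%:E)%E.
  rewrite -gauss_massE// -ge0_integralD//; last 4 first.
  - by move=> z _; rewrite mule_ge0// lee_fin expR_ge0.
  - exact: msh.
  - by move=> z _; rewrite mule_ge0// lee_fin expR_ge0.
  - exact: msh.
  apply: eq_integral => z _; rewrite -ge0_muleDr//.
  rewrite -[RHS]mule1; congr (_ * _)%E.
  rewrite (_ : [set y | (~` A) (y - z)] = ~` [set y | A (y - z)])//.
  rewrite probability_setC; last exact: mshift.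
  by rewrite addeC subeK// fP//; exact: mshift.
have I0 C : (0 <= I C)%E.
  by apply: integral_ge0 => z _; rewrite mule_ge0// lee_fin expR_ge0.
move: hAk hBk; rewrite !IE// IB !shift0 PB.
have fI : I A \is a fin_num /\ I (~` A) \is a fin_num.
  rewrite !ge0_fin_numE//; split.
    by apply: (@le_lt_trans _ _ (I A + I (~` A))%E); rewrite ?leeDl// Isum ltry.
  by apply: (@le_lt_trans _ _ (I A + I (~` A))%E); rewrite ?leeDr// Isum ltry.
move: Isum; rewrite -(fineK fI.1) -(fineK fI.2) -EFinD !lee_fin => -[Isum] hA' hB'.
have : (fine (P t A) - e / 2 + (1 - fine (P t [set y | A (- y)]) - e / 2)) *
    @gauss_mass R n k.+1%:R <= 1 * @gauss_mass R n k.+1%:R.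
  by rewrite mulrDl mul1r -[leRHS]Isum lerD.
by rewrite ler_pM2r//; lra.
Qed.

Lemma semigroup_symmetric (A : set 'rV[R]_n) : measurable A ->
  P t [set y | A (- y)] = P t A.
Proof.
move=> mA; apply/eqP; rewrite eq_le (symmetric_le mA) andbT.
apply: (le_trans (symmetric_le (mopp mA))).
by rewrite (_ : [set y | _] = A)//; apply/seteqP; split=> y /=; rewrite opprK.
Qed.

Lemma ge0_integral_semigroup_opp (f : 'rV[R]_n -> \bar R) :
  measurable_fun setT f -> (forall y, 0 <= f y)%E ->
  (\int[P t]_y f (- y)%R = \int[P t]_y f y)%E.
Proof.
move=> mf f0.
have mo : measurable_fun setT (-%R : 'rV[R]_n -> 'rV[R]_n).
  rewrite (_ : -%R = fun x : 'rV[R]_n => 0 - x); first exact: measurable_rV_subl.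
  by apply/funext => x; rewrite sub0r.
have <- : (\int[pushforward (P t) -%R]_y f y = \int[P t]_y f y)%E.
  apply: eq_measure_integral => A mA _; exact: semigroup_symmetric.
by rewrite (ge0_integral_pushforward mo (P t) measurableT).
Qed.

End symmetry.

(** * Pointwise bound by tilting *)

(** Doubling the product, instead of halving the squares, keeps infinite values harmless. *)
Lemma mule_le_sqr (R : realType) (x y : \bar R) : (0 <= x)%E -> (0 <= y)%E ->
  (x * y + x * y <= x * x + y * y)%E.
Proof.
move: x y => [x| |] [y| |] //= x0 y0; rewrite ?mulyy ?addye ?addey ?leey//.
rewrite -!EFinM -!EFinD lee_fin; have := sqr_ge0 (x - y); nra.
Qed.

Section transition_density.
Context {R : realType} {n : nat}.
Local Notation lam := (@lebesgue_rV R n).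
Variables (nu : {measure set 'rV[R]_n -> \bar R}) (P : R -> probability 'rV[R]_n R)
  (p : R -> 'rV[R]_n -> \bar R).
Hypotheses (sg : levy_semigroup nu P) (td : transition_density P p).
Implicit Types (s t m : R) (x : 'rV[R]_n).

Let dens t : 0 < t -> is_density (P t) (p t). Proof. by have [h _] := td; exact: h. Qed.

Let mp t : 0 < t -> measurable_fun setT (p t). Proof. by move=> /dens[]. Qed.

Let p0 t x : 0 < t -> (0 <= p t x)%E. Proof. by move=> /dens[]. Qed.

Let mpsub t x : 0 < t -> measurable_fun setT (fun y : 'rV[R]_n => p t (x - y)).
Proof. by move=> t0; exact: (measurableT_comp (mp t0) (measurable_rV_subl x)). Qed.

Let CK s x : 0 < s ->
  (p (s + s) x = \int[lam]_y (p s (x - y)%R * p s y))%E.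
Proof. by move=> s0; have [_ h] := td; exact: h. Qed.

Lemma density_convolution s x : 0 < s ->
  (p (s + s) x = \int[P s]_y p s (x - y)%R)%E.
Proof.
move=> s0; rewrite CK// (ge0_integral_density (dens s0))//; first exact: mpsub.
by move=> y; exact: p0.
Qed.

(** Chapman-Kolmogorov gives the integral of [p s (- y)] against [P s], and the symmetry of [P s]
    removes the sign. *)
Let density_sqr s : 0 < s -> (p (s + s) 0 = \int[lam]_y (p s y * p s y))%E.
Proof.
move=> s0; rewrite density_convolution//.
rewrite -(ge0_integral_density (dens s0) (mp s0) (fun y => p0 y s0)).
rewrite -(ge0_integral_semigroup_opp sg s0 (dens s0) (mp s0) (fun y => p0 y s0)).
by apply: eq_integral => y _; rewrite sub0r.
Qed.

(** With [f = p s], [2 f(x - y) f(y) <= f(x - y)^2 + f(y)^2], and both squares integrate to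
    [p (s + s) 0], the first one by invariance under [y -> x - y]. *)
Lemma density_le_density0 s x : 0 < s -> (p (s + s) x <= p (s + s) 0%R)%E.
Proof.
move=> s0; set b := p (s + s) 0.
have mpp : measurable_fun setT (fun y : 'rV[R]_n => p s y * p s y)%E.
  by apply: emeasurable_funM; exact: mp.
have mss : measurable_fun setT (fun y : 'rV[R]_n => p s (x - y) * p s (x - y))%E.
  by apply: emeasurable_funM; exact: mpsub.
have mps : measurable_fun setT (fun y : 'rV[R]_n => p s (x - y) * p s y)%E.
  by apply: emeasurable_funM; [exact: mpsub|exact: mp].
have ge y z : (0 <= p s y * p s z)%E by rewrite mule_ge0// p0.
have bE : (\int[lam]_y (p s (x - y) * p s (x - y)) = b)%E.
  rewrite /b density_sqr//.
  by rewrite (@ge0_integral_rV_sub _ _ x (fun y : 'rV[R]_n => p s y * p s y)%E).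
have : (p (s + s) x + p (s + s) x <= b + b)%E.
  rewrite CK// -{1}bE /b density_sqr// -!ge0_integralD//.
  apply: ge0_le_integral => //.
  - by move=> y _; rewrite adde_ge0.
  - exact: emeasurable_funD.
  - exact: emeasurable_funD.
  - by move=> y _; apply: mule_le_sqr; exact: p0.
by apply: contraLR; rewrite -!ltNge => h; rewrite lteD.
Qed.

Lemma gauss_smooth_density m t x : 0 < m -> 0 < t ->
  ((gauss_smooth P m t x)%:E = \int[lam]_z ((gauss_rV m z)%:E * p t (x - z)%R))%E.
Proof.
move=> m0 t0; rewrite gauss_smoothE// (ge0_integral_density (dens t0)); last 2 first.
- apply/measurable_EFinP.
  exact: (measurableT_comp (measurable_gauss_rV m) (measurable_rV_subl x)).
- by move=> y; rewrite lee_fin expR_ge0.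
rewrite -(@ge0_integral_rV_sub _ _ x
  (fun y : 'rV[R]_n => (gauss_rV m (x - y))%:E * p t y)%E).
- by apply: eq_integral => z _; rewrite subKr.
- apply: emeasurable_funM; last exact: mp.
  apply/measurable_EFinP.
  exact: (measurableT_comp (measurable_gauss_rV m) (measurable_rV_subl x)).
- by move=> y; rewrite mule_ge0 ?p0// lee_fin expR_ge0.
Qed.

Variable r0 : R.
Hypotheses (levy : symmetric_levy_measure nu)
  (supp : measure_support nu `<=` eball 0 r0).

(** If [p t 0] is infinite there is nothing to prove. Otherwise a real [c < p t x] stays below [p t]
    near [x], so the Gaussian averages at [x] are nearly [c] times the mass or more; the tilt bounds
    them by the average at 0, which is at most [p t 0] times the mass. *)
Lemma density_exponential_bound (xi : 'rV[R]_n) L t x : 0 < t ->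
  (forall j, (\int[nu]_(y in levy_shell r0 j)
     ((expR (dotv xi y) + expR (- dotv xi y)) / 2 - 1)%:E <= L%:E)%E) ->
  (p t x <= (expR (t * L - dotv xi x))%:E * p t 0%R)%E.
Proof.
move=> t0 hL.
have [s s0 ts] : exists2 s, 0 < s & t = s + s by exists (t / 2); lra.
have pt0 := p0 0 t0.
case E0 : (p t 0) pt0 => [b| |] // b0; last first.
  by rewrite gt0_muley ?leey// lte_fin expR_gt0.
rewrite lee_fin in b0.
set B := expR (t * L - dotv xi x) * b.
have B0 : 0 <= B by rewrite mulr_ge0 ?expR_ge0.
(* Working with reals [c] below [p t x] also covers [p t x = +oo]. *)
suff bound c : (c%:E < p t x)%E -> c <= B.
  rewrite -EFinM -/B leNgt; apply/negP => Bp.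
  case E : (p t x) Bp => [v| |] // Bp.
    have := bound ((B + v) / 2); rewrite E !lte_fin in Bp *.
    by move=> /(_ _); lra.
  by have := bound (B + 1); rewrite E ltry => /(_ isT); lra.
move=> cp; have [c0|c0] := leP c 0; first exact: le_trans c0 B0.
apply/ler_addgt0Pr => e e0.
have near0 : \forall z \near (0 : 'rV[R]_n), (c%:E < p t (x - z)%R)%E.
  have := @lower_semicontinuous_convolution _ _ _ _ (dens s0) _ x c (mp s0) (fun y => p0 y s0).
  rewrite -density_convolution// -ts => /(_ cp).
  move=> /nbhs_rV_box[d d0 dx]; apply: (filterS _ (rV_box_nbhs n d0)) => z zd.
  (* Semicontinuity speaks of [x + z]; the cube is symmetric, which gives [x - z]. *)
  have /dx : rV_box d (- z) by move=> i; rewrite mxE normrN.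
  by rewrite /= -density_convolution// -ts.
have mpt := mpsub x t0.
have ec0 : 0 < e / c by rewrite divr_gt0.
have approx := gauss_approx_identity mpt (fun z => p0 (x - z) t0) (ltW c0) ec0 near0.
(* The Gaussian cost [a |xi|^2] with [a = 1 / (4 (k + 1))] is [q / (k + 1)]. *)
pose q := dotv xi xi / 4.
have upper k : gauss_smooth P k.+1%:R t x <=
    expR (q / k.+1%:R + t * L - dotv xi x) * (b * @gauss_mass R n k.+1%:R).
  have k0 : 0 < k.+1%:R :> R by rewrite ltr0n.
  have a0 : 0 < (4 * k.+1%:R)^-1 :> R by rewrite invr_gt0 mulr_gt0.
  have := gauss_ft_levy_tilt levy supp x a0 (ltW t0) hL.
  rewrite !(gauss_ft_semigroup sg)// ?(ltW t0)// !(mulrCA _ (gauss_mass _)).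
  rewrite ler_pM2l ?gauss_mass_gt0// => h.
  have h0 : gauss_smooth P k.+1%:R t 0 <= b * @gauss_mass R n k.+1%:R.
    rewrite -lee_fin gauss_smooth_density// EFinM -gauss_massE//.
    rewrite -ge0_integralZl//; last 2 first.
    - by apply/measurable_EFinP; exact: measurable_gauss_rV.
    - by move=> z _; rewrite lee_fin expR_ge0.
    apply: ge0_le_integral => //.
    - by move=> z _; rewrite mule_ge0 ?p0// lee_fin expR_ge0.
    - apply: emeasurable_funM; last exact: mpsub.
      by apply/measurable_EFinP; exact: measurable_gauss_rV.
    - by apply: measurable_funeM; apply/measurable_EFinP; exact: measurable_gauss_rV.
    - move=> z _; rewrite muleC lee_wpmul2r ?lee_fin ?expR_ge0//.
      by rewrite -E0 ts; exact: density_le_density0.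
  rewrite -(ler_pM2l (expR_gt0 (dotv xi x))); apply: (le_trans h).
  rewrite [leRHS]mulrA -expRD; apply: ler_pM; rewrite ?expR_ge0//.
    by apply: Rintegral_ge0 => y _; exact: expR_ge0.
  rewrite ler_expR le_eqVlt; apply/orP; left; apply/eqP.
  by rewrite /q; field; rewrite gt_eqF.
have lim : expR (q / k.+1%:R + t * L - dotv xi x) * b @[k --> \oo] --> B.
  have c1 : q / k.+1%:R + t * L - dotv xi x @[k --> \oo] --> t * L - dotv xi x.
    rewrite -[X in _ --> X - _]add0r; apply: cvgB; last exact: cvg_cst.
    apply: cvgD; last exact: cvg_cst.
    by rewrite -(mulr0 q); apply: cvgM; [exact: cvg_cst|exact: cvg_harmonic].
  apply: cvgM; last exact: cvg_cst.
  exact: (continuous_cvg _ (@continuous_expR R _) c1).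
rewrite -lerBlDr; apply: (cvgr_to_ge lim); move: approx; apply: filterS => k.
have k0 : 0 < k.+1%:R :> R by rewrite ltr0n.
rewrite -gauss_smooth_density// lee_fin => /le_trans /(_ (upper k)).
rewrite mulrA ler_pM2r ?gauss_mass_gt0//; apply: le_trans.
by rewrite mulrBr mulr1 mulrCA divff ?mulr1 ?gt_eqF.
Qed.

End transition_density.

(** * Choice of the tilt *)

(** Both sides are even in [s], so [s >= 0] may be assumed, and then [0 <= 1 - expR (- s) <= s]. The
    bound [b] is left free to become [enorm xi * enorm y]. *)
Lemma cosh_sub1_le (R : realType) (s b : R) : `|s| <= b ->
  (expR s + expR (- s)) / 2 - 1 <= s ^+ 2 / 2 * expR b.
Proof.
have half (u : R) : 1 - expR (- u) <= u by have := expR_ge1Dx (- u); lra.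
wlog s0 : s / 0 <= s.
  move=> H; have [|s0] := leP 0 s; first exact: H.
  by move=> sb; rewrite -sqrrN (addrC (expR s)); have := H (- s); rewrite opprK normrN oppr_ge0 (ltW s0) => /(_ isT sb).
rewrite ger0_norm// => sb; apply: (@le_trans _ _ (s ^+ 2 / 2 * expR s)); last first.
  by rewrite ler_wpM2l ?ler_expR// divr_ge0 ?sqr_ge0.
(* [cosh s - 1 = e^s (1 - e^{-s})^2 / 2] *)
have e : expR s * expR (- s) = 1 by rewrite -expRD subrr expR0.
have -> : (expR s + expR (- s)) / 2 - 1 = (1 - expR (- s)) ^+ 2 / 2 * expR s.
  rewrite expr2.
  transitivity ((expR s - 2 * (expR s * expR (- s)) + (expR s * expR (- s)) * expR (- s)) / 2).
    by rewrite e; field.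
  by field.
rewrite ler_wpM2r ?expR_ge0// ler_wpM2r ?invr_ge0// lerXn2r ?nnegrE//.
by rewrite subr_ge0 -expR0 ler_expR oppr_le0.
Qed.

Section second_moment.
Context {R : realType} {n : nat}.
Variables (nu : {measure set 'rV[R]_n -> \bar R}) (r0 : R).
Hypotheses (levy : symmetric_levy_measure nu)
  (supp : measure_support nu `<=` eball 0 r0).

Lemma measurable_sqr_enorm :
  measurable_fun setT (fun y : 'rV[R]_n => (enorm y ^+ 2)%:E).
Proof. by apply/measurable_EFinP; apply: measurable_funX; exact: measurable_enorm. Qed.

(** On the ball, [|y|^2 <= (1 + r0^2) min (1, |y|^2)]. Finiteness ensures that the real-valued
    integral is the true second moment and not the value 0 that [fine] gives to [+oo]. *)
Lemma levy_second_moment_lty : (\int[nu]_y (enorm y ^+ 2)%:E < +oo)%E.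
Proof.
have [_ h _] := levy.
have sq0 (y : 'rV[R]_n) : (0 <= (enorm y ^+ 2)%:E)%E by rewrite lee_fin sqr_ge0.
have mU : measurable (\bigcup_j levy_shell r0 j : set 'rV[R]_n).
  by apply: bigcup_measurable => j _; exact: measurable_levy_shell.
have mmin : measurable_fun setT (fun y : 'rV[R]_n => (Num.min 1 (enorm y ^+ 2))%:E).
  apply/measurable_EFinP; apply: measurable_minr; first exact: measurable_cst.
  by apply: measurable_funX; exact: measurable_enorm.
have min0 (y : 'rV[R]_n) : (0 <= (Num.min 1 (enorm y ^+ 2))%:E)%E.
  by rewrite lee_fin le_min ler01 sqr_ge0.
rewrite (ge0_integral_levy_shells levy supp)//; last exact: measurable_sqr_enorm.
apply: (@le_lt_trans _ _
   (\int[nu]_(y in \bigcup_j levy_shell r0 j) ((1 + r0 ^+ 2)%:E * (Num.min 1 (enorm y ^+ 2))%:E))%E).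
  apply: ge0_le_integral => //.
  - exact: measurable_funTS measurable_sqr_enorm.
  - by apply: measurable_funTS; apply: measurable_funeM.
  - move=> y [j _ /andP[_ yr]]; rewrite -EFinM lee_fin.
    have y0 := enorm_ge0 y.
    have yr2 : enorm y ^+ 2 <= r0 ^+ 2.
      by rewrite lerXn2r ?nnegrE// ?ltW// (le_lt_trans y0 yr).
    have := sqr_ge0 (enorm y); have := sqr_ge0 r0.
    by rewrite minEle; case: ifP => _; nra.
rewrite ge0_integralZl ?lee_fin ?addr_ge0 ?sqr_ge0//; last first.
  exact: measurable_funTS mmin.
rewrite lte_mul_pinfty ?lee_fin ?addr_ge0 ?sqr_ge0//.
apply: le_lt_trans h; apply: ge0_subset_integral => //.
Qed.

Lemma levy_second_momentE :
  (\int[nu]_y (enorm y ^+ 2)%:E = (\int[nu]_y (enorm y ^+ 2)%R)%:E)%E.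
Proof.
rewrite /Rintegral fineK// ge0_fin_numE; first exact: levy_second_moment_lty.
by apply: integral_ge0 => y _; rewrite lee_fin sqr_ge0.
Qed.

(** The majorant [g] is left open for the two estimates: [expR (a * r0) * enorm y ^+ 2] when only
    the radius of the support is known, and the integrand of the exponential moment itself in the
    other case. *)
Lemma levy_shell_cosh_le (xi : 'rV[R]_n) (g : 'rV[R]_n -> R) j M :
  measurable_fun setT g -> (forall y, 0 <= g y) ->
  (forall y, enorm y < r0 -> enorm y ^+ 2 * expR (enorm xi * enorm y) <= g y) ->
  (\int[nu]_y (g y)%:E <= M%:E)%E ->
  (\int[nu]_(y in levy_shell r0 j)
    ((expR (dotv xi y) + expR (- dotv xi y)) / 2 - 1)%:E
      <= (enorm xi ^+ 2 / 2 * M)%:E)%E.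
Proof.
move=> mg g0 gle gM.
have xi2 : 0 <= enorm xi ^+ 2 / 2 by rewrite divr_ge0 ?sqr_ge0.
have mj := @measurable_levy_shell R n r0 j.
apply: (@le_trans _ _ (\int[nu]_(y in levy_shell r0 j) ((enorm xi ^+ 2 / 2)%:E * (g y)%:E))%E).
  apply: ge0_le_integral => //.
  - move=> y _; rewrite lee_fin.
    by have := expR_ge1Dx (dotv xi y); have := expR_ge1Dx (- dotv xi y); lra.
  - apply/measurable_EFinP; apply: measurable_funTS.
    apply: measurable_funB; last exact: measurable_cst.
    apply: measurable_funM; last exact: measurable_cst.
    apply: measurable_funD; first exact: measurable_exp_dotv.
    apply: measurableT_comp => //; apply: measurableT_comp => //.
    exact: measurable_dotvl.
  - apply: measurable_funeM; apply/measurable_EFinP; exact: measurable_funTS mg.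
  - move=> y /andP[_ yr]; rewrite -EFinM lee_fin.
    apply: (le_trans (cosh_sub1_le (dotv_le xi y))).
    apply: (@le_trans _ _ (enorm xi ^+ 2 / 2 * (enorm y ^+ 2 * expR (enorm xi * enorm y)))).
      rewrite mulrA ler_wpM2r ?expR_ge0// [leRHS]mulrAC ler_wpM2r ?invr_ge0// -exprMn.
      rewrite -[leLHS]real_normK ?num_real// lerXn2r ?nnegrE//.
      + by rewrite mulr_ge0 ?enorm_ge0.
      + exact: dotv_le.
    by rewrite ler_wpM2l// gle.
rewrite ge0_integralZl//; last 2 first.
- by apply/measurable_EFinP; exact: measurable_funTS mg.
- by move=> y _; rewrite lee_fin.
rewrite [leRHS]EFinM lee_wpmul2l ?lee_fin//; apply: le_trans gM.
apply: ge0_subset_integral => //.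
- exact/measurable_EFinP.
- by move=> y _; rewrite lee_fin.
Qed.

End second_moment.

(* With [h = ln u / 2] and [u = r0 s / (2 t m)] the tilt of length [h / r0]
   costs [t m h^2 e^h / (2 r0^2)], at most half of the gain [h s / r0],
   because [h <= 2 e^h]. *)
Lemma tilt_cost_le (R : realType) (r0 t m s : R) :
  0 < r0 -> 0 < t -> 0 < m -> 2 * expR 1 * m / r0 * t <= s ->
  let u := r0 * s / (2 * t * m) in let a := ln u / (2 * r0) in
  0 <= a /\
  t * (a ^+ 2 / 2 * (expR (a * r0) * m)) - a * s <= - (s / (4 * r0) * ln u).
Proof.
move=> r00 t0 m0 hs u a.
have d0 : 0 < 2 * t * m by rewrite !mulr_gt0.
(* The lower bound on [s] says exactly that [u >= e], whence [ln u >= 1]. *)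
have u1 : expR 1 <= u.
  rewrite /u ler_pdivlMr//; move: hs; rewrite mulrAC ler_pdivrMr//; lra.
have u0 : 0 < u := lt_le_trans (expR_gt0 1) u1.
set l := ln u.
have l1 : 1 <= l by rewrite /l -[leLHS]expRK ler_ln ?posrE ?expR_gt0.
have a0 : 0 <= a by rewrite divr_ge0 ?mulr_ge0 ?(ltW r00)// (le_trans ler01 l1).
split=> //.
have ar : a * r0 = l / 2 by rewrite /a -/l; field; rewrite gt_eqF.
have sE : s = 2 * t * m / r0 * (expR (l / 2) * expR (l / 2)).
  rewrite -expRD -splitr lnK ?posrE// /u; field; rewrite !gt_eqF//.
rewrite ar; set e := expR (l / 2) in sE *.
have e1 : l / 2 <= e by have := expR_ge1Dx (l / 2); rewrite -/e; lra.
have e0 : 0 < e by exact: expR_gt0.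
(* The exact difference between the two sides carries the factor [e - l / 4], which is positive
   since [l / 2 <= e]. *)
have -> : t * (a ^+ 2 / 2 * (e * m)) - a * s =
    - (s / (4 * r0) * l) - t * m / r0 ^+ 2 * l * e / 2 * (e - l / 4).
  by rewrite {}sE /a -/l; field; rewrite gt_eqF.
rewrite gerDl oppr_le0; apply: mulr_ge0; last by lra.
by rewrite !mulr_ge0 ?invr_ge0 ?exprn_ge0 ?(ltW e0) ?(ltW t0) ?(ltW m0) ?(ltW r00)//; lra.
Qed.

Theorem lemma4p2 (R : realType) (d : nat) (hd : (0 < d)%N)
    (nu : {measure set 'rV[R]_d -> \bar R})
    (P : R -> probability 'rV[R]_d R)
    (p : R -> 'rV[R]_d -> \bar R) :
  symmetric_levy_measure nu ->
  nu [set: 'rV[R]_d] = +oo%E ->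
  levy_semigroup nu P ->
  transition_density P p ->
  forall r0 : R, 0 < r0 ->
  measure_support nu `<=` eball 0 r0 ->
  let m0 := \int[nu]_y (enorm y ^+ 2) in
  (forall (t : R) (x : 'rV[R]_d), 0 < t ->
     2 * expR 1 * m0 / r0 * t <= enorm x ->
     (p t x <= (expR (- (enorm x / (4 * r0)
                         * ln (r0 * enorm x / (2 * t * m0)))))%:E
               * p t 0%R)%E)
  /\
  (forall M5 M6 : R, 0 < M5 -> 0 < M6 ->
     (forall xi : 'rV[R]_d, enorm xi <= M6 ->
        (\int[nu]_y (enorm y ^+ 2 * expR (enorm xi * enorm y))%:E
           <= M5%:E)%E) ->
     forall (t : R) (x : 'rV[R]_d), 0 < t ->
       enorm x <= 2 * M5 * M6 * t ->
       (p t x <= (expR (- (enorm x ^+ 2 / (4 * t * M5))))%:E * p t 0%R)%E).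
Proof.
move=> levy _ sg td r0 r00 supp m0.
have p00 t : 0 < t -> (0 <= p t 0%R)%E by move=> t0; have [/(_ t t0)[]] := td.
have bound xi L c t x : 0 < t ->
    (forall j, (\int[nu]_(y in levy_shell r0 j)
      ((expR (dotv xi y) + expR (- dotv xi y)) / 2 - 1)%:E <= L%:E)%E) ->
    t * L - dotv xi x <= c -> (p t x <= (expR c)%:E * p t 0%R)%E.
  move=> t0 hL hc.
  apply: (le_trans (density_exponential_bound sg td levy supp x t0 hL)).
  by rewrite lee_wpmul2r ?p00// lee_fin ler_expR.
split=> [t x t0 hx|M5 M6 M50 M60 hM t x t0 hx].
- have m00 : 0 <= m0 by apply: Rintegral_ge0 => y _; exact: sqr_ge0.
  (* If [m0 = 0], the quotient and its logarithm are 0 by convention; the claim becomes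
     [p t x <= p t 0], which the tilt 0 gives. *)
  have [mz|mn0] := eqVneq m0 0.
    rewrite mz mulr0 invr0 mulr0 ln0// mulr0 oppr0.
    apply: (@bound 0 0) => //; last by rewrite mulr0 (dotvC 0) dotv0r subr0.
    move=> j; rewrite integral0_eq// => y _.
    by rewrite (dotvC 0) dotv0r oppr0 expR0 -[1 + 1]/(2%:R) divff// subrr.
  have mp : 0 < m0 by rewrite lt_neqAle eq_sym mn0.
  have s0 : 0 < enorm x.
    by apply: lt_le_trans hx; rewrite !mulr_gt0 ?invr_gt0 ?expR_gt0.
  have [a0 cost] := tilt_cost_le r00 t0 mp hx.
  set a := ln _ / _ in a0 cost; clearbody a.
  (* Among the tilts of length [a] this one has the largest gain [dotv xi x], namely
     [a * enorm x]. *)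
  pose xi := (a / enorm x) *: x.
  have xia : enorm xi = a.
    by rewrite enormZ ger0_norm ?divr_ge0 ?enorm_ge0// divfK// gt_eqF.
  apply: (bound xi (a ^+ 2 / 2 * (expR (a * r0) * m0))) => //.
    move=> j; rewrite -xia.
    apply: (levy_shell_cosh_le (g := fun y => expR (a * r0) * enorm y ^+ 2)).
    + apply: measurable_funM => //; apply: measurable_funX; exact: measurable_enorm.
    + by move=> y; rewrite mulr_ge0 ?expR_ge0 ?sqr_ge0.
    + move=> y yr; rewrite mulrC ler_wpM2r ?sqr_ge0// ler_expR xia.
      by rewrite ler_wpM2l// ltW.
    + under eq_integral do rewrite EFinM.
      rewrite ge0_integralZl//; last 2 first.
      * exact: measurable_sqr_enorm.
      * by move=> y _; rewrite lee_fin sqr_ge0.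
      by rewrite (levy_second_momentE levy supp) xia.
  have -> : dotv xi x = a * enorm x.
    by rewrite dotvZl -sqr_enorm expr2 mulrA divfK// gt_eqF.
  exact: cost.
- have q0 : 0 < 2 * t * M5 by rewrite !mulr_gt0.
  (* The length of this tilt is at most [M6] precisely when [enorm x <= 2 * M5 * M6 * t]. The cost
     [|x|^2 / (8 t M5)] and the gain [|x|^2 / (2 t M5)] leave at least the claimed
     [|x|^2 / (4 t M5)]. *)
  pose xi := (2 * t * M5)^-1 *: x.
  have xiE : enorm xi = enorm x / (2 * t * M5).
    by rewrite enormZ ger0_norm ?invr_ge0 ?(ltW q0)// mulrC.
  have xiM : enorm xi <= M6 by rewrite xiE ler_pdivrMr//; lra.
  apply: (bound xi (enorm xi ^+ 2 / 2 * M5)) => //.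
    move=> j.
    apply: (levy_shell_cosh_le
      (g := fun y => enorm y ^+ 2 * expR (enorm xi * enorm y))) => //.
    + apply: measurable_funM; first by apply: measurable_funX; exact: measurable_enorm.
      apply: measurableT_comp => //; apply: measurable_funM => //; exact: measurable_enorm.
    + by move=> y; rewrite mulr_ge0 ?expR_ge0 ?sqr_ge0.
    + exact: hM.
  rewrite xiE dotvZl -sqr_enorm.
  have -> : t * ((enorm x / (2 * t * M5)) ^+ 2 / 2 * M5) -
      (2 * t * M5)^-1 * enorm x ^+ 2 =
      - (enorm x ^+ 2 / (4 * t * M5)) - enorm x ^+ 2 / (8 * t * M5).
    by field; rewrite !gt_eqF.
  by rewrite gerDl oppr_le0 divr_ge0 ?sqr_ge0// !mulr_ge0 ?(ltW t0) ?(ltW M50).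
Qed.
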